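(* In every model of $\mathbf{ZF}+\mathbf{QPKW}(\infty,<\aleph_0)$, the following conditions are all equivalent: (i) $\mathbf{IQDI}$; (ii) every infinite zero-dimensional Hausdorff space admits a denumerable cellular family; (iii) every infinite Hausdorff space admits a denumerable cellular family; (iv) every infinite Tychonoff space has a denumerable cellular family; (v) for every infinite set $X$, every infinite subspace of the Tychonoff cube $[0,1]^X$ admits a denumerable cellular family; (vi) every infinite Hausdorff space has a regular matrix.
   Context: The base theory is $\mathbf{ZF}$, with no form of the axiom of choice assumed beyond what is stated. A set is infinite if it is not equipotent with any $n\in\omega$, denumerable if it is equipotent with $\omega$, and countable if it is equipotent with a subset of $\omega$. $\mathbf{IQDI}$: for every infinite set $X$, the set $[X]^{<\omega}$ of all finite subsets of $X$ has a denumerable subset. $\mathbf{QPKW}(\infty,<\aleph_0)$: for every infinite set $J$ and every family $\{A_j: j\in J\}$ of finite sets such that $|A_j|\ge 2$ for every $j\in J$, if $J$ is a countable union of finite sets, then there exist an infinite subset $I$ of $J$ and a family $\{B_j: j\in I\}$ of non-empty sets such that, for every $j\in I$, $B_j$ is a proper subset of $A_j$. A cellular family of a topological space is a set of pairwise disjoint non-empty open subsets of it. A space is zero-dimensional if it has a base of clopen sets. A set $U$ is regular open in $\mathbf{X}$ if $U=int(\overline{U})$. A regular matrix of $\mathbf{X}$ is a collection $\{\mathcal{C}_n: n\in\mathbb{N}\}$ of finite cellular families of $\mathbf{X}$ such that $\mathcal{C}_m\neq\mathcal{C}_n$ whenever $m\ne n$ and, for each $n\in\mathbb{N}$, all members of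 $\mathcal{C}_n$ are regular open and $\bigcup\mathcal{C}_n$ is dense in $\mathbf{X}$. *)

(* Defs.v *)
(* The setting is that of arbitrary models of first-order ZF, so
   every set-theoretic notion below is interpreted inside a structure (M, ∈):
   all quantifiers over sets range over the elements of M.  A predicate
   M -> Prop plays the role of a class of M; each one used below is
   first-order definable over (M, ∈) with parameters. *)

Set Implicit Arguments.
Unset Strict Implicit.

Record set_structure := SetStructure {
  carrier :> Type;
  mem : carrier -> carrier -> Prop
}.

Notation "x ∈ a" := (mem x a) (at level 70, no associativity).
Notation "x ∉ a" := (~ mem x a) (at level 70, no associativity).

(* First-order formulas of the language {∈, =}, with de Bruijn variables: [fAll]
   binds variable 0 of its body. *)
Inductive formula :=
  | fMem (i j : nat)
  | fEq (i j : nat)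
  | fFalse
  | fImp (p q : formula)
  | fAll (p : formula).

Definition scons (T : Type) (x : T) (e : nat -> T) (i : nat) : T :=
  match i with O => x | S k => e k end.

Fixpoint sat (M : set_structure) (e : nat -> M) (p : formula) : Prop :=
  match p with
  | fMem i j => e i ∈ e j
  | fEq i j => e i = e j
  | fFalse => False
  | fImp q r => sat e q -> sat e r
  | fAll q => forall x : M, sat (scons x e) q
  end.

Section InModel.
Context {M : set_structure}.
Implicit Types a b c f p q s t u v w x y z : M.

(* The set [a] is the extension of the class [P], i.e. a = {x | P x}. *)
Definition extension_of a (P : M -> Prop) : Prop := forall x, x ∈ a <-> P x.
Local Notation "a ≐ P" := (extension_of a P) (at level 70).

Definition subset a b : Prop := forall x, x ∈ a -> x ∈ b.
Local Notation "a ⊆ b" := (subset a b) (at level 70).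

Definition nonempty a : Prop := exists x, x ∈ a.
Definition disjoint a b : Prop := forall x, x ∈ a -> x ∉ b.

Definition is_empty a : Prop := a ≐ fun _ => False.
Definition is_upair p a b : Prop := p ≐ fun x => x = a \/ x = b.
Definition is_union u a : Prop := u ≐ fun x => exists y, y ∈ a /\ x ∈ y.
Definition is_inter c a b : Prop := c ≐ fun x => x ∈ a /\ x ∈ b.
Definition is_diff c a b : Prop := c ≐ fun x => x ∈ a /\ x ∉ b.
Definition is_power p a : Prop := p ≐ fun x => x ⊆ a.
Definition is_succ s a : Prop := s ≐ fun x => x ∈ a \/ x = a.

Definition inductive_set w : Prop :=
  (exists e, is_empty e /\ e ∈ w) /\
  (forall x, x ∈ w -> exists s, is_succ s x /\ s ∈ w).

Definition is_omega w : Prop :=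
  inductive_set w /\ forall v, inductive_set v -> w ⊆ v.

(* Kuratowski pairs *)
Definition is_opair p a b : Prop :=
  exists s t, is_upair s a a /\ is_upair t a b /\ is_upair p s t.

Definition is_product c a b : Prop :=
  c ≐ fun p => exists x y, x ∈ a /\ y ∈ b /\ is_opair p x y.

(* [maps f x y] is f(x) = y when [f] is a function of the model. *)
Definition maps f x y : Prop := exists p, is_opair p x y /\ p ∈ f.

(* [f] is a function with domain [J], i.e. a family indexed by [J]. *)
Definition is_family f (J : M) : Prop :=
  (forall p, p ∈ f -> exists x y, x ∈ J /\ is_opair p x y) /\
  (forall x, x ∈ J -> exists! y, maps f x y).

Definition is_function f a b : Prop :=
  is_family f a /\ forall x y, maps f x y -> y ∈ b.

Definition injective f : Prop :=
  forall x x' y, maps f x y -> maps f x' y -> x = x'.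

Definition is_injection f a b : Prop := is_function f a b /\ injective f.

Definition is_bijection f a b : Prop :=
  is_injection f a b /\ forall y, y ∈ b -> exists x, maps f x y.

Definition equipotent a b : Prop := exists f, is_bijection f a b.

Definition finite a : Prop :=
  exists w n, is_omega w /\ n ∈ w /\ equipotent a n.
Definition infinite a : Prop := ~ finite a.
Definition denumerable a : Prop := exists w, is_omega w /\ equipotent a w.
Definition countable a : Prop :=
  exists w b, is_omega w /\ b ⊆ w /\ equipotent a b.

Definition at_least_two a : Prop := exists x y, x ∈ a /\ y ∈ a /\ x <> y.

Definition countable_union_of_finite_sets a : Prop :=
  exists c, countable c /\ (forall x, x ∈ c -> finite x) /\ is_union a c.

Implicit Types X Y T F U V W : M.

Definition is_topology X T : Prop :=
  (forall U, U ∈ T -> U ⊆ X) /\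
  (forall U, is_empty U -> U ∈ T) /\
  X ∈ T /\
  (forall U V W, U ∈ T -> V ∈ T -> is_inter W U V -> W ∈ T) /\
  (forall F U, F ⊆ T -> is_union U F -> U ∈ T).

(* [T] is the topology on [X] having the members of the class [S] as a subbase. *)
Definition generated_topology X T (S : M -> Prop) : Prop :=
  is_topology X T /\
  (forall U, S U -> U ∈ T) /\
  (forall T', is_topology X T' -> (forall U, S U -> U ∈ T') -> T ⊆ T').

Definition is_subspace Y (TY : M) X T : Prop :=
  Y ⊆ X /\ TY ≐ fun W => exists U, U ∈ T /\ is_inter W U Y.

Definition closed_in X T F : Prop :=
  F ⊆ X /\ forall U, is_diff U X F -> U ∈ T.

Definition clopen X T U : Prop := U ∈ T /\ closed_in X T U.

Definition closure X T (A : M -> Prop) : M -> Prop :=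
  fun x => x ∈ X /\ forall U, U ∈ T -> x ∈ U -> exists y, y ∈ U /\ A y.

Definition interior T (A : M -> Prop) : M -> Prop :=
  fun x => exists U, U ∈ T /\ x ∈ U /\ forall y, y ∈ U -> A y.

Definition regular_open X T U : Prop :=
  U ≐ interior T (closure X T (fun x => x ∈ U)).

Definition dense X T (A : M -> Prop) : Prop :=
  forall x, x ∈ X -> closure X T A x.

Definition is_base T (B : M) : Prop :=
  B ⊆ T /\
  forall U, U ∈ T -> U ≐ fun x => exists V, V ∈ B /\ V ⊆ U /\ x ∈ V.

Definition zero_dimensional X T : Prop :=
  exists B, is_base T B /\ forall U, U ∈ B -> clopen X T U.

Definition T1_space X T : Prop :=
  forall x y, x ∈ X -> y ∈ X -> x <> y -> exists U, U ∈ T /\ x ∈ U /\ y ∉ U.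

Definition hausdorff X T : Prop :=
  forall x y, x ∈ X -> y ∈ X -> x <> y ->
  exists U V, U ∈ T /\ V ∈ T /\ x ∈ U /\ y ∈ V /\ disjoint U V.

Definition continuous f X T (TY : M) : Prop :=
  forall V U, V ∈ TY -> U ≐ (fun x => x ∈ X /\ exists y, maps f x y /\ y ∈ V) ->
  U ∈ T.

(* The unit interval is built by Dedekind cuts.  A fraction is an ordered pair
   (m, n) of natural numbers with m < n; it denotes the rational m/n of [0,1). *)
Definition fraction p : Prop :=
  exists w m n, is_omega w /\ n ∈ w /\ m ∈ n /\ is_opair p m n.

(* m/n <= m'/n'  iff  m n' <= m' n  iff  |m × n'| <= |m' × n|. *)
Definition fraction_le p q : Prop :=
  exists m n m' n' a b f,
    is_opair p m n /\ is_opair q m' n' /\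
    is_product a m n' /\ is_product b m' n /\ is_injection f a b.

(* The real r of [0,1] is the set of all fractions (m, n) with m/n < r; thus
   0 is the empty set and 1 is the set of all fractions. *)
Definition unit_real c : Prop :=
  (forall p, p ∈ c -> fraction p) /\
  (forall p q, p ∈ c -> fraction q -> fraction_le q p -> q ∈ c) /\
  (forall p, p ∈ c -> exists q, q ∈ c /\ ~ fraction_le q p).

Definition real_lt x y : Prop := x ⊆ y /\ x <> y.
Definition real_zero x : Prop := is_empty x.
Definition real_one x : Prop := x ≐ fraction.

(* [I] is the set [0,1] and [TI] its usual (order) topology. *)
Definition is_unit_interval (I TI : M) : Prop :=
  I ≐ unit_real /\
  generated_topology I TI (fun U => exists a, a ∈ I /\
    (U ≐ (fun x => x ∈ I /\ real_lt x a) \/ U ≐ (fun x => x ∈ I /\ real_lt a x))).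

Definition completely_regular X T : Prop :=
  forall x F, x ∈ X -> closed_in X T F -> x ∉ F ->
  exists I TI f, is_unit_interval I TI /\ is_function f X I /\
    continuous f X T TI /\
    (forall y, maps f x y -> real_zero y) /\
    (forall z y, z ∈ F -> maps f z y -> real_one y).

Definition tychonoff X T : Prop := T1_space X T /\ completely_regular X T.

(* [C] is the set [0,1]^X of all functions from X to [0,1], and [TC] the product
   topology: its subbase consists of the sets {f | f(x) ∈ V}, V open in [0,1]. *)
Definition is_tychonoff_cube X (C TC : M) : Prop :=
  exists I TI, is_unit_interval I TI /\
    (C ≐ fun f => is_function f X I) /\
    generated_topology C TC (fun U => exists x V, x ∈ X /\ V ∈ TI /\
      U ≐ fun f => f ∈ C /\ exists y, maps f x y /\ y ∈ V).

Definition cellular_family T F : Prop :=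
  F ⊆ T /\ (forall U, U ∈ F -> nonempty U) /\
  (forall U V, U ∈ F -> V ∈ F -> U <> V -> disjoint U V).

Definition has_denumerable_cellular_family T : Prop :=
  exists F, cellular_family T F /\ denumerable F.

(* A regular matrix is encoded as an injective function [c] with domain ω,
   n being mapped to the n-th cellular family. *)
Definition regular_matrix X T c : Prop :=
  exists w, is_omega w /\ is_family c w /\ injective c /\
  forall n F, maps c n F ->
    finite F /\ cellular_family T F /\
    (forall U, U ∈ F -> regular_open X T U) /\
    dense X T (fun x => exists U, U ∈ F /\ x ∈ U).

Definition has_regular_matrix X T : Prop := exists c, regular_matrix X T c.

End InModel.

Notation "a ≐ P" := (extension_of a P) (at level 70).
Notation "a ⊆ b" := (subset a b) (at level 70).

(* Separation and Replacement are the first-order schemas; the environment [e]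
   supplies the parameters of the formula. *)
Record is_ZF_model (M : set_structure) : Prop := {
  zf_extensionality : forall a b : M, (forall x, x ∈ a <-> x ∈ b) -> a = b;
  zf_foundation : forall a : M, nonempty a -> exists x, x ∈ a /\ disjoint x a;
  zf_pairing : forall a b : M, exists p, is_upair p a b;
  zf_union : forall a : M, exists u, is_union u a;
  zf_power : forall a : M, exists p, is_power p a;
  zf_infinity : exists w : M, inductive_set w;
  zf_separation : forall (phi : formula) (e : nat -> M) (a : M),
    exists b : M, b ≐ fun x => x ∈ a /\ sat (scons x e) phi;
  zf_replacement : forall (phi : formula) (e : nat -> M) (a : M),
    (forall x y y', x ∈ a -> sat (scons x (scons y e)) phi ->
       sat (scons x (scons y' e)) phi -> y = y') ->
    exists b : M, b ≐ fun y => exists x, x ∈ a /\ sat (scons x (scons y e)) phi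
}.

Definition IQDI (M : set_structure) : Prop :=
  forall X : M, infinite X ->
  exists D : M, denumerable D /\ forall s, s ∈ D -> s ⊆ X /\ finite s.

Definition QPKW (M : set_structure) : Prop :=
  forall J A : M, infinite J -> is_family A J ->
  (forall j a, maps A j a -> finite a /\ at_least_two a) ->
  countable_union_of_finite_sets J ->
  exists I B : M, I ⊆ J /\ infinite I /\ is_family B I /\
    forall j a b, maps A j a -> maps B j b -> nonempty b /\ b ⊆ a /\ b <> a.

(* Main.v *)
(* IQDI, applied to the infinite set of regular open sets of an infinite Hausdorff space, yields
   an increasing sequence of finite sets of regular open sets; the atoms of the finite algebras
   they generate are the terms of a regular matrix.  These atoms form a tree with finite levels,
   and QPKW, applied to the nodes having at least two children, cuts infinitely many nodes in two
   definably.  Starting with the whole space, one repeatedly cuts an open set along the least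
   available level, keeps a half that still contains infinitely many cut nodes, and puts the
   other half into the cellular family.

   Conversely, given an infinite set X, let Y be the set of functions from X to {0,1} as a
   zero-dimensional subspace of [0,1]^X.  For a regular open subset U of Y and a natural number n, only finitely
   many conditions of size at most n are minimal among the finite partial functions whose cylinder
   is contained in U, and the minimal conditions determine U.  Hence an injective sequence of
   finite sets of regular open subsets of Y produces infinitely many finite supports, which are
   finite subsets of X indexed by the natural numbers.

   All constructions take place inside a model of first-order ZF, so each use of Separation or
   Replacement needs a formula.  The tactic [dfn] synthesizes it from the Rocq expression. *)

From Stdlib Require Import Classical ClassicalEpsilon FunctionalExtensionality Arith Lia.
Require Import Defs.

Set Implicit Arguments.
Unset Strict Implicit.

Existing Class is_ZF_model.

(** * Definability *)

(** The obstacle throughout is that no infinite family of choices may be made inside the model.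
    Picking one child of each splitting node, or one basic set inside each member of a cellular
    family, would be such a choice. Hence the cut at a level is the union of all selected children
    of all selected nodes of that level, and an open set is represented by all of its minimal
    conditions up to a size bound. Where one object has to be taken, it is the least suitable
    natural number or is fixed by a case distinction. The epsilon operator of Rocq only names sets
    that extensionality already makes unique.

    Regular open sets are used because they contain every open set in which they are dense. So they
    can be recovered from the atoms inside them, and a cylinder not contained in one has a smaller
    nonempty cylinder that misses it altogether. For arbitrary open sets the latter fails: the set
    of functions to {0,1} taking the value 1 somewhere has one minimal condition of size 1 for every
    point of X. *)

Fixpoint rename (r : nat -> nat) (p : formula) : formula :=
  match p with
  | fMem i j => fMem (r i) (r j)
  | fEq i j => fEq (r i) (r j)
  | fFalse => fFalse
  | fImp p q => fImp (rename r p) (rename r q)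
  | fAll p => fAll (rename (fun i => match i with O => O | S k => S (r k) end) p)
  end.

Lemma sat_rename (M : set_structure) p : forall r (e : nat -> M),
  sat e (rename r p) <-> sat (fun i => e (r i)) p.
Proof.
  induction p as [| | |p IHp q IHq|p IHp]; intros r e; simpl; try tauto.
  - rewrite IHp, IHq; tauto.
  - assert (E : forall x : M,
      (fun i => scons x e (match i with O => O | S k => S (r k) end))
      = scons x (fun i => e (r i)))
      by (intros x; apply functional_extensionality; intros [|i]; reflexivity).
    split; intros H x; specialize (H x).
    + rewrite IHp, E in H; exact H.
    + rewrite IHp, E; exact H.
Qed.

Section Definability.
Context {M : set_structure}.
Notation env := (nat -> M).

(* Even positions hold the variables, odd positions the parameters. *)
Definition mix (v e : env) : env :=
  fun n => if Nat.even n then v (Nat.div2 n) else e (Nat.div2 n).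

Lemma mix_even v e i : mix v e (2 * i) = v i.
Proof.
  unfold mix. rewrite Nat.even_mul, Nat.div2_double. reflexivity.
Qed.

Lemma mix_odd v e i : mix v e (S (2 * i)) = e i.
Proof.
  unfold mix. rewrite Nat.even_succ, <- Nat.negb_even, Nat.even_mul, Nat.div2_succ_double.
  reflexivity.
Qed.

Lemma parity n : exists i, n = 2 * i \/ n = S (2 * i).
Proof.
  destruct (Nat.Even_or_Odd n) as [[i Hi]|[i Hi]]; exists i; lia.
Qed.

(* Predicates of an environment that are given by a formula with parameters; the variables are
   bound as de Bruijn indices, so that quantifiers of the model become quantifiers of Rocq over
   the first entry of the environment. *)
Definition definable (P : env -> Prop) : Prop :=
  exists phi e, forall v, P v <-> sat (mix v e) phi.

(** The graph of [t], with the value put in front at index 0. Substituting a term into a predicate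
    then costs one existential quantifier, as in [D_subst]. *)
Definition definable_term (t : env -> M) : Prop :=
  definable (fun w => w 0 = t (fun i => w (S i))).

(* Reindexing with separate control of variables and parameters: [rv] and [re]
   give the positions of variable and parameter number [i] in the new environment. *)
Definition pos (rv re : nat -> nat) (n : nat) : nat :=
  if Nat.even n then rv (Nat.div2 n) else re (Nat.div2 n).

Lemma sat_pos rv re phi (u v e : env) :
  (forall i, u (rv i) = v i) -> (forall i, u (re i) = e i) ->
  (sat u (rename (pos rv re) phi) <-> sat (mix v e) phi).
Proof.
  intros Hv He. rewrite sat_rename.
  replace (fun i => u (pos rv re i)) with (mix v e); [tauto|].
  apply functional_extensionality; intros n. unfold mix, pos.
  destruct (Nat.even n); symmetry; auto.
Qed.

Lemma D_ext (P Q : env -> Prop) : (forall v, P v <-> Q v) -> definable Q -> definable P.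
Proof.
  intros H (phi & e & K). exists phi, e. intros v. rewrite H. apply K.
Qed.

Lemma D_ren rho (P : env -> Prop) :
  definable P -> definable (fun v => P (fun i => v (rho i))).
Proof.
  intros (phi & e & K).
  exists (rename (pos (fun i => 2 * rho i) (fun i => S (2 * i))) phi), e. intros v.
  rewrite K. symmetry. apply sat_pos; intros i; [apply mix_even|apply mix_odd].
Qed.

(** The two formulas come with unrelated parameter lists. A second use of [mix] interleaves them,
    which avoids any bound on the number of parameters in use. *)
Lemma D_imp (P Q : env -> Prop) :
  definable P -> definable Q -> definable (fun v => P v -> Q v).
Proof.
  intros (phi & e & K) (psi & e' & K').
  exists (fImp (rename (pos (fun i => 2 * i) (fun i => S (2 * (2 * i)))) phi)
               (rename (pos (fun i => 2 * i) (fun i => S (2 * S (2 * i)))) psi)),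
    (mix e e'). intros v. rewrite K, K'.
  change (sat ?u (fImp ?a ?b)) with (sat u a -> sat u b).
  rewrite (@sat_pos _ _ phi _ v e), (@sat_pos _ _ psi _ v e'); [tauto| | | |];
    intros i; rewrite ?mix_even, ?mix_odd, ?mix_even, ?mix_odd; reflexivity.
Qed.

(** The new quantifier shifts every position of [mix v e] by one: the old variables move to odd
    positions and the parameters to even positions from 2 on. *)
Lemma D_all (P : env -> M -> Prop) :
  definable (fun w => P (fun i => w (S i)) (w 0)) -> definable (fun v => forall x, P v x).
Proof.
  intros (phi & e & K).
  exists (fAll (rename (pos (fun i => match i with O => O | S k => S (2 * k) end)
                            (fun i => S (S (2 * i)))) phi)), e.
  intros v. simpl sat.
  split; intros H x; specialize (H x).
  - rewrite sat_pos with (v := scons x v) (e := e).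
    + rewrite <- (K (scons x v)). exact H.
    + intros [|i]; [reflexivity|]. apply (mix_even v e i).
    + intros i. apply (mix_odd v e i).
  - rewrite sat_pos with (v := scons x v) (e := e) in H.
    + rewrite <- (K (scons x v)) in H. exact H.
    + intros [|i]; [reflexivity|]. apply (mix_even v e i).
    + intros i. apply (mix_odd v e i).
Qed.

Context {ZF : is_ZF_model M}.

Lemma model_inhabited : inhabited M.
Proof. destruct (zf_infinity ZF) as [w _]. exact (inhabits w). Qed.

Lemma D_False : definable (fun _ => False).
Proof.
  destruct model_inhabited as [x]. exists fFalse, (fun _ => x). intros v. simpl. tauto.
Qed.

Lemma D_not (P : env -> Prop) : definable P -> definable (fun v => ~ P v).
Proof. intros H. apply (D_imp H D_False). Qed.

Lemma D_True : definable (fun _ => True).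
Proof. apply D_ext with (fun _ => ~ False); [tauto|]. apply D_not, D_False. Qed.

(** By excluded middle a proposition that ignores the environment is equivalent to [True] or to
    [False], even if it quantifies over Rocq types. *)
Lemma D_const (P : Prop) : definable (fun _ => P).
Proof.
  destruct (classic P) as [H|H].
  - apply D_ext with (fun _ => True); [tauto|apply D_True].
  - apply D_ext with (fun _ => False); [tauto|apply D_False].
Qed.

Lemma D_and (P Q : env -> Prop) :
  definable P -> definable Q -> definable (fun v => P v /\ Q v).
Proof.
  intros H K. apply D_ext with (fun v => ~ (P v -> ~ Q v)); [intros v; tauto|].
  apply D_not, D_imp, D_not; assumption.
Qed.

Lemma D_or (P Q : env -> Prop) :
  definable P -> definable Q -> definable (fun v => P v \/ Q v).
Proof.
  intros H K. apply D_ext with (fun v => ~ P v -> Q v); [intros v; tauto|].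
  apply D_imp; [apply D_not|]; assumption.
Qed.

Lemma D_iff (P Q : env -> Prop) :
  definable P -> definable Q -> definable (fun v => P v <-> Q v).
Proof. intros H K. unfold iff. apply D_and; apply D_imp; assumption. Qed.

Lemma D_ex (P : env -> M -> Prop) :
  definable (fun w => P (fun i => w (S i)) (w 0)) -> definable (fun v => exists x, P v x).
Proof.
  intros H. apply D_ext with (fun v => ~ forall x, ~ P v x).
  - intros v. split; [firstorder|]. intros K. apply NNPP. firstorder.
  - apply D_not. apply (D_all (P := fun v x => ~ P v x)). apply D_not, H.
Qed.

Lemma D_ex_unique (P : env -> M -> Prop) :
  definable (fun w => P (fun i => w (S i)) (w 0)) -> definable (fun v => exists! x, P v x).
Proof.
  intros H. unfold unique. apply (D_ex (P := fun v x => P v x /\ forall x', P v x' -> x = x')).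
  apply D_and; [exact H|].
  apply (D_all (P := fun v x' => P (fun i => v (S i)) x' -> v 0 = x')).
  apply D_imp.
  - exact (D_ren (fun i => match i with O => O | S k => S (S k) end) H).
  - destruct model_inhabited as [x]. exists (fEq 2 0), (fun _ => x). intros v. simpl. tauto.
Qed.

Lemma DT_var n : definable_term (fun v => v n).
Proof.
  destruct model_inhabited as [x]. exists (fEq 0 (2 * S n)), (fun _ => x).
  intros v. cbn [sat]. rewrite mix_even. reflexivity.
Qed.

Lemma DT_const (c : M) : definable_term (fun _ => c).
Proof. exists (fEq 0 1), (fun _ => c). intros v. simpl. tauto. Qed.

Lemma D_subst (P : env -> M -> Prop) (t : env -> M) :
  definable_term t -> definable (fun w => P (fun i => w (S i)) (w 0)) ->
  definable (fun v => P v (t v)).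
Proof.
  intros Ht H. apply D_ext with (fun v => exists x, x = t v /\ P v x).
  - intros v. split; [eauto|]. intros (x & -> & K). exact K.
  - apply (D_ex (P := fun v x => x = t v /\ P v x)). apply D_and; assumption.
Qed.

Lemma DT_ren rho (t : env -> M) :
  definable_term t -> definable_term (fun v => t (fun i => v (rho i))).
Proof.
  intros H. exact (D_ren (fun i => match i with O => O | S k => S (rho k) end) H).
Qed.

Lemma D_subst2 (R : M -> M -> Prop) (a b : env -> M) :
  definable (fun w => R (w 0) (w 1)) -> definable_term a -> definable_term b ->
  definable (fun v => R (a v) (b v)).
Proof.
  intros H Ha Hb. apply (D_subst (P := fun v x => R x (b v)) Ha).
  apply (D_subst (P := fun v y => R (v 0) y)).
  - exact (DT_ren S Hb).
  - exact (D_ren (fun i => match i with O => 1 | S _ => 0 end) H).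
Qed.

Lemma D_mem (a b : env -> M) :
  definable_term a -> definable_term b -> definable (fun v => a v ∈ b v).
Proof.
  apply (D_subst2 (R := fun x y => x ∈ y)).
  destruct model_inhabited as [x]. exists (fMem 0 2), (fun _ => x). intros v. simpl. tauto.
Qed.

Lemma D_eq (a b : env -> M) :
  definable_term a -> definable_term b -> definable (fun v => a v = b v).
Proof.
  apply (D_subst2 (R := fun x y => x = y)).
  destruct model_inhabited as [x]. exists (fEq 0 2), (fun _ => x). intros v. simpl. tauto.
Qed.

Lemma D_pred (R : M -> Prop) (a : env -> M) :
  definable (fun w => R (w 0)) -> definable_term a -> definable (fun v => R (a v)).
Proof. intros H Ha. apply (D_subst (P := fun _ x => R x) Ha). exact H. Qed.

Lemma DT_subst (F : M -> M) (a : env -> M) :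
  definable_term (fun w => F (w 0)) -> definable_term a -> definable_term (fun v => F (a v)).
Proof.
  intros H Ha. apply (D_subst (P := fun v x => v 0 = F x) (DT_ren S Ha)).
  exact (D_ren (fun i => match i with O => 1 | S _ => 0 end) H).
Qed.

Lemma DT_subst2 (F : M -> M -> M) (a b : env -> M) :
  definable_term (fun w => F (w 0) (w 1)) -> definable_term a -> definable_term b ->
  definable_term (fun v => F (a v) (b v)).
Proof.
  intros H Ha Hb. apply (D_subst (P := fun v x => v 0 = F x (b (fun i => v (S i)))) (DT_ren S Ha)).
  apply (D_subst (P := fun v y => v 1 = F (v 0) y) (DT_ren (fun i => S (S i)) Hb)).
  exact (D_ren (fun i => match i with O => 2 | S O => 1 | _ => 0 end) H).
Qed.

Lemma set_eq (a b : M) : (forall x, x ∈ a <-> x ∈ b) -> a = b.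
Proof. apply (zf_extensionality ZF). Qed.

Lemma empty_exists : exists e : M, is_empty e.
Proof. destruct (zf_infinity ZF) as [w [[e [H _]] _]]. eauto. Qed.

(* The set with extension [P]; the empty set if [P] is a proper class, so that
   [setof] is a definable operation without side conditions. *)
Definition setof (P : M -> Prop) : M :=
  epsilon model_inhabited (fun a => a ≐ P \/ ((forall b, ~ b ≐ P) /\ is_empty a)).

Lemma setof_spec (P : M -> Prop) :
  setof P ≐ P \/ ((forall b, ~ b ≐ P) /\ is_empty (setof P)).
Proof.
  unfold setof. apply epsilon_spec.
  destruct (classic (exists b, b ≐ P)) as [[b H]|N].
  - exists b. left. exact H.
  - destruct empty_exists as [e He]. exists e. right. split; [|exact He]. firstorder.
Qed.

Lemma in_setof (P : M -> Prop) :
  (exists a, forall x, x ∈ a <-> P x) -> forall x, x ∈ setof P <-> P x.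
Proof.
  intros [a H]. destruct (setof_spec P) as [K|[N _]]; [exact K|]. elim (N a H).
Qed.

Lemma eq_setof (P : M -> Prop) (a : M) : (forall x, x ∈ a <-> P x) -> a = setof P.
Proof. intros H. apply set_eq. intros x. rewrite in_setof by eauto. apply H. Qed.

(** Extensionality leaves only one possible value in either case of [setof_spec], so the graph is
    first-order although [setof] is defined by [epsilon]. *)
Lemma DT_setof (P : env -> M -> Prop) :
  definable (fun w => P (fun i => w (S i)) (w 0)) -> definable_term (fun v => setof (P v)).
Proof.
  intros H.
  set (Q := fun (a : M) v => forall x, x ∈ a <-> P v x).
  apply D_ext with (fun w => Q (w 0) (fun i => w (S i)) \/
    ((forall b, ~ Q b (fun i => w (S i))) /\ forall x, x ∈ w 0 -> False)).
  - intros w. set (v := fun i => w (S i)). split.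
    + intros ->. destruct (setof_spec (P v)) as [K|[N K]]; [left; exact K|right].
      split; [exact N|]. intros x Hx. apply (K x), Hx.
    + intros [K|[N K]]; [apply eq_setof, K|].
      destruct (setof_spec (P v)) as [K'|[_ K']]; [elim (N _ K')|].
      apply set_eq. intros x. split; [intros Hx; elim (K _ Hx)|intros Hx; elim (proj1 (K' x) Hx)].
  - assert (HQ : forall rho, definable (fun w => Q (w 0) (fun i => w (S (rho i))))).
    { intros rho. apply (D_all (P := fun w x => x ∈ w 0 <-> P (fun i => w (S (rho i))) x)).
      apply D_iff; [apply D_mem; apply DT_var|].
      exact (D_ren (fun i => match i with O => O | S k => S (S (rho k)) end) H). }
    apply D_or; [exact (HQ (fun i => i))|]. apply D_and.
    + apply (D_all (P := fun w b => ~ Q b (fun i => w (S i)))). apply D_not. exact (HQ S).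
    + apply (D_all (P := fun w x => x ∈ w 0 -> False)).
      apply D_imp; [apply D_mem; apply DT_var|apply D_False].
Qed.

(** Variable 0 sits at position 0 of [mix], which is also where the schemas put their variable. So
    the formula is kept, and the remaining variables are packed with the parameters; [c] is a dummy
    for the position that is cut off. *)
Lemma sat_param (P : env -> Prop) :
  definable P -> forall v, exists phi e, forall x, P (scons x v) <-> sat (scons x e) phi.
Proof.
  intros (phi & e & K) v. exists phi.
  destruct model_inhabited as [c].
  exists (fun n => mix (scons c v) e (S n)). intros x. rewrite K.
  replace (mix (scons x v) e) with (scons x (fun n => mix (scons c v) e (S n))); [tauto|].
  apply functional_extensionality. intros n.
  destruct n as [|n]; [reflexivity|]. cbn [scons].
  destruct (parity (S n)) as [[|i] [E|E]]; rewrite E, ?mix_even, ?mix_odd; try reflexivity.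
  discriminate E.
Qed.

Lemma separation (P : M -> Prop) :
  definable (fun w => P (w 0)) -> forall a, exists b, forall x, x ∈ b <-> x ∈ a /\ P x.
Proof.
  intros H a. destruct (sat_param H (fun _ => a)) as (phi & e & K).
  destruct (zf_separation ZF phi e a) as [b Hb]. exists b. intros x.
  rewrite (Hb x), <- (K x). reflexivity.
Qed.

Lemma replacement (F : M -> M) :
  definable_term (fun w => F (w 0)) ->
  forall a, exists b, forall y, y ∈ b <-> exists x, x ∈ a /\ y = F x.
Proof.
  intros (phi & e & K) a.
  set (e' := mix (fun _ => a) e).
  (* The graph of [F] has its value at index 0 and its argument at index 1, whereas the Replacement
     schema puts the argument first; the renaming swaps them. *)
  set (psi := rename (pos (fun i => match i with O => 1 | S _ => 0 end) (fun i => S (S (S (2 * i))))) phi).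
  assert (E : forall x y, sat (scons x (scons y e')) psi <-> y = F x).
  { intros x y. unfold psi.
    rewrite sat_pos with (v := fun i => match i with O => y | S _ => x end) (e := e).
    - rewrite <- K. reflexivity.
    - intros [|i]; reflexivity.
    - intros i. simpl scons. apply mix_odd. }
  destruct (zf_replacement ZF (phi := psi) (e := e') (a := a)) as [b Hb].
  - intros x y y' _ H1 H2. apply E in H1, H2. congruence.
  - exists b. intros y. rewrite (Hb y). split; intros (x & Hx & H); exists x; split; trivial; apply E; trivial.
Qed.

End Definability.

(** * Set operations *)

Section SetOperations.
Context {M : set_structure} {ZF : is_ZF_model M}.
Implicit Types a b c f p q s t u x y z : M.

Definition bigcup a : M := setof (fun x => exists y, y ∈ a /\ x ∈ y).
(* The set satisfying [P], if there is exactly one. *)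
Definition the (P : M -> Prop) : M := bigcup (setof P).
Definition empty : M := setof (fun _ => False).
Definition upair a b : M := setof (fun x => x = a \/ x = b).
Definition sing a : M := setof (fun x => x = a).
Definition cup a b : M := setof (fun x => x ∈ a \/ x ∈ b).
Definition cap a b : M := setof (fun x => x ∈ a /\ x ∈ b).
Definition diff a b : M := setof (fun x => x ∈ a /\ x ∉ b).
Definition power a : M := setof (fun x => x ⊆ a).
Definition sep a (P : M -> Prop) : M := setof (fun x => x ∈ a /\ P x).
Definition img a (F : M -> M) : M := setof (fun y => exists x, x ∈ a /\ y = F x).
Definition opair a b : M := upair (sing a) (upair a b).
Definition prod a b : M := setof (fun p => exists x y, x ∈ a /\ y ∈ b /\ p = opair x y).
Definition succ a : M := cup a (sing a).
Definition omega : M := setof (fun n => forall w, inductive_set w -> n ∈ w).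
Definition lam a (F : M -> M) : M := img a (fun x => opair x (F x)).
Definition app f x : M := the (fun y => opair x y ∈ f).

End SetOperations.

(* Automatic synthesis of formulas *)
Create HintDb dfn.

Ltac dfn_app :=
  match goal with
  | |- definable (fun v => ?R (@?a v)) =>
      simple refine (@D_pred _ _ R _ _ _); [solve [eauto 2 with dfn nocore]|]
  | |- definable (fun v => ?R (@?a v) (@?b v)) =>
      simple refine (@D_subst2 _ _ R _ _ _ _ _); [solve [eauto 2 with dfn nocore]| |]
  | |- definable_term (fun v => ?F (@?a v)) =>
      simple refine (@DT_subst _ _ F _ _ _); [solve [eauto 2 with dfn nocore]|]
  | |- definable_term (fun v => ?F (@?a v) (@?b v)) =>
      simple refine (@DT_subst2 _ _ F _ _ _ _ _); [solve [eauto 2 with dfn nocore]| |]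
  end.

Ltac dfn_step :=
  cbv beta;
  lazymatch goal with
  | |- definable (fun _ => ?P) => apply (@D_const _ _ P)
  | |- definable (fun v => _ /\ _) => apply D_and
  | |- definable (fun v => _ \/ _) => apply D_or
  | |- definable (fun v => _ <-> _) => apply D_iff
  | |- definable (fun v => ~ _) => apply D_not
  | |- definable (fun v => exists x, _) => apply D_ex
  | |- definable (fun v => exists! x, _) => apply D_ex_unique
  | |- definable (fun v => @?A v -> @?B v) => apply D_imp
  | |- definable (fun v => forall x, _) => apply D_all
  | |- definable (fun v => _ ∈ _) => apply D_mem
  | |- definable (fun v => @eq (carrier _) _ _) => apply D_eq
  | |- definable_term (fun _ => ?c) => apply (@DT_const _ c)
  | |- definable_term (fun v : nat -> _ => v ?n) => apply (@DT_var _ _ n)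
  | |- definable_term (fun v => setof _) => apply DT_setof
  | |- definable_term (fun v => sep _ _) => unfold sep at 1
  | |- definable_term (fun v => img _ _) => unfold img at 1
  | |- definable_term (fun v => lam _ _) => unfold lam at 1
  | |- definable_term (fun v => the _) => unfold the at 1
  | _ => dfn_app
  end.

Ltac head_of t := lazymatch t with ?f _ => head_of f | _ => t end.

(* The head symbol of the body is exposed by applying the function to a dummy environment. *)
Ltac dfn_unfold :=
  let unfold_head M P :=
    (let t := eval cbv beta in (P (fun _ : nat => epsilon (@model_inhabited M _) (fun _ => True))) in
     let h := head_of t in progress (unfold h at 1)) in
  lazymatch goal with
  | |- @definable ?M ?P => unfold_head M P
  | |- @definable_term ?M ?P => unfold_head M P
  end.

Ltac dfn := repeat first [dfn_step | dfn_unfold]; fail.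

Section Sets.
Context {M : set_structure} {ZF : is_ZF_model M}.
Implicit Types a b c f p q s t u x y z : M.

(** As hints, these lemmas let [dfn_app] treat the operations and relations as primitive symbols, so
    that [dfn] does not unfold them down to membership at every use. *)
Lemma DT_bigcup : definable_term (fun v : nat -> M => bigcup (v 0)).
Proof. dfn. Qed.
Lemma DT_upair : definable_term (fun v : nat -> M => upair (v 0) (v 1)).
Proof. dfn. Qed.
Lemma DT_cup : definable_term (fun v : nat -> M => cup (v 0) (v 1)).
Proof. dfn. Qed.
#[local] Hint Resolve DT_bigcup DT_upair DT_cup : dfn.
Lemma DT_opair : definable_term (fun v : nat -> M => opair (v 0) (v 1)).
Proof. dfn. Qed.
#[local] Hint Resolve DT_opair : dfn.
Lemma DT_app : definable_term (fun v : nat -> M => app (v 0) (v 1)).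
Proof. dfn. Qed.
Lemma D_subset : definable (fun v : nat -> M => v 0 ⊆ v 1).
Proof. dfn. Qed.
Lemma D_inductive : definable (fun v : nat -> M => inductive_set (v 0)).
Proof. dfn. Qed.
Lemma D_equipotent : definable (fun v : nat -> M => equipotent (v 0) (v 1)).
Proof. dfn. Qed.
#[local] Hint Resolve D_equipotent : dfn.
Lemma D_finite : definable (fun v : nat -> M => finite (v 0)).
Proof. dfn. Qed.
End Sets.

#[export] Hint Resolve DT_bigcup DT_upair DT_cup DT_opair DT_app
  D_subset D_inductive D_equipotent D_finite : dfn.

Tactic Notation "set_ext" simple_intropattern(x) := apply set_eq; intros x.

Section Sets.
Context {M : set_structure} {ZF : is_ZF_model M}.
Implicit Types a b c f p q s t u x y z : M.

Lemma in_empty x : ~ x ∈ empty.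
Proof.
  unfold empty. rewrite in_setof; [tauto|]. destruct empty_exists as [e He].
  exists e. exact He.
Qed.

Lemma in_upair a b x : x ∈ upair a b <-> x = a \/ x = b.
Proof. unfold upair. rewrite in_setof; [reflexivity|]. exact (zf_pairing ZF a b). Qed.

Lemma in_sing a x : x ∈ sing a <-> x = a.
Proof.
  unfold sing. rewrite in_setof; [reflexivity|]. exists (upair a a). intros y. rewrite in_upair. tauto.
Qed.

Lemma in_bigcup a x : x ∈ bigcup a <-> exists y, y ∈ a /\ x ∈ y.
Proof. unfold bigcup. rewrite in_setof; [reflexivity|]. exact (zf_union ZF a). Qed.

Lemma in_cup a b x : x ∈ cup a b <-> x ∈ a \/ x ∈ b.
Proof.
  unfold cup. rewrite in_setof; [reflexivity|]. exists (bigcup (upair a b)). intros y. rewrite in_bigcup.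
  split; [intros (z & Hz & H); apply in_upair in Hz; destruct Hz; subst; auto|].
  intros [H|H]; eexists; rewrite in_upair; eauto.
Qed.

Lemma in_sep a (P : M -> Prop) (HP : definable (fun v => P (v 0))) x :
  x ∈ sep a P <-> x ∈ a /\ P x.
Proof. unfold sep. rewrite in_setof; [reflexivity|]. apply separation, HP. Qed.

Lemma in_cap a b x : x ∈ cap a b <-> x ∈ a /\ x ∈ b.
Proof. apply (@in_sep a (fun x => x ∈ b)). dfn. Qed.

Lemma in_diff a b x : x ∈ diff a b <-> x ∈ a /\ x ∉ b.
Proof. apply (@in_sep a (fun x => x ∉ b)). dfn. Qed.

Lemma in_power a x : x ∈ power a <-> x ⊆ a.
Proof. unfold power. rewrite in_setof; [reflexivity|]. exact (zf_power ZF a). Qed.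

Lemma in_img a (F : M -> M) (HF : definable_term (fun v => F (v 0))) y :
  y ∈ img a F <-> exists x, x ∈ a /\ y = F x.
Proof. unfold img. rewrite in_setof; [reflexivity|]. apply replacement, HF. Qed.

Lemma in_succ a x : x ∈ succ a <-> x ∈ a \/ x = a.
Proof. unfold succ. rewrite in_cup, in_sing. tauto. Qed.

Lemma opair_inj a b c p : opair a b = opair c p -> a = c /\ b = p.
Proof.
  intros E.
  assert (H : forall x, x = sing a \/ x = upair a b <-> x = sing c \/ x = upair c p).
  { intros x. unfold opair in E. rewrite <- !in_upair, E. tauto. }
  assert (S : forall x y, sing x = sing y -> x = y).
  { intros x y Exy. apply in_sing. rewrite <- Exy. apply in_sing. reflexivity. }
  assert (U : forall x y z, sing x = upair y z -> x = y /\ x = z).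
  { intros x y z Exyz. split; symmetry; apply in_sing; rewrite Exyz, in_upair; auto. }
  assert (V : forall y z z', upair y z = upair y z' -> z = z').
  { intros y z z' Ez.
    assert (K : z ∈ upair y z') by (rewrite <- Ez, in_upair; auto).
    assert (K' : z' ∈ upair y z) by (rewrite Ez, in_upair; auto).
    rewrite in_upair in K, K'. destruct K, K'; congruence. }
  assert (Eac : a = c).
  { destruct (proj1 (H (sing a)) (or_introl eq_refl)) as [K|K]; [auto|]. apply (U _ _ _ K). }
  subst c. split; [reflexivity|].
  destruct (proj1 (H (upair a b)) (or_intror eq_refl)) as [K|K]; [|eapply V; eauto].
  destruct (proj2 (H (upair a p)) (or_intror eq_refl)) as [K'|K'].
  - symmetry in K, K'. apply U in K, K'. destruct K, K'; congruence.
  - symmetry. eapply V; eauto.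
Qed.

Lemma in_prod a b x : x ∈ prod a b <-> exists y z, y ∈ a /\ z ∈ b /\ x = opair y z.
Proof.
  unfold prod. rewrite in_setof; [reflexivity|].
  exists (bigcup (img a (fun y => img b (fun z => opair y z)))). intros p.
  rewrite in_bigcup. split.
  - intros (s & Hs & Hp). rewrite in_img in Hs by dfn. destruct Hs as (y & Hy & ->).
    rewrite in_img in Hp by dfn. destruct Hp as (z & Hz & ->). eauto.
  - intros (y & z & Hy & Hz & ->). exists (img b (fun z => opair y z)). split.
    + rewrite in_img by dfn. eauto.
    + rewrite in_img by dfn. eauto.
Qed.

Lemma opair_in_prod a b x y : opair x y ∈ prod a b <-> x ∈ a /\ y ∈ b.
Proof.
  rewrite in_prod. split; [|intros [H K]; eauto 6].
  intros (x' & y' & H & K & E). apply opair_inj in E. destruct E; subst; auto.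
Qed.

Lemma the_eq (P : M -> Prop) x : P x -> (forall y, P y -> y = x) -> the P = x.
Proof.
  intros H K.
  assert (E : setof P = sing x).
  { symmetry. apply eq_setof. intros y. rewrite in_sing. split; [intros ->; exact H|apply K]. }
  unfold the. rewrite E. set_ext z. rewrite in_bigcup. split.
  - intros (y & Hy & Hz). apply in_sing in Hy. subst; auto.
  - intros Hz. exists x. rewrite in_sing. auto.
Qed.

Lemma is_emptyE a : is_empty a <-> a = empty.
Proof.
  split.
  - intros H. set_ext x. rewrite (H x). split; [tauto|apply in_empty].
  - intros -> x. split; [apply in_empty|tauto].
Qed.

Lemma empty_or_nonempty a : a = empty \/ nonempty a.
Proof.
  destruct (classic (nonempty a)) as [H|H]; [auto|left].
  apply is_emptyE. intros x. split; [|tauto]. intros Hx. apply H. exists x; exact Hx.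
Qed.

Lemma is_upairE p a b : is_upair p a b <-> p = upair a b.
Proof.
  split; [intros H; set_ext x; rewrite (H x), in_upair; tauto|].
  intros -> x. apply in_upair.
Qed.

Lemma is_unionE u a : is_union u a <-> u = bigcup a.
Proof.
  split; [intros H; set_ext x; rewrite (H x), in_bigcup; tauto|].
  intros -> x. apply in_bigcup.
Qed.

Lemma is_interE c a b : is_inter c a b <-> c = cap a b.
Proof.
  split; [intros H; set_ext x; rewrite (H x), in_cap; tauto|].
  intros -> x. apply in_cap.
Qed.

Lemma is_diffE c a b : is_diff c a b <-> c = diff a b.
Proof.
  split; [intros H; set_ext x; rewrite (H x), in_diff; tauto|].
  intros -> x. apply in_diff.
Qed.

Lemma is_succE s a : is_succ s a <-> s = succ a.
Proof.
  split; [intros H; set_ext x; rewrite (H x), in_succ; tauto|].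
  intros -> x. apply in_succ.
Qed.

Lemma is_opairE p a b : is_opair p a b <-> p = opair a b.
Proof.
  assert (E : upair a a = sing a) by (set_ext x; rewrite in_upair, in_sing; tauto).
  unfold opair. rewrite <- E. split.
  - intros (s & t & Hs & Ht & Hp). apply is_upairE in Hs, Ht, Hp. congruence.
  - intros ->. exists (upair a a), (upair a b). rewrite !is_upairE. auto.
Qed.

Lemma is_productE c a b : is_product c a b <-> c = prod a b.
Proof.
  assert (H : forall p, p ∈ prod a b <-> exists x y, x ∈ a /\ y ∈ b /\ is_opair p x y).
  { intros p. rewrite in_prod. setoid_rewrite is_opairE. tauto. }
  split; [intros K; set_ext x; rewrite (K x), H; tauto|]. intros ->. exact H.
Qed.

Lemma mapsE f x y : maps f x y <-> opair x y ∈ f.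
Proof.
  unfold maps. setoid_rewrite is_opairE. split; [intros (p & -> & H); exact H|eauto].
Qed.

Lemma set_induction (P : M -> Prop) (HP : definable (fun v => P (v 0))) a :
  (exists x, x ∈ a /\ P x) -> exists x, x ∈ a /\ P x /\ forall y, y ∈ a -> P y -> y ∉ x.
Proof.
  intros (x & Hx & Px).
  destruct (zf_foundation ZF (a := sep a P)) as (m & Hm & D).
  - exists x. rewrite in_sep by exact HP. auto.
  - rewrite in_sep in Hm by exact HP. exists m. repeat split; try tauto.
    intros y Hy Py Hym. apply (D y Hym). rewrite in_sep by exact HP. auto.
Qed.

Lemma mem_irrefl x : x ∉ x.
Proof.
  intros H. destruct (zf_foundation ZF (a := sing x)) as (y & Hy & D).
  - exists x. apply in_sing. reflexivity.
  - apply in_sing in Hy. subst. apply (D x H). apply in_sing. reflexivity.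
Qed.

Lemma mem_asym x y : x ∈ y -> y ∉ x.
Proof.
  intros H K. destruct (zf_foundation ZF (a := upair x y)) as (z & Hz & D).
  - exists x. apply in_upair. auto.
  - apply in_upair in Hz. destruct Hz; subst z.
    + apply (D y K). apply in_upair. auto.
    + apply (D x H). apply in_upair. auto.
Qed.

End Sets.

(** * Functions and natural numbers *)

Section Functions.
Context {M : set_structure} {ZF : is_ZF_model M}.
Implicit Types a b c f p q s t u x y z : M.

Definition injective_on (F : M -> M) a : Prop :=
  forall x x', x ∈ a -> x' ∈ a -> F x = F x' -> x = x'.

(** Definable class functions compose by plain Rocq composition, unlike sets of ordered pairs;
    [injectsP] shows by Replacement that both give the same notion. *)
Definition injects a b : Prop :=
  exists F, definable_term (fun v => F (v 0)) /\ (forall x, x ∈ a -> F x ∈ b) /\ injective_on F a.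

Lemma family_app f a x : is_family f a -> x ∈ a -> maps f x (app f x).
Proof.
  intros [_ H] Hx. destruct (H x Hx) as (y & Hy & U).
  replace (app f x) with y; [exact Hy|]. symmetry. apply the_eq.
  - apply mapsE, Hy.
  - intros z Hz. symmetry. apply U, mapsE, Hz.
Qed.

Lemma mapsP f a x y : is_family f a -> (maps f x y <-> x ∈ a /\ y = app f x).
Proof.
  intros H. split.
  - intros K. assert (Hx : x ∈ a).
    { destruct K as (p & Hp & Hpf). destruct (proj1 H p Hpf) as (x' & y' & Hx' & Hp').
      apply is_opairE in Hp, Hp'. rewrite Hp in Hp'. apply opair_inj in Hp'.
      destruct Hp'; subst; auto. }
    split; [exact Hx|]. destruct (proj2 H x Hx) as (z & _ & U).
    rewrite <- (U y K). apply U, (family_app H Hx).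
  - intros [Hx ->]. apply (family_app H Hx).
Qed.

Lemma function_app f a b x : is_function f a b -> x ∈ a -> app f x ∈ b.
Proof. intros [H K] Hx. apply (K x). apply (family_app H Hx). Qed.

Lemma family_in f a p : is_family f a -> (p ∈ f <-> exists x, x ∈ a /\ p = opair x (app f x)).
Proof.
  intros H. split.
  - intros Hp. destruct (proj1 H p Hp) as (x & y & Hx & E). apply is_opairE in E. subst p.
    exists x. split; [exact Hx|]. apply mapsE, (mapsP _ _ H) in Hp. destruct Hp; congruence.
  - intros (x & Hx & ->). apply mapsE, (family_app H Hx).
Qed.

Lemma family_ext f g a :
  is_family f a -> is_family g a -> (forall x, x ∈ a -> app f x = app g x) -> f = g.
Proof.
  intros Hf Hg H. set_ext p. rewrite (family_in p Hf), (family_in p Hg).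
  split; intros (x & Hx & ->); exists x; rewrite H; auto.
Qed.

Section Lam.
Variables (a : M) (F : M -> M).
Hypothesis HF : definable_term (fun v => F (v 0)).

Lemma maps_lam x y : maps (lam a F) x y <-> x ∈ a /\ y = F x.
Proof.
  rewrite mapsE. unfold lam. rewrite in_img by dfn. split.
  - intros (z & Hz & E). apply opair_inj in E. destruct E; subst; auto.
  - intros [H ->]. eauto.
Qed.

Lemma lam_family : is_family (lam a F) a.
Proof.
  split.
  - intros p Hp. unfold lam in Hp. rewrite in_img in Hp by dfn.
    destruct Hp as (x & Hx & ->). exists x, (F x). split; [exact Hx|]. apply is_opairE. reflexivity.
  - intros x Hx. exists (F x). split; [apply maps_lam; auto|].
    intros y Hy. apply maps_lam in Hy. symmetry. apply Hy.
Qed.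

Lemma app_lam x : x ∈ a -> app (lam a F) x = F x.
Proof. intros Hx. apply (proj1 (maps_lam x _) (family_app lam_family Hx)). Qed.

Lemma lam_function b : (forall x, x ∈ a -> F x ∈ b) -> is_function (lam a F) a b.
Proof.
  intros H. split; [exact lam_family|]. intros x y K. apply maps_lam in K.
  destruct K as [K ->]. auto.
Qed.

Lemma lam_injective : injective_on F a -> injective (lam a F).
Proof.
  intros H x x' y K K'. apply maps_lam in K, K'. destruct K as [K ->], K' as [K' E]. eauto.
Qed.
End Lam.

Lemma injectsP a b : (exists f, is_injection f a b) <-> injects a b.
Proof.
  split.
  - intros (f & Hf & I). exists (fun x => app f x). split; [dfn|]. split.
    + intros x Hx. apply (function_app Hf Hx).
    + intros x x' Hx Hx' E. apply (I x x' (app f x)).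
      * apply (family_app (proj1 Hf) Hx).
      * rewrite E. apply (family_app (proj1 Hf) Hx').
  - intros (F & HF & H & I). exists (lam a F). split.
    + apply lam_function; assumption.
    + apply lam_injective; assumption.
Qed.

Lemma equipotentP a b :
  equipotent a b <-> exists F, definable_term (fun v => F (v 0)) /\ (forall x, x ∈ a -> F x ∈ b) /\
    injective_on F a /\ forall y, y ∈ b -> exists x, x ∈ a /\ y = F x.
Proof.
  split.
  - intros (f & [Hf I] & S). exists (fun x => app f x). split; [dfn|]. split; [|split].
    + intros x Hx. apply (function_app Hf Hx).
    + intros x x' Hx Hx' E. apply (I x x' (app f x)).
      * apply (family_app (proj1 Hf) Hx).
      * rewrite E. apply (family_app (proj1 Hf) Hx').
    + intros y Hy. destruct (S y Hy) as [x Hx]. exists x. apply (mapsP _ _ (proj1 Hf)), Hx.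
  - intros (F & HF & H & I & S). exists (lam a F). split; [split|].
    + apply lam_function; assumption.
    + apply lam_injective; assumption.
    + intros y Hy. destruct (S y Hy) as (x & Hx & ->). exists x. apply maps_lam; auto.
Qed.

Definition inverse (F : M -> M) a y : M := the (fun x => x ∈ a /\ F x = y).

Lemma inverse_eq F a x : injective_on F a -> x ∈ a -> inverse F a (F x) = x.
Proof. intros I Hx. apply the_eq; [auto|]. intros y [Hy E]. auto. Qed.

Lemma equipotent_refl a : equipotent a a.
Proof.
  apply equipotentP. exists (fun x => x). split; [dfn|]. unfold injective_on. eauto 6.
Qed.

Lemma equipotent_sym a b : equipotent a b -> equipotent b a.
Proof.
  intros H. apply equipotentP in H. destruct H as (F & HF & H & I & S).
  apply equipotentP. exists (inverse F a). split; [dfn|]. split; [|split].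
  - intros y Hy. destruct (S y Hy) as (x & Hx & ->). rewrite inverse_eq; auto.
  - intros y y' Hy Hy'. destruct (S y Hy) as (x & Hx & ->), (S y' Hy') as (x' & Hx' & ->).
    rewrite !inverse_eq; auto. congruence.
  - intros x Hx. exists (F x). split; [auto|]. rewrite inverse_eq; auto.
Qed.

Lemma equipotent_injects a b : equipotent a b -> injects a b.
Proof.
  intros H. apply equipotentP in H. destruct H as (F & HF & H & I & _). exists F. auto.
Qed.

Lemma injects_trans a b c : injects a b -> injects b c -> injects a c.
Proof.
  intros (F & HF & H & I) (G & HG & K & J). exists (fun x => G (F x)).
  split; [dfn|]. split; [auto|]. intros x x' Hx Hx' E. auto.
Qed.

Lemma subset_injects a b : a ⊆ b -> injects a b.
Proof.
  intros H. exists (fun x => x). split; [dfn|]. split; [exact H|]. intros x x' _ _ E; exact E.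
Qed.

Lemma subset_refl a : a ⊆ a.
Proof. intros x Hx; exact Hx. Qed.

Lemma subset_trans a b c : a ⊆ b -> b ⊆ c -> a ⊆ c.
Proof. intros H K x Hx. auto. Qed.

Lemma subset_antisym a b : a ⊆ b -> b ⊆ a -> a = b.
Proof. intros H K. set_ext x. split; auto. Qed.

End Functions.

(** * The natural numbers of the model *)

Section Omega.
Context {M : set_structure} {ZF : is_ZF_model M}.
Implicit Types a b c f p q s t u x y z m n : M.

Lemma in_omega n : n ∈ omega <-> forall w, inductive_set w -> n ∈ w.
Proof.
  unfold omega. rewrite in_setof; [reflexivity|].
  destruct (zf_infinity ZF) as [w Hw].
  exists (sep w (fun n => forall w, inductive_set w -> n ∈ w)). intros x.
  rewrite in_sep by dfn. split; [tauto|auto].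
Qed.

Lemma inductive_setE (w : M) :
  inductive_set w <-> empty ∈ w /\ forall x, x ∈ w -> succ x ∈ w.
Proof.
  unfold inductive_set. setoid_rewrite is_emptyE. setoid_rewrite is_succE. split.
  - intros [(e & -> & He) H]. split; [exact He|]. intros x Hx.
    destruct (H x Hx) as (s & -> & Hs). exact Hs.
  - intros [He H]. split; eauto.
Qed.

Lemma empty_omega : empty ∈ omega.
Proof. apply in_omega. intros w Hw. apply inductive_setE in Hw. apply Hw. Qed.

Lemma succ_omega n : n ∈ omega -> succ n ∈ omega.
Proof.
  intros H. apply in_omega. intros w Hw. assert (K := proj1 (in_omega n) H w Hw).
  apply inductive_setE in Hw. apply Hw, K.
Qed.

Lemma omega_ind (P : M -> Prop) : definable (fun v => P (v 0)) ->
  P empty -> (forall n, n ∈ omega -> P n -> P (succ n)) -> forall n, n ∈ omega -> P n.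
Proof.
  intros HP H0 HS n Hn.
  assert (I : inductive_set (sep omega P)).
  { apply inductive_setE. rewrite in_sep by exact HP. split; [split; [apply empty_omega|exact H0]|].
    intros x Hx. rewrite in_sep in * by exact HP. split; [apply succ_omega|apply HS]; apply Hx. }
  assert (K := proj1 (in_omega n) Hn _ I). rewrite in_sep in K by exact HP. apply K.
Qed.

Lemma is_omegaE (w : M) : is_omega w <-> w = omega.
Proof.
  assert (I : is_omega omega).
  { split; [apply inductive_setE; split; [apply empty_omega|exact succ_omega]|].
    intros w' Hw' n Hn. apply (proj1 (in_omega n) Hn w' Hw'). }
  split; [|intros ->; exact I]. intros [H K].
  apply subset_antisym; [apply K, I|apply I, H].
Qed.

Lemma omega_mem_trans n : n ∈ omega -> forall m, m ∈ n -> m ∈ omega /\ m ⊆ n.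
Proof.
  revert n. apply (omega_ind (P := fun n => forall m, m ∈ n -> m ∈ omega /\ m ⊆ n)); [dfn| |].
  - intros m Hm. elim (in_empty Hm).
  - intros n Hn IH m Hm. apply in_succ in Hm. destruct Hm as [Hm| ->].
    + destruct (IH m Hm) as [H K]. split; [exact H|]. intros x Hx. apply in_succ. auto.
    + split; [exact Hn|]. intros x Hx. apply in_succ. auto.
Qed.

Lemma omega_mem m n : n ∈ omega -> m ∈ n -> m ∈ omega.
Proof. intros H K. apply (omega_mem_trans H K). Qed.

Lemma omega_subset m n : n ∈ omega -> m ∈ n -> m ⊆ n.
Proof. intros H K. apply (omega_mem_trans H K). Qed.

Lemma empty_in_succ n : n ∈ omega -> empty ∈ succ n.
Proof.
  revert n. apply (omega_ind (P := fun n => empty ∈ succ n)); [dfn| |].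
  - apply in_succ. auto.
  - intros n _ IH. apply in_succ. auto.
Qed.

Lemma succ_mem_succ m n : n ∈ omega -> m ∈ n -> succ m ∈ succ n.
Proof.
  intros Hn. revert n Hn m. apply (omega_ind (P := fun n => forall m, m ∈ n -> succ m ∈ succ n)); [dfn| |].
  - intros m Hm. elim (in_empty Hm).
  - intros n _ IH m Hm. apply in_succ in Hm. apply in_succ. destruct Hm as [Hm| ->]; auto.
Qed.

Lemma omega_total m n : m ∈ omega -> n ∈ omega -> m ∈ n \/ m = n \/ n ∈ m.
Proof.
  intros Hm Hn. revert m Hm.
  apply (omega_ind (P := fun m => m ∈ n \/ m = n \/ n ∈ m)); [dfn| |].
  - assert (H := empty_in_succ Hn). apply in_succ in H. tauto.
  - intros m Hm [H|[->|H]].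
    + apply (succ_mem_succ Hn) in H. apply in_succ in H. tauto.
    + right; right. apply in_succ. auto.
    + right; right. apply in_succ. auto.
Qed.

Lemma omega_linear m n : m ∈ omega -> n ∈ omega -> m ⊆ n \/ n ⊆ m.
Proof.
  intros Hm Hn. destruct (omega_total Hm Hn) as [H|[->|H]].
  - left. apply (omega_subset Hn H).
  - left. apply subset_refl.
  - right. apply (omega_subset Hm H).
Qed.

Lemma succ_inj m n : succ m = succ n -> m = n.
Proof.
  intros E.
  assert (H : m ∈ succ n) by (rewrite <- E; apply in_succ; auto).
  assert (K : n ∈ succ m) by (rewrite E; apply in_succ; auto).
  apply in_succ in H, K. destruct H as [H|H]; [|exact H]. destruct K as [K|K]; [|auto].
  elim (mem_asym H K).
Qed.

Lemma succ_not_empty n : succ n <> empty.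
Proof. intros E. apply (@in_empty M _ n). rewrite <- E. apply in_succ. auto. Qed.

(** Foundation supplies a minimal witness. Taking it is the substitute for choice in the
    constructions indexed by [omega]. *)
Lemma omega_least (P : M -> Prop) : definable (fun v => P (v 0)) ->
  (exists n, n ∈ omega /\ P n) ->
  exists n, n ∈ omega /\ P n /\ forall m, m ∈ omega -> P m -> n = m \/ n ∈ m.
Proof.
  intros HP H. destruct (set_induction HP H) as (n & Hn & Pn & L).
  exists n. split; [exact Hn|]. split; [exact Pn|]. intros m Hm Pm.
  destruct (omega_total Hn Hm) as [K|[K|K]]; auto. elim (L m Hm Pm K).
Qed.

End Omega.
#[export] Hint Resolve empty_omega succ_omega subset_refl : core.

(** * Finite sets and recursion *)

Section Finite.
Context {M : set_structure} {ZF : is_ZF_model M}.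
Implicit Types a b c f p q s t u x y z m n : M.

(** A case distinction written as a comprehension, so that it is a definable term as soon as [P] is
    definable. *)
Definition ite (P : Prop) a b : M := setof (fun z => (P /\ z ∈ a) \/ (~ P /\ z ∈ b)).

Lemma ite_true (P : Prop) a b : P -> ite P a b = a.
Proof. intros H. symmetry. apply eq_setof. tauto. Qed.

Lemma ite_false (P : Prop) a b : ~ P -> ite P a b = b.
Proof. intros H. symmetry. apply eq_setof. tauto. Qed.

Lemma finiteE a : finite a <-> exists n, n ∈ omega /\ equipotent a n.
Proof.
  unfold finite. setoid_rewrite is_omegaE. split; [intros (w & n & -> & H); eauto|].
  intros (n & H). exists omega, n. tauto.
Qed.

Lemma finite_omega n : n ∈ omega -> finite n.
Proof. intros H. apply finiteE. exists n. split; [exact H|apply equipotent_refl]. Qed.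

Lemma finite_empty : finite empty.
Proof. apply finite_omega, empty_omega. Qed.

Lemma finite_ind (P : M -> Prop) : definable (fun v => P (v 0)) ->
  P empty -> (forall s x, finite s -> x ∉ s -> P s -> P (cup s (sing x))) ->
  forall s, finite s -> P s.
Proof.
  intros HP H0 HS s Hs. apply finiteE in Hs. destruct Hs as (n & Hn & Hs). revert n Hn s Hs.
  apply (omega_ind (P := fun n => forall s, equipotent s n -> P s)); [dfn| |].
  - intros s Hs. apply equipotentP in Hs. destruct Hs as (F & _ & H & _).
    destruct (empty_or_nonempty s) as [->|[x Hx]]; [exact H0|]. elim (in_empty (H x Hx)).
  - intros n Hn IH s Hs. apply equipotentP in Hs. destruct Hs as (F & HF & H & I & S).
    (* The element sent to the top value [n] is the one to remove; the same bijection then maps the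
       rest onto [n]. *)
    destruct (S n) as (x & Hx & En); [apply in_succ; auto|].
    assert (E : s = cup (diff s (sing x)) (sing x)).
    { set_ext z. rewrite in_cup, in_diff, in_sing. destruct (classic (z = x)); [subst|]; tauto. }
    assert (K : equipotent (diff s (sing x)) n).
    { apply equipotentP. exists F. split; [exact HF|]. split; [|split].
      - intros z Hz. rewrite in_diff, in_sing in Hz. destruct Hz as [Hz N].
        assert (K := H z Hz). apply in_succ in K. destruct K as [K|K]; [exact K|].
        elim N. apply I; congruence.
      - intros z z' Hz Hz' Ez. rewrite in_diff in Hz, Hz'. apply I; tauto.
      - intros y Hy. destruct (S y) as (z & Hz & ->); [apply in_succ; auto|].
        exists z. split; [|reflexivity]. rewrite in_diff, in_sing. split; [exact Hz|].
        intros ->. rewrite <- En in Hy. apply (mem_irrefl Hy). }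
    rewrite E. apply HS.
    + apply finiteE. eauto.
    + rewrite in_diff, in_sing. tauto.
    + apply IH, K.
Qed.

Lemma cup_absorb s x : x ∈ s -> cup s (sing x) = s.
Proof.
  intros H. set_ext z. rewrite in_cup, in_sing. split; [|tauto]. intros [K| ->]; auto.
Qed.

Lemma finite_adjoin s x : finite s -> finite (cup s (sing x)).
Proof.
  intros Hs. destruct (classic (x ∈ s)) as [Hx|Hx]; [rewrite cup_absorb; assumption|].
  apply finiteE in Hs. destruct Hs as (n & Hn & Hs). apply equipotentP in Hs.
  destruct Hs as (F & HF & H & I & S).
  apply finiteE. exists (succ n). split; [apply succ_omega, Hn|]. apply equipotentP.
  exists (fun z => ite (z = x) n (F z)). split; [dfn|].
  assert (Ex : ite (x = x) n (F x) = n) by (apply ite_true; reflexivity).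
  assert (Es : forall z, z ∈ s -> ite (z = x) n (F z) = F z).
  { intros z Hz. apply ite_false. intros ->; auto. }
  split; [|split].
  - intros z Hz. rewrite in_cup, in_sing in Hz. apply in_succ. destruct Hz as [Hz| ->]; [|auto].
    rewrite Es; auto.
  - intros z z' Hz Hz' E. rewrite in_cup, in_sing in Hz, Hz'.
    destruct Hz as [Hz| ->], Hz' as [Hz'| ->]; auto.
    + rewrite !Es in E; auto.
    + rewrite (Es _ Hz), Ex in E. elim (@mem_irrefl M _ n). rewrite <- E at 1. auto.
    + rewrite (Es _ Hz'), Ex in E. elim (@mem_irrefl M _ n). rewrite E at 1. auto.
  - intros y Hy. apply in_succ in Hy. destruct Hy as [Hy| ->].
    + destruct (S y Hy) as (z & Hz & ->). exists z. rewrite in_cup, Es; auto.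
    + exists x. rewrite in_cup, in_sing. auto.
Qed.

Lemma cup_diff_sing a x : x ∈ a -> cup (diff a (sing x)) (sing x) = a.
Proof.
  intros H. set_ext z. rewrite in_cup, in_diff, in_sing. destruct (classic (z = x)); [subst|]; tauto.
Qed.

Lemma finite_subset a b : finite b -> a ⊆ b -> finite a.
Proof.
  intros Hb. revert b Hb a.
  apply (finite_ind (P := fun b => forall a, a ⊆ b -> finite a)); [dfn| |].
  - intros a Ha. replace a with (@empty M _); [apply finite_empty|].
    apply subset_antisym; [|exact Ha]. intros x Hx. elim (in_empty Hx).
  - intros s x _ Hx IH a Ha.
    destruct (classic (x ∈ a)) as [K|K].
    + rewrite <- (cup_diff_sing K). apply finite_adjoin, IH. intros z Hz.
      rewrite in_diff, in_sing in Hz. destruct Hz as [Hz N].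
      specialize (Ha z Hz). rewrite in_cup, in_sing in Ha. tauto.
    + apply IH. intros z Hz. assert (L := Ha z Hz). rewrite in_cup, in_sing in L.
      destruct L as [L| ->]; tauto.
Qed.

Lemma img_cup_sing (F : M -> M) (HF : definable_term (fun v => F (v 0))) s x :
  img (cup s (sing x)) F = cup (img s F) (sing (F x)).
Proof.
  set_ext z. rewrite in_cup, in_sing, !in_img by dfn. setoid_rewrite in_cup.
  setoid_rewrite in_sing. split; [intros (y & [H|H] & K); subst; eauto|].
  intros [(y & H & K)| ->]; eauto.
Qed.

Lemma img_empty (F : M -> M) (HF : definable_term (fun v => F (v 0))) : img empty F = empty.
Proof.
  set_ext z. rewrite in_img by dfn. split; [intros (x & H & _)|intros H]; elim (in_empty H).
Qed.

Lemma finite_img (F : M -> M) (HF : definable_term (fun v => F (v 0))) s :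
  finite s -> finite (img s F).
Proof.
  revert s. apply (finite_ind (P := fun s => finite (img s F))); [dfn| |].
  - rewrite img_empty by dfn. apply finite_empty.
  - intros s x _ _ H. rewrite img_cup_sing by dfn. apply finite_adjoin, H.
Qed.

Lemma finite_cup a b : finite a -> finite b -> finite (cup a b).
Proof.
  intros Ha. revert b. revert a Ha.
  apply (finite_ind (P := fun a => forall b, finite b -> finite (cup a b))); [dfn| |].
  - intros b Hb. apply (finite_subset Hb). intros x Hx. apply in_cup in Hx.
    destruct Hx as [Hx|Hx]; [elim (in_empty Hx)|exact Hx].
  - intros s x _ _ IH b Hb. apply (finite_subset (IH _ (finite_adjoin x Hb))).
    intros z Hz. rewrite !in_cup in *. tauto.
Qed.

Lemma finite_sing x : finite (sing x).
Proof.
  apply (finite_subset (finite_adjoin x finite_empty)). intros z Hz. apply in_cup. auto.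
Qed.

Lemma finite_bigcup a : finite a -> (forall s, s ∈ a -> finite s) -> finite (bigcup a).
Proof.
  revert a. apply (finite_ind (P := fun a => (forall s, s ∈ a -> finite s) -> finite (bigcup a))); [dfn| |].
  - intros _. apply (finite_subset finite_empty). intros x Hx. apply in_bigcup in Hx.
    destruct Hx as (y & Hy & _). elim (in_empty Hy).
  - intros a s _ _ IH H.
    assert (K : finite (cup (bigcup a) s)).
    { apply finite_cup; [apply IH; intros t Ht|]; apply H; rewrite in_cup, ?in_sing; auto. }
    apply (finite_subset K). intros x Hx. apply in_bigcup in Hx. destruct Hx as (t & Ht & Hx).
    rewrite in_cup, in_sing in Ht. rewrite in_cup, in_bigcup. destruct Ht as [Ht| ->]; eauto.
Qed.

Lemma finite_power a : finite a -> finite (power a).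
Proof.
  revert a. apply (finite_ind (P := fun a => finite (power a))); [dfn| |].
  - apply (finite_subset (finite_sing empty)). intros s Hs. rewrite in_power in Hs. apply in_sing.
    apply subset_antisym; [exact Hs|]. intros x Hx. elim (in_empty Hx).
  - intros a x _ Hx IH.
    assert (K : finite (cup (power a) (img (power a) (fun s => cup s (sing x))))).
    { apply finite_cup; [exact IH|]. apply finite_img; [dfn|exact IH]. }
    apply (finite_subset K). intros s Hs. rewrite in_power in Hs.
    assert (L : diff s (sing x) ⊆ a).
    { intros z Hz. rewrite in_diff, in_sing in Hz. destruct Hz as [Hz N].
      specialize (Hs z Hz). rewrite in_cup, in_sing in Hs. tauto. }
    rewrite in_cup, in_power, in_img by dfn.
    destruct (classic (x ∈ s)) as [Hxs|Hxs].
    + right. exists (diff s (sing x)). rewrite in_power, cup_diff_sing; auto.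
    + left. intros z Hz. apply L. rewrite in_diff, in_sing. split; [exact Hz|]. intros ->; auto.
Qed.

Lemma finite_prod a b : finite a -> finite b -> finite (prod a b).
Proof.
  intros Ha Hb.
  assert (K : finite (bigcup (img a (fun x => img b (fun y => opair x y))))).
  { apply finite_bigcup; [apply finite_img; [dfn|exact Ha]|].
    intros s Hs. rewrite in_img in Hs by dfn. destruct Hs as (x & _ & ->).
    apply finite_img; [dfn|exact Hb]. }
  apply (finite_subset K). intros p Hp. apply in_prod in Hp.
  destruct Hp as (x & y & Hx & Hy & ->). apply in_bigcup.
  exists (img b (fun y => opair x y)). split.
  - rewrite in_img by dfn. eauto.
  - rewrite in_img by dfn. eauto.
Qed.

Lemma finite_injective (F : M -> M) (HF : definable_term (fun v => F (v 0))) a :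
  injective_on F a -> finite (img a F) -> finite a.
Proof.
  intros I H. apply (finite_img (F := inverse F a)) in H; [|dfn].
  apply (finite_subset H). intros x Hx. rewrite in_img by dfn.
  exists (F x). rewrite in_img by dfn. rewrite inverse_eq; eauto.
Qed.

Lemma finite_injects a b : injects a b -> finite b -> finite a.
Proof.
  intros (F & HF & H & I) Hb. apply (finite_injective HF I).
  apply (finite_subset Hb). intros y Hy. rewrite in_img in Hy by dfn.
  destruct Hy as (x & Hx & ->). auto.
Qed.

(* Tarski's characterization of finiteness. *)
Lemma finite_minimal s : finite s -> forall k, (exists t, t ∈ k /\ t ⊆ s) ->
  exists t, t ∈ k /\ t ⊆ s /\ forall r, r ∈ k -> r ⊆ t -> r = t.
Proof.
  revert s. apply (finite_ind (P := fun s => forall k, (exists t, t ∈ k /\ t ⊆ s) ->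
    exists t, t ∈ k /\ t ⊆ s /\ forall r, r ∈ k -> r ⊆ t -> r = t)); [dfn| |].
  - intros k (t & Ht & Hs). exists t. repeat split; [exact Ht|exact Hs|].
    intros r _ Hr. apply subset_antisym; [exact Hr|]. intros x Hx. elim (in_empty (Hs x Hx)).
  - intros s x _ Hx IH k (t & Ht & Hts).
    destruct (classic (exists t, t ∈ k /\ t ⊆ s)) as [H|H].
    { destruct (IH k H) as (t' & H1 & H2 & H3). exists t'. repeat split; auto.
      intros z Hz. apply in_cup. auto. }
    assert (Hin : forall u, u ∈ k -> u ⊆ cup s (sing x) -> x ∈ u).
    { intros u Hu Hus. apply NNPP. intros N. apply H. exists u. split; [exact Hu|].
      intros z Hz. specialize (Hus z Hz). rewrite in_cup, in_sing in Hus.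
      destruct Hus as [K| ->]; tauto. }
    assert (Hd : forall u, u ⊆ cup s (sing x) -> diff u (sing x) ⊆ s).
    { intros u Hu z Hz. rewrite in_diff, in_sing in Hz. destruct Hz as [Hz N].
      specialize (Hu z Hz). rewrite in_cup, in_sing in Hu. tauto. }
    (* All members of [k] below [cup s (sing x)] contain [x] now, so deleting [x] turns the question
       into one about subsets of [s]. *)
    destruct (IH (sep (power s) (fun r => cup r (sing x) ∈ k))) as (r & Hr & Hrs & Hm).
    { exists (diff t (sing x)). rewrite in_sep, in_power, cup_diff_sing by (auto; dfn). auto. }
    rewrite in_sep in Hr by dfn. exists (cup r (sing x)). split; [apply Hr|]. split.
    { intros z. rewrite !in_cup. specialize (Hrs z). tauto. }
    intros u Hu Hur.
    assert (Hus : u ⊆ cup s (sing x)).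
    { intros z Hz. specialize (Hur z Hz). rewrite in_cup in *. specialize (Hrs z). tauto. }
    assert (E : diff u (sing x) = r).
    { apply Hm.
      - rewrite in_sep, in_power, cup_diff_sing by (auto; dfn). auto.
      - intros z Hz. rewrite in_diff, in_sing in Hz. destruct Hz as [Hz N].
        specialize (Hur z Hz). rewrite in_cup, in_sing in Hur. tauto. }
    rewrite <- E. symmetry. apply cup_diff_sing. auto.
Qed.

(* A subset b of a with F[b] ⊊ b, minimal among the nonempty such subsets, would be
   contradicted by F[b]. *)
Lemma finite_pigeonhole (F : M -> M) (HF : definable_term (fun v => F (v 0))) a :
  finite a -> (forall x, x ∈ a -> F x ∈ a) -> injective_on F a ->
  forall y, y ∈ a -> exists x, x ∈ a /\ y = F x.
Proof.
  intros Ha H I y Hy. apply NNPP. intros N.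
  destruct (finite_minimal Ha (k := sep (power a) (fun b => img b F ⊆ b /\ img b F <> b)))
    as (b & Hb & Hba & Hm).
  - exists a. split; [|apply subset_refl]. rewrite in_sep, in_power by dfn.
    split; [apply subset_refl|]. split.
    + intros z Hz. rewrite in_img in Hz by dfn. destruct Hz as (x & Hx & ->). auto.
    + intros E. apply N. rewrite <- in_img by dfn. rewrite E. exact Hy.
  - rewrite in_sep, in_power in Hb by dfn. destruct Hb as (_ & Hb & Nb).
    apply Nb, Hm; [|exact Hb]. rewrite in_sep, in_power by dfn. split; [|split].
    + apply (subset_trans Hb Hba).
    + intros z Hz. rewrite in_img in * by dfn. destruct Hz as (x & Hx & ->). eauto.
    + intros E. apply Nb. apply subset_antisym; [exact Hb|]. intros x Hx.
      assert (K : F x ∈ img (img b F) F) by (rewrite E, in_img by dfn; eauto).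
      rewrite in_img in K by dfn. destruct K as (x' & Hx' & K).
      replace x with x'; [exact Hx'|]. symmetry. apply I; auto.
Qed.

Lemma omega_infinite : infinite omega.
Proof.
  intros H. destruct (finite_pigeonhole (F := succ) ltac:(dfn) H) with (y := empty) as (n & Hn & E).
  - intros n Hn. apply succ_omega, Hn.
  - intros n n' _ _ E. apply succ_inj, E.
  - apply empty_omega.
  - apply (succ_not_empty (eq_sym E)).
Qed.

Lemma finite_comparable a b : finite a -> finite b -> injects a b \/ injects b a.
Proof.
  intros Ha Hb. apply finiteE in Ha, Hb. destruct Ha as (m & Hm & Ha), Hb as (n & Hn & Hb).
  destruct (omega_linear Hm Hn) as [H|H]; [left|right].
  - apply injects_trans with m; [apply equipotent_injects, Ha|].
    apply injects_trans with n; [apply subset_injects, H|].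
    apply equipotent_injects, equipotent_sym, Hb.
  - apply injects_trans with n; [apply equipotent_injects, Hb|].
    apply injects_trans with m; [apply subset_injects, H|].
    apply equipotent_injects, equipotent_sym, Ha.
Qed.

(** The graph is the intersection [R] of all relations that contain the initial pair and are closed
    under the step. It is single-valued by [Rinv]: the pairs that are initial or are the successor
    of a pair in [R] already form a closed relation. The values are confined to a set [a] so that
    this relation is a set. *)
Lemma recursion (F : M -> M) (HF : definable_term (fun v => F (v 0))) a x0 :
  x0 ∈ a -> (forall x, x ∈ a -> F x ∈ a) ->
  exists f, is_function f omega a /\ app f empty = x0 /\
    forall n, n ∈ omega -> app f (succ n) = F (app f n).
Proof.
  intros H0 HS.
  set (closed := fun k => opair empty x0 ∈ k /\
    forall n x, n ∈ omega -> x ∈ a -> opair n x ∈ k -> opair (succ n) (F x) ∈ k).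
  set (R := fun n x => n ∈ omega /\ x ∈ a /\ forall k, closed k -> opair n x ∈ k).
  assert (R0 : R empty x0).
  { split; [apply empty_omega|]. split; [exact H0|]. intros k Hk. apply Hk. }
  assert (RS : forall n x, R n x -> R (succ n) (F x)).
  { intros n x (Hn & Hx & H). split; [apply succ_omega, Hn|]. split; [auto|].
    intros k Hk. apply Hk; auto. }
  assert (Hclosed : definable (fun v => closed (v 0))) by (unfold closed; dfn).
  assert (HR : definable (fun v => R (v 0) (v 1))) by (unfold R; dfn).
  assert (Rinv : forall n x, R n x -> n = empty /\ x = x0 \/ exists m y, R m y /\ n = succ m /\ x = F y).
  { intros n x (Hn & Hx & H).
    set (k := sep (prod omega a) (fun p => exists n x, p = opair n x /\
       (n = empty /\ x = x0 \/ exists m y, R m y /\ n = succ m /\ x = F y))).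
    assert (Hk : forall n x, opair n x ∈ k <-> n ∈ omega /\ x ∈ a /\
       (n = empty /\ x = x0 \/ exists m y, R m y /\ n = succ m /\ x = F y)).
    { intros n' x'. unfold k. rewrite in_sep by dfn. rewrite opair_in_prod. split.
      - intros ((K1 & K2) & n'' & x'' & E & K). apply opair_inj in E. destruct E; subst. auto.
      - intros (K1 & K2 & K). eauto 6. }
    apply (Hk n x), H. split; [apply Hk; auto|].
    intros m y Hm Hy K. apply Hk. split; [auto|]. split; [auto|]. right. exists m, y.
    split; [|auto]. apply Hk in K. destruct K as (_ & _ & [[-> ->]|(m' & y' & K & -> & ->)]); auto. }
  assert (RU : forall n, n ∈ omega -> exists x, R n x /\ forall y, R n y -> y = x).
  { apply (omega_ind (P := fun n => exists x, R n x /\ forall y, R n y -> y = x)); [dfn| |].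
    - exists x0. split; [exact R0|]. intros y Hy.
      destruct (Rinv _ _ Hy) as [[_ ->]|(m & z & _ & E & _)]; [reflexivity|].
      elim (succ_not_empty (eq_sym E)).
    - intros n Hn (x & Hx & U). exists (F x). split; [auto|]. intros y Hy.
      destruct (Rinv _ _ Hy) as [[E _]|(m & z & K & E & ->)]; [elim (succ_not_empty E)|].
      apply succ_inj in E. subst m. f_equal. auto. }
  set (G := fun n => the (fun x => R n x)).
  assert (HG : definable_term (fun v => G (v 0))) by (unfold G; dfn).
  assert (GR : forall n x, R n x -> G n = x).
  { intros n x H. destruct (RU n (proj1 H)) as (y & Hy & U). rewrite (U x H).
    apply the_eq; assumption. }
  assert (RG : forall n, n ∈ omega -> R n (G n)).
  { intros n Hn. destruct (RU n Hn) as (x & Hx & _). rewrite (GR n x Hx). exact Hx. }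
  exists (lam omega G). split; [|split].
  - apply lam_function; [exact HG|]. intros n Hn. apply RG, Hn.
  - rewrite app_lam by auto. apply GR, R0.
  - intros n Hn. rewrite !app_lam by auto. apply GR, RS, RG, Hn.
Qed.

(** [next k] is the least index whose value does not occur up to index [k]. It exists because
    finitely many indices yield only finitely many values. *)
Lemma injective_subsequence (F : M -> M) (HF : definable_term (fun v => F (v 0))) :
  infinite (img omega F) -> exists g, is_family g omega /\ injective_on (app g) omega /\
    forall n, n ∈ omega -> exists k, k ∈ omega /\ app g n = F k.
Proof.
  intros Inf.
  set (new := fun k m => F m ∉ img (succ k) F /\
    forall m', m' ∈ omega -> F m' ∉ img (succ k) F -> m = m' \/ m ∈ m').
  set (next := fun k => the (fun m => m ∈ omega /\ new k m)).
  assert (Hnew : definable (fun v => new (v 0) (v 1))) by (unfold new; dfn).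
  assert (Hnext : forall k, k ∈ omega -> next k ∈ omega /\ F (next k) ∉ img (succ k) F).
  { intros k Hk.
    destruct (omega_least (P := fun m => F m ∉ img (succ k) F)) as (m & Hm & N & L); [dfn| |].
    - apply NNPP. intros N. apply Inf.
      apply finite_subset with (img (succ k) F);
        [apply finite_img; [dfn|apply finite_omega, succ_omega, Hk]|].
      intros y Hy. rewrite in_img in Hy by dfn. destruct Hy as (m & Hm & ->).
      apply NNPP. intros N'. apply N. eauto.
    - replace (next k) with m; [auto|]. symmetry. apply the_eq; [unfold new; auto|].
      intros m' (Hm' & N' & L'). destruct (L m' Hm' N') as [E|E]; [auto|].
      destruct (L' m Hm N) as [E'|E']; [auto|]. elim (mem_asym E E'). }
  assert (Dnext : definable_term (fun v => next (v 0))) by (unfold next; dfn).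
  destruct (recursion Dnext empty_omega) as (e & He & _ & ES); [intros k Hk; apply Hnext, Hk|].
  assert (eo : forall n, n ∈ omega -> app e n ∈ omega) by (intros n Hn; apply (function_app He Hn)).
  (* The values at the first indices up to [app e j] include all those selected so far, so the value
     at [app e (succ j)] is new. *)
  assert (A : forall j, j ∈ omega -> forall i, i ∈ succ j -> F (app e i) ∈ img (succ (app e j)) F).
  { apply (omega_ind (P := fun j => forall i, i ∈ succ j -> F (app e i) ∈ img (succ (app e j)) F));
      [dfn| |].
    - intros i Hi. apply in_succ in Hi. destruct Hi as [Hi| ->]; [elim (in_empty Hi)|].
      rewrite in_img by dfn. exists (app e empty). split; [apply in_succ; auto|reflexivity].
    - intros j Hj IH i Hi. apply in_succ in Hi. destruct Hi as [Hi| ->].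
      + specialize (IH i Hi). rewrite in_img in * by dfn. destruct IH as (l & Hl & E).
        exists l. split; [|exact E]. apply in_succ. left.
        destruct (Hnext _ (eo j Hj)) as [K N].
        rewrite ES by exact Hj.
        destruct (omega_total (succ_omega (eo j Hj)) K) as [L|[L|L]].
        * apply (omega_subset K L). exact Hl.
        * rewrite <- L. exact Hl.
        * elim N. rewrite in_img by dfn. eauto.
      + rewrite in_img by dfn. exists (app e (succ j)). split; [apply in_succ; auto|reflexivity]. }
  assert (B : forall i j, j ∈ omega -> i ∈ j -> F (app e i) <> F (app e j)).
  { intros i j Hj Hij E.
    destruct (classic (exists j', j' ∈ omega /\ j = succ j')) as [(j' & Hj' & ->)|N].
    - apply (Hnext _ (eo j' Hj')). rewrite <- ES by exact Hj'. rewrite <- E.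
      apply A; assumption.
    - apply N. clear E N. revert Hij. revert j Hj.
      apply (omega_ind (P := fun j => i ∈ j -> exists j', j' ∈ omega /\ j = succ j')); [dfn| |].
      + intros H. elim (in_empty H).
      + eauto. }
  exists (lam omega (fun n => F (app e n))).
  assert (Dg : definable_term (fun v => F (app e (v 0)))) by dfn.
  split; [apply lam_family, Dg|]. split.
  - intros i j Hi Hj E. rewrite !app_lam in E by assumption.
    destruct (omega_total Hi Hj) as [K|[K|K]]; [elim (B _ _ Hj K E)|exact K|].
    elim (B _ _ Hi K (eq_sym E)).
  - intros n Hn. rewrite app_lam by assumption. eauto.
Qed.

Lemma denumerableE a : denumerable a <-> equipotent a omega.
Proof.
  unfold denumerable. setoid_rewrite is_omegaE. split; [intros (w & -> & H); exact H|eauto].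
Qed.

Lemma denumerable_img (F : M -> M) (HF : definable_term (fun v => F (v 0))) :
  injective_on F omega -> denumerable (img omega F).
Proof.
  intros I. apply denumerableE. apply equipotent_sym. apply equipotentP. exists F.
  split; [exact HF|]. split; [|split; [exact I|]].
  - intros n Hn. rewrite in_img by dfn. eauto.
  - intros y Hy. rewrite in_img in Hy by dfn. exact Hy.
Qed.

Lemma img_denumerable_subset (F : M -> M) (HF : definable_term (fun v => F (v 0))) :
  infinite (img omega F) -> exists d, denumerable d /\ d ⊆ img omega F.
Proof.
  intros H. destruct (injective_subsequence HF H) as (g & Hg & I & K).
  exists (img omega (app g)). split; [apply denumerable_img; [dfn|exact I]|].
  intros y Hy. rewrite in_img in * by dfn. destruct Hy as (n & Hn & ->). eauto.
Qed.

Lemma denumerable_enum a : denumerable a -> exists F, definable_term (fun v => F (v 0)) /\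
  (forall n, n ∈ omega -> F n ∈ a) /\ injective_on F omega /\
  forall x, x ∈ a -> exists n, n ∈ omega /\ x = F n.
Proof.
  intros H. apply denumerableE, equipotent_sym, equipotentP in H. exact H.
Qed.

End Finite.

(** * Regular open sets *)

Section Topology.
Context {M : set_structure} {ZF : is_ZF_model M}.
Implicit Types a b c f p q s t u x y z m n : M.
Implicit Types U V W G E : M.
Variables X T : M.

Definition meets U V : Prop := exists x, x ∈ U /\ x ∈ V.

(* Every nonempty open subset of [V] meets [U]; for open [V] this says that [V] is
   contained in the closure of [U]. *)
Definition dense_in V U : Prop :=
  forall W, W ∈ T -> W ⊆ V -> nonempty W -> meets W U.

(** A form of regularity without closures, equivalent to the usual one by [regular_openP]. *)
Definition regular U : Prop := U ∈ T /\ forall V, V ∈ T -> dense_in V U -> V ⊆ U.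

(** This is the interior of the closure of [U]. *)
Definition regularization U : M :=
  sep X (fun x => exists V, V ∈ T /\ x ∈ V /\ dense_in V U).

Definition regular_sets : M := sep T (fun U => regular U).

Lemma D_meets : definable (fun v => meets (v 0) (v 1)).
Proof. dfn. Qed.
#[local] Hint Resolve D_meets : dfn.
Lemma D_dense_in : definable (fun v => dense_in (v 0) (v 1)).
Proof. dfn. Qed.
#[local] Hint Resolve D_dense_in : dfn.
Lemma D_regular : definable (fun v => regular (v 0)).
Proof. dfn. Qed.
#[local] Hint Resolve D_regular : dfn.
Lemma DT_regularization : definable_term (fun v => regularization (v 0)).
Proof. dfn. Qed.

Lemma in_regular_sets U : U ∈ regular_sets <-> regular U.
Proof. unfold regular_sets. rewrite in_sep by dfn. unfold regular. tauto. Qed.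

Hypothesis HT : is_topology X T.

Lemma open_subset U : U ∈ T -> U ⊆ X.
Proof. apply HT. Qed.

Lemma open_empty : empty ∈ T.
Proof. apply HT, is_emptyE. reflexivity. Qed.

Lemma open_full : X ∈ T.
Proof. apply HT. Qed.

Lemma open_cap U V : U ∈ T -> V ∈ T -> cap U V ∈ T.
Proof. intros H K. destruct HT as (_ & _ & _ & C & _). apply (C U V); auto. apply is_interE. reflexivity. Qed.

Lemma open_bigcup a : a ⊆ T -> bigcup a ∈ T.
Proof. intros H. destruct HT as (_ & _ & _ & _ & C). apply (C a); auto. apply is_unionE. reflexivity. Qed.

(** The union of all open subsets of [U] is formed, so no neighbourhood has to be chosen for each
    point. *)
Lemma open_local U : (forall x, x ∈ U -> exists V, V ∈ T /\ x ∈ V /\ V ⊆ U) -> U ∈ T.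
Proof.
  intros H. replace U with (bigcup (sep T (fun V => V ⊆ U))).
  - apply open_bigcup. intros V HV. rewrite in_sep in HV by dfn. apply HV.
  - set_ext x. rewrite in_bigcup. split.
    + intros (V & HV & Hx). rewrite in_sep in HV by dfn. destruct HV as [_ HV]. auto.
    + intros Hx. destruct (H x Hx) as (V & HV & HxV & K). exists V.
      rewrite in_sep by dfn. auto.
Qed.

Lemma dense_inP V U : V ∈ T ->
  (dense_in V U <-> forall y, y ∈ V -> closure X T (fun x => x ∈ U) y).
Proof.
  intros HV. split.
  - intros H y Hy. split; [apply (open_subset HV Hy)|]. intros W HW HyW.
    destruct (H (cap W V)) as (z & Hz & Hz').
    + apply open_cap; assumption.
    + intros z Hz. apply in_cap in Hz. apply Hz.
    + exists y. apply in_cap. auto.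
    + apply in_cap in Hz. exists z. tauto.
  - intros H W HW HWV (y & Hy). destruct (H y (HWV y Hy)) as [_ K].
    destruct (K W HW Hy) as (z & Hz & Hz'). exists z; auto.
Qed.

Lemma regular_openP U : regular_open X T U <-> regular U.
Proof.
  split.
  - intros H. split.
    + apply open_local. intros x Hx. destruct (proj1 (H x) Hx) as (V & HV & HxV & K).
      exists V. split; [exact HV|]. split; [exact HxV|]. intros y Hy. apply (H y). exists V; auto.
    + intros V HV D y Hy. apply (H y). exists V. split; [exact HV|]. split; [exact Hy|].
      apply dense_inP; assumption.
  - intros [HU H] x. split.
    + intros Hx. exists U. split; [exact HU|]. split; [exact Hx|]. apply dense_inP; [exact HU|].
      intros W HW HWU (y & Hy). exists y; auto.
    + intros (V & HV & Hx & K). apply (H V HV); [apply dense_inP; assumption|exact Hx].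
Qed.

Lemma in_regularization U x :
  x ∈ regularization U <-> exists V, V ∈ T /\ x ∈ V /\ dense_in V U.
Proof.
  unfold regularization. rewrite in_sep by dfn. split; [tauto|].
  intros (V & HV & Hx & D). split; [apply (open_subset HV Hx)|eauto].
Qed.

Lemma dense_in_refl U : dense_in U U.
Proof. intros W _ H (y & Hy). exists y; auto. Qed.

Lemma regularization_subset U : U ∈ T -> U ⊆ regularization U.
Proof.
  intros HU x Hx. apply in_regularization. exists U. split; [exact HU|]. split; [exact Hx|].
  apply dense_in_refl.
Qed.

Lemma meets_regularization U W : W ∈ T -> meets W (regularization U) -> meets W U.
Proof.
  intros HW (x & Hx & K). apply in_regularization in K. destruct K as (V & HV & HxV & D).
  destruct (D (cap W V)) as (z & Hz & Hz').
  - apply open_cap; assumption.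
  - intros z Hz. apply in_cap in Hz. tauto.
  - exists x. apply in_cap. auto.
  - apply in_cap in Hz. exists z. tauto.
Qed.

Lemma regularization_regular U : regular (regularization U).
Proof.
  split.
  - apply open_local. intros x Hx. apply in_regularization in Hx.
    destruct Hx as (V & HV & Hx & D). exists V. split; [exact HV|]. split; [exact Hx|].
    intros y Hy. apply in_regularization. eauto.
  - intros V HV D x Hx. apply in_regularization. exists V. split; [exact HV|]. split; [exact Hx|].
    intros W HW HWV N. apply (meets_regularization HW). apply D; assumption.
Qed.

Lemma hausdorff_regular x y : hausdorff X T -> x ∈ X -> y ∈ X -> x <> y ->
  exists U, regular U /\ x ∈ U /\ y ∉ U.
Proof.
  intros H Hx Hy N. destruct (H x y Hx Hy N) as (U & V & HU & HV & HxU & HyV & D).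
  exists (regularization U). split; [apply regularization_regular|].
  split; [apply (regularization_subset HU HxU)|]. intros K.
  destruct (meets_regularization (U := U) HV) as (z & Hz & Hz').
  - exists y. auto.
  - apply (D z Hz' Hz).
Qed.

(** A point is determined by the set of regular open sets that contain it, so finitely many regular
    open sets would leave only finitely many points. *)
Lemma regular_sets_infinite : hausdorff X T -> infinite X -> infinite regular_sets.
Proof.
  intros H Inf K. apply Inf.
  apply finite_injective with (F := fun x => sep regular_sets (fun U => x ∈ U)); [dfn| |].
  - intros x y Hx Hy E. apply NNPP. intros N.
    destruct (hausdorff_regular H Hx Hy N) as (U & HU & HxU & HyU). apply HyU.
    assert (L : U ∈ sep regular_sets (fun U => y ∈ U)).
    { rewrite <- E. rewrite in_sep, in_regular_sets by dfn. auto. }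
    rewrite in_sep in L by dfn. apply L.
  - apply (finite_subset (finite_power K)). intros s Hs. rewrite in_img in Hs by dfn.
    destruct Hs as (x & _ & ->). apply in_power. intros U HU. rewrite in_sep in HU by dfn. apply HU.
Qed.

End Topology.
#[export] Hint Resolve D_meets D_dense_in D_regular DT_regularization : dfn.

(* The atoms of the algebra of regular open sets generated by the members of a finite set [G],
   obtained as classes of points that lie in the interior or in the exterior of each member. *)
Section Atoms.
Context {M : set_structure} {ZF : is_ZF_model M}.
Implicit Types a b c f p q s t u x y z m n : M.
Implicit Types U V W G E : M.
Variables X T : M.

Definition decided G x : Prop :=
  forall U, U ∈ G -> x ∈ U \/ exists V, V ∈ T /\ x ∈ V /\ ~ meets V U.

Definition atom G x : M :=
  sep X (fun y => decided G y /\ forall U, U ∈ G -> (x ∈ U <-> y ∈ U)).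

Definition atoms G : M := img (sep X (fun x => decided G x)) (atom G).

Lemma D_decided : definable (fun v => decided (v 0) (v 1)).
Proof. dfn. Qed.
#[local] Hint Resolve D_decided : dfn.
Lemma DT_atom : definable_term (fun v => atom (v 0) (v 1)).
Proof. dfn. Qed.
#[local] Hint Resolve DT_atom : dfn.
Lemma DT_atoms : definable_term (fun v => atoms (v 0)).
Proof. dfn. Qed.

Lemma in_atom G x y :
  y ∈ atom G x <-> y ∈ X /\ decided G y /\ forall U, U ∈ G -> (x ∈ U <-> y ∈ U).
Proof. unfold atom. rewrite in_sep by dfn. tauto. Qed.

Lemma in_atoms G E : E ∈ atoms G <-> exists x, x ∈ X /\ decided G x /\ E = atom G x.
Proof.
  unfold atoms. rewrite in_img by dfn. setoid_rewrite in_sep; [|dfn].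
  split; intros (x & H); exists x; tauto.
Qed.

Lemma atom_self G x : x ∈ X -> decided G x -> x ∈ atom G x.
Proof. intros H K. apply in_atom. repeat split; auto. Qed.

Lemma atom_eq G x y : y ∈ atom G x -> atom G y = atom G x.
Proof.
  intros H. apply in_atom in H. destruct H as (_ & _ & H). set_ext z. rewrite !in_atom.
  split; intros (H1 & H2 & H3); (split; [exact H1|]; split; [exact H2|]);
    intros U HU; specialize (H U HU); specialize (H3 U HU); tauto.
Qed.

Lemma atoms_eq G E x : E ∈ atoms G -> x ∈ E -> x ∈ X /\ decided G x /\ E = atom G x.
Proof.
  intros H Hx. apply in_atoms in H. destruct H as (y & _ & _ & ->).
  assert (K := Hx). apply in_atom in K. destruct K as (K1 & K2 & _).
  split; [exact K1|]. split; [exact K2|]. symmetry. apply atom_eq, Hx.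
Qed.

Lemma atoms_disjoint G E E' : E ∈ atoms G -> E' ∈ atoms G -> meets E E' -> E = E'.
Proof.
  intros H K (x & Hx & Hx'). destruct (atoms_eq H Hx) as (_ & _ & ->).
  destruct (atoms_eq K Hx') as (_ & _ & ->). reflexivity.
Qed.

Lemma atoms_finite G : finite G -> finite (atoms G).
Proof.
  intros HG.
  (* Atoms are indexed here by subsets of [G] instead of points, and [power G] is finite. *)
  set (cls := fun s => sep X (fun y => decided G y /\ forall U, U ∈ G -> (U ∈ s <-> y ∈ U))).
  apply finite_subset with (img (power G) cls).
  - apply finite_img; [dfn|apply finite_power, HG].
  - intros E HE. apply in_atoms in HE. destruct HE as (x & Hx & Dx & ->).
    rewrite in_img by dfn. exists (sep G (fun U => x ∈ U)). split.
    + apply in_power. intros U HU. rewrite in_sep in HU by dfn. apply HU.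
    + set_ext y. unfold cls. rewrite in_atom, in_sep by dfn. setoid_rewrite in_sep; [|dfn].
      firstorder.
Qed.

Lemma atom_subset G U x : U ∈ G -> x ∈ U -> atom G x ⊆ U.
Proof. intros HU Hx y Hy. apply in_atom in Hy. apply Hy; assumption. Qed.

Lemma decided_mono G G' x : G ⊆ G' -> decided G' x -> decided G x.
Proof. intros H K U HU. auto. Qed.

Lemma atoms_refine G G' E E' :
  G ⊆ G' -> E ∈ atoms G -> E' ∈ atoms G' -> meets E' E -> E' ⊆ E.
Proof.
  intros H HE HE' (x & Hx' & Hx).
  destruct (atoms_eq HE Hx) as (_ & _ & ->), (atoms_eq HE' Hx') as (_ & _ & ->).
  intros y Hy. apply in_atom in Hy. destruct Hy as (H1 & H2 & H3).
  apply in_atom. split; [exact H1|]. split; [apply (decided_mono H H2)|auto].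
Qed.

Hypothesis HT : is_topology X T.

Lemma decided_nbhd G x : finite G -> decided G x -> x ∈ X -> G ⊆ T ->
  exists V, V ∈ T /\ x ∈ V /\ forall U, U ∈ G -> V ⊆ U \/ ~ meets V U.
Proof.
  intros HG D Hx. revert G HG D.
  apply (finite_ind (P := fun G => decided G x -> G ⊆ T ->
    exists V, V ∈ T /\ x ∈ V /\ forall U, U ∈ G -> V ⊆ U \/ ~ meets V U)); [dfn| |].
  - intros _ _. exists X. split; [apply (open_full HT)|]. split; [exact Hx|].
    intros U HU. elim (in_empty HU).
  - intros G U _ _ IH D HG.
    destruct IH as (V & HV & HxV & K).
    { intros W HW. apply D, in_cup. auto. }
    { intros W HW. apply HG, in_cup. auto. }
    assert (L : exists W, W ∈ T /\ x ∈ W /\ (W ⊆ U \/ ~ meets W U)).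
    { assert (HU : U ∈ cup G (sing U)) by (rewrite in_cup, in_sing; auto).
      destruct (D U HU) as [H|(W & HW & HxW & N)].
      - exists U. split; [auto|]. split; [auto|]. left; apply subset_refl.
      - exists W. auto. }
    destruct L as (W & HW & HxW & L).
    exists (cap V W). split; [apply (open_cap HT); assumption|]. split; [apply in_cap; auto|].
    intros U' HU'. rewrite in_cup, in_sing in HU'. destruct HU' as [HU'| ->].
    + destruct (K U' HU') as [S|N]; [left|right].
      * intros z Hz. apply in_cap in Hz. apply S, Hz.
      * intros (z & Hz & Hz'). apply in_cap in Hz. apply N. exists z. tauto.
    + destruct L as [S|N]; [left|right].
      * intros z Hz. apply in_cap in Hz. apply S, Hz.
      * intros (z & Hz & Hz'). apply in_cap in Hz. apply N. exists z. tauto.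
Qed.

(** The boundary of an open set is nowhere dense. The induction treats one member of [G] at a time,
    shrinking the open set into that member whenever the two meet. *)
Lemma decided_dense G : finite G -> G ⊆ T -> forall V, V ∈ T -> nonempty V ->
  exists W, W ∈ T /\ W ⊆ V /\ nonempty W /\ forall x, x ∈ W -> decided G x.
Proof.
  intros HG HGT.
  assert (S : forall V, V ∈ T -> nonempty V -> exists W, W ∈ T /\ W ⊆ V /\ nonempty W /\
    forall U, U ∈ G -> W ⊆ U \/ ~ meets W U).
  { revert G HG HGT.
    apply (finite_ind (P := fun G => G ⊆ T -> forall V, V ∈ T -> nonempty V ->
      exists W, W ∈ T /\ W ⊆ V /\ nonempty W /\ forall U, U ∈ G -> W ⊆ U \/ ~ meets W U)); [dfn| |].
    - intros _ V HV N. exists V. split; [exact HV|]. split; [apply subset_refl|]. split; [exact N|].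
      intros U HU. elim (in_empty HU).
    - intros G U _ _ IH HG V HV N.
      destruct IH with (V := V) as (W & HW & HWV & NW & K); trivial.
      { intros W HW. apply HG, in_cup. auto. }
      destruct (classic (meets W U)) as [(x & Hx & HxU)|D].
      + exists (cap W U). split; [apply (open_cap HT); auto; apply HG; rewrite in_cup, in_sing; auto|].
        split; [intros z Hz; apply in_cap in Hz; apply HWV, Hz|].
        split; [exists x; apply in_cap; auto|].
        intros U' HU'. rewrite in_cup, in_sing in HU'. destruct HU' as [HU'| ->].
        * destruct (K U' HU') as [S|D]; [left|right].
          -- intros z Hz. apply in_cap in Hz. apply S, Hz.
          -- intros (z & Hz & Hz'). apply in_cap in Hz. apply D. exists z. tauto.
        * left. intros z Hz. apply in_cap in Hz. apply Hz.
      + exists W. repeat split; trivial.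
        intros U' HU'. rewrite in_cup, in_sing in HU'. destruct HU' as [HU'| ->]; auto. }
  intros V HV N. destruct (S V HV N) as (W & HW & HWV & NW & K).
  exists W. repeat split; trivial. intros x Hx U HU. destruct (K U HU); [left|right]; eauto.
Qed.

Section RegularGenerators.
Variable G : M.
Hypotheses (HG : finite G) (HR : G ⊆ regular_sets T).

Lemma generators_open : G ⊆ T.
Proof. intros U HU. apply HR in HU. apply in_regular_sets in HU. apply HU. Qed.

Lemma atoms_nonempty E : E ∈ atoms G -> nonempty E.
Proof.
  intros H. apply in_atoms in H. destruct H as (x & Hx & D & ->). exists x. apply atom_self; assumption.
Qed.

Lemma atom_open x : x ∈ X -> decided G x -> atom G x ∈ T.
Proof.
  intros Hx0 Dx0. apply (open_local HT). intros x1 Hx. rewrite <- (atom_eq Hx). rename x into x0, x1 into x.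
  assert (K := Hx). apply in_atom in K. destruct K as (HxX & Dx & _).
  destruct (decided_nbhd HG Dx HxX generators_open) as (V & HV & HxV & K).
  exists V. split; [exact HV|]. split; [exact HxV|]. intros y Hy. apply in_atom.
  split; [apply (open_subset HT HV Hy)|]. split.
  - intros U HU. destruct (K U HU); [left|right]; eauto.
  - intros U HU. destruct (K U HU) as [S|N]; [split; auto|].
    split; intros L; elim N; [exists x|exists y]; auto.
Qed.

(** An atom is the intersection of the members of [G] containing [x] with the exteriors of the
    others. An open set in which the atom is dense is contained in the former, by their regularity,
    and misses the latter, since they are open. *)
Lemma atom_regular x : x ∈ X -> decided G x -> regular T (atom G x).
Proof.
  intros Hx Dx. split; [apply atom_open; assumption|]. intros V HV D y Hy.
  assert (A : forall U, U ∈ G -> x ∈ U -> V ⊆ U).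
  { intros U HU HxU. assert (K := HR HU). apply in_regular_sets in K. apply K; [exact HV|].
    intros W HW HWV N. destruct (D W HW HWV N) as (z & Hz & Hz'). exists z. split; [exact Hz|].
    apply (atom_subset HU HxU Hz'). }
  assert (B : forall U, U ∈ G -> x ∉ U -> ~ meets V U).
  { intros U HU HxU (z & Hz & HzU).
    destruct (D (cap V U)) as (z' & Hz' & K).
    - apply (open_cap HT); [exact HV|apply generators_open, HU].
    - intros z' Hz'. apply in_cap in Hz'. tauto.
    - exists z. apply in_cap. auto.
    - apply in_cap in Hz'. apply in_atom in K. apply HxU. apply (proj2 (proj2 K) U HU). tauto. }
  apply in_atom. split; [apply (open_subset HT HV Hy)|]. split.
  - intros U HU. destruct (classic (x ∈ U)) as [K|K]; [left; apply (A U HU K y Hy)|right; eauto].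
  - intros U HU. split; intros K; [apply (A U HU K y Hy)|].
    apply NNPP. intros N. apply (B U HU N). exists y; auto.
Qed.

Lemma atoms_regular E : E ∈ atoms G -> regular T E.
Proof. intros H. apply in_atoms in H. destruct H as (x & Hx & D & ->). apply atom_regular; assumption. Qed.

Lemma atoms_dense V : V ∈ T -> nonempty V -> exists x, x ∈ V /\ atom G x ∈ atoms G /\ x ∈ atom G x.
Proof.
  intros HV N. destruct (decided_dense HG generators_open HV N) as (W & HW & HWV & (x & Hx) & D).
  assert (HxX := open_subset HT HW Hx).
  exists x. split; [auto|]. split; [apply in_atoms; eauto|]. apply atom_self; auto.
Qed.

Lemma atoms_cellular : cellular_family T (atoms G).
Proof.
  split; [|split].
  - intros E HE. apply atoms_regular, HE.
  - apply atoms_nonempty.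
  - intros U V HU HV N x Hx Hx'. apply N. apply (atoms_disjoint HU HV). exists x; auto.
Qed.

End RegularGenerators.

(** The atoms inside [U] are dense in [U]. Since [U'] may lie outside [G], regular open sets from
    different stages of the sequence can be compared. *)
Lemma regular_from_atoms G U U' : finite G -> G ⊆ regular_sets T ->
  U ∈ G -> regular T U' -> (forall E, E ∈ atoms G -> E ⊆ U -> E ⊆ U') -> U ⊆ U'.
Proof.
  intros HG HR HU HU' H. apply HU'; [apply (generators_open HR HU)|].
  intros W HW HWU N. destruct (atoms_dense HG HR HW N) as (x & Hx & K & Hx').
  exists x. split; [exact Hx|]. apply (H _ K); [|exact Hx']. apply (atom_subset HU). auto.
Qed.

End Atoms.
#[export] Hint Resolve D_decided DT_atom DT_atoms : dfn.

(** * From IQDI to cellular families *)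

Section AtomSequence.
Context {M : set_structure} {ZF : is_ZF_model M}.
Implicit Types a b c f p q s t u x y z m n k : M.
Implicit Types U V W E : M.
Variables X T : M.
Hypothesis HT : is_topology X T.
Variable F : M -> M.
Hypothesis DF : definable_term (fun v => F (v 0)).
Hypothesis F_regular : forall n, n ∈ omega -> F n ⊆ regular_sets T.
Hypothesis F_finite : forall n, n ∈ omega -> finite (F n).
Hypothesis F_inj : injective_on F omega.

Definition generators n : M := bigcup (img n F).
Definition level n : M := atoms X T (generators n).

Lemma DT_generators : definable_term (fun v => generators (v 0)).
Proof. dfn. Qed.
#[local] Hint Resolve DT_generators : dfn.
Lemma DT_level : definable_term (fun v => level (v 0)).
Proof. dfn. Qed.
#[local] Hint Resolve DT_level : dfn.

Lemma in_generators n U : U ∈ generators n <-> exists m, m ∈ n /\ U ∈ F m.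
Proof.
  unfold generators. rewrite in_bigcup. split.
  - intros (s & Hs & H). rewrite in_img in Hs by dfn. destruct Hs as (m & Hm & ->). eauto.
  - intros (m & Hm & H). exists (F m). rewrite in_img by dfn. eauto.
Qed.

Lemma generators_finite n : n ∈ omega -> finite (generators n).
Proof.
  intros Hn. apply finite_bigcup.
  - apply finite_img; [dfn|apply finite_omega, Hn].
  - intros s Hs. rewrite in_img in Hs by dfn. destruct Hs as (m & Hm & ->).
    apply F_finite, (omega_mem Hn Hm).
Qed.

Lemma generators_regular n : n ∈ omega -> generators n ⊆ regular_sets T.
Proof.
  intros Hn U HU. apply in_generators in HU. destruct HU as (m & Hm & HU).
  apply (F_regular (omega_mem Hn Hm) HU).
Qed.

Lemma generators_mono m n : m ⊆ n -> generators m ⊆ generators n.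
Proof.
  intros H U HU. apply in_generators in HU. destruct HU as (k & Hk & HU).
  apply in_generators. eauto.
Qed.

Lemma level_finite n : n ∈ omega -> finite (level n).
Proof. intros Hn. apply atoms_finite, generators_finite, Hn. Qed.

Lemma level_regular n E : n ∈ omega -> E ∈ level n -> regular T E.
Proof. intros Hn. apply (atoms_regular HT (generators_finite Hn) (generators_regular Hn)). Qed.

Lemma level_open n E : n ∈ omega -> E ∈ level n -> E ∈ T.
Proof. intros Hn H. apply (level_regular Hn H). Qed.

Lemma all_generators_infinite : infinite (bigcup (img omega F)).
Proof.
  intros H. apply omega_infinite. apply (finite_injects (b := power (bigcup (img omega F)))).
  - exists F. split; [exact DF|]. split; [|exact F_inj].
    intros n Hn. apply in_power. intros U HU. apply in_bigcup. exists (F n).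
    rewrite in_img by dfn. eauto.
  - apply finite_power, H.
Qed.

(** By [regular_from_atoms] a generator is determined by the set of atoms it contains, so finitely
    many atoms would allow only finitely many generators. *)
Lemma all_atoms_infinite : infinite (bigcup (img omega level)).
Proof.
  intros H. apply all_generators_infinite.
  apply finite_injective with
    (F := fun U => sep (bigcup (img omega level)) (fun E => E ⊆ U)); [dfn| |].
  - assert (K : forall U U', U ∈ bigcup (img omega F) -> U' ∈ bigcup (img omega F) ->
      sep (bigcup (img omega level)) (fun E => E ⊆ U) =
      sep (bigcup (img omega level)) (fun E => E ⊆ U') -> U ⊆ U').
    { intros U U' HU HU' Eq. apply in_bigcup in HU, HU'.
      destruct HU as (s & Hs & HU), HU' as (s' & Hs' & HU').
      rewrite in_img in Hs, Hs' by dfn.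
      destruct Hs as (n & Hn & ->), Hs' as (n' & Hn' & ->).
      (* [generators n] collects the terms before [n], so the members of [F n] enter at [succ n]. *)
      assert (Sn := succ_omega Hn).
      apply (regular_from_atoms HT (generators_finite Sn) (generators_regular Sn)).
      - apply in_generators. exists n. split; [apply in_succ; auto|exact HU].
      - apply F_regular in HU'; [|exact Hn']. apply in_regular_sets in HU'. exact HU'.
      - intros E HE HEU.
        assert (L : E ∈ sep (bigcup (img omega level)) (fun E => E ⊆ U)).
        { rewrite in_sep by dfn. split; [|exact HEU]. apply in_bigcup. exists (level (succ n)).
          rewrite in_img by dfn. eauto. }
        rewrite Eq, in_sep in L by dfn. apply L. }
    intros U U' HU HU' Eq. apply subset_antisym; apply K; auto.
  - apply (finite_subset (finite_power H)). intros s Hs. rewrite in_img in Hs by dfn.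
    destruct Hs as (U & _ & ->). apply in_power. intros E HE. rewrite in_sep in HE by dfn. apply HE.
Qed.

Lemma levels_infinite : infinite (img omega level).
Proof.
  intros H. apply all_atoms_infinite. apply (finite_bigcup H). intros s Hs.
  rewrite in_img in Hs by dfn. destruct Hs as (n & Hn & ->). apply level_finite, Hn.
Qed.

(** Consecutive levels may coincide, while a regular matrix has to be injective. There are
    infinitely many different levels, so a subsequence serves. *)
Lemma atoms_regular_matrix : has_regular_matrix X T.
Proof.
  destruct (injective_subsequence DT_level levels_infinite) as (g & Hg & I & H).
  exists g, omega. split; [apply is_omegaE; reflexivity|]. split; [exact Hg|]. split.
  - intros n n' y K K'. apply (mapsP _ _ Hg) in K, K'. destruct K as [Hn ->], K' as [Hn' E]. auto.
  - intros n a K. apply (mapsP _ _ Hg) in K. destruct K as [Hn ->].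
    destruct (H n Hn) as (k & Hk & ->). split; [apply level_finite, Hk|]. split; [|split].
    + apply (atoms_cellular HT (generators_finite Hk) (generators_regular Hk)).
    + intros U HU. apply (regular_openP HT), (level_regular Hk HU).
    + intros x Hx. split; [exact Hx|]. intros U HU HxU.
      destruct (atoms_dense HT (generators_finite Hk) (generators_regular Hk) HU) as (y & Hy & K1 & K2);
        [exists x; exact HxU|].
      exists y. split; [exact Hy|]. eauto.
Qed.

Lemma level_refine m n E E' :
  m ⊆ n -> E ∈ level m -> E' ∈ level n -> meets E' E -> E' ⊆ E.
Proof. intros H. apply atoms_refine, generators_mono, H. Qed.

Lemma level_above m n E' : m ⊆ n -> E' ∈ level n -> exists E, E ∈ level m /\ E' ⊆ E.
Proof.
  intros H HE'. assert (K := HE'). apply in_atoms in K. destruct K as (x & Hx & D & EE).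
  assert (Dm := decided_mono (generators_mono H) D).
  exists (atom X T (generators m) x). assert (L : atom X T (generators m) x ∈ level m) by (apply in_atoms; eauto).
  split; [exact L|]. apply (level_refine H L HE'). exists x. rewrite EE. split; apply atom_self; assumption.
Qed.

(** * Splitting nodes of the tree of atoms *)

Definition children n E : M := sep (level (succ n)) (fun V => V ⊆ E).

Lemma DT_children : definable_term (fun v => children (v 0) (v 1)).
Proof. dfn. Qed.
#[local] Hint Resolve DT_children : dfn.

Lemma in_children n E V : V ∈ children n E <-> V ∈ level (succ n) /\ V ⊆ E.
Proof. unfold children. rewrite in_sep by dfn. tauto. Qed.

(** The atoms of the next level are dense in [E]; if [V] is the only one inside [E], then regularity
    of [V] gives [E ⊆ V]. *)
Lemma unsplit_level n E V : n ∈ omega -> E ∈ level n -> V ∈ children n E ->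
  ~ at_least_two (children n E) -> E = V.
Proof.
  intros Hn HE HV N. assert (HV' := HV). apply in_children in HV'. destruct HV' as [HV1 HV2].
  apply subset_antisym; [|exact HV2]. assert (Sn := succ_omega Hn).
  apply (level_regular Sn HV1); [apply (level_open Hn HE)|].
  intros W HW HWE NW.
  destruct (atoms_dense HT (generators_finite Sn) (generators_regular Sn) HW NW) as (y & Hy & K1 & K2).
  exists y. split; [exact Hy|].
  assert (HA : atom X T (generators (succ n)) y ∈ children n E).
  { apply in_children. split; [exact K1|].
    apply (level_refine (m := n) (n := succ n)); trivial.
    - intros z Hz. apply in_succ. auto.
    - exists y. auto. }
  replace V with (atom X T (generators (succ n)) y); [exact K2|].
  apply NNPP. intros Ne. apply N. exists (atom X T (generators (succ n)) y), V. auto.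
Qed.

(** The same atom can occur on several levels and have different children there, so a node carries
    its level. *)
Definition splitting : M :=
  sep (prod omega (bigcup (img omega level)))
    (fun z => exists n E, z = opair n E /\ E ∈ level n /\ at_least_two (children n E)).

Lemma in_splitting z : z ∈ splitting <->
  exists n E, n ∈ omega /\ z = opair n E /\ E ∈ level n /\ at_least_two (children n E).
Proof.
  unfold splitting. rewrite in_sep by dfn. split.
  - intros (H & n & E & -> & K). apply opair_in_prod in H. exists n, E. tauto.
  - intros (n & E & Hn & -> & H & K). split; [|eauto]. apply opair_in_prod.
    split; [exact Hn|]. apply in_bigcup. exists (level n). rewrite in_img by dfn. eauto.
Qed.

(* The levels are constant along indices without splitting nodes. *)
Lemma splitting_infinite : infinite splitting.
Proof.
  intros H. apply all_atoms_infinite.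
  set (first := fun z => the (fun n => exists E, z = opair n E)).
  assert (Dfirst : definable_term (fun v => first (v 0))) by (unfold first; dfn).
  assert (firstE : forall n E, first (opair n E) = n).
  { intros n E. apply the_eq; [eauto|]. intros m (E' & K). apply opair_inj in K. destruct K; auto. }
  (* An atom first appears either on level 0 or on the level just after a splitting node; finitely
     many such nodes would confine all atoms to the finite set [K]. *)
  set (K := cup (level empty) (bigcup (img (img splitting first) (fun n => level (succ n))))).
  assert (FK : finite K).
  { apply finite_cup; [apply level_finite, empty_omega|]. apply finite_bigcup.
    - apply finite_img; [dfn|]. apply finite_img; [dfn|]. exact H.
    - intros s Hs. rewrite in_img in Hs by dfn. destruct Hs as (n & Hn & ->).
      rewrite in_img in Hn by dfn. destruct Hn as (z & Hz & ->). apply in_splitting in Hz.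
      destruct Hz as (n & E & Hn & -> & _). rewrite firstE. apply level_finite, succ_omega, Hn. }
  apply (finite_subset FK). intros E HE. apply in_bigcup in HE. destruct HE as (s & Hs & HE).
  rewrite in_img in Hs by dfn. destruct Hs as (n & Hn & ->). revert HE. revert E. revert n Hn.
  apply (omega_ind (P := fun n => forall E, E ∈ level n -> E ∈ K)); [dfn| |].
  - intros E HE. apply in_cup. auto.
  - intros n Hn IH V HV.
    destruct (level_above (m := n) (n := succ n) (E' := V)) as (E & HE & HVE); trivial.
    { intros z Hz. apply in_succ. auto. }
    destruct (classic (at_least_two (children n E))) as [S|S].
    + apply in_cup. right. apply in_bigcup. exists (level (succ n)). split; [|exact HV].
      rewrite in_img by dfn. exists n. split; [|reflexivity].
      rewrite in_img by dfn. exists (opair n E). rewrite in_splitting, firstE. eauto 8.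
    + rewrite <- (unsplit_level Hn HE (V := V)); trivial; [auto|]. apply in_children; auto.
Qed.

Lemma splitting_countable_union : countable_union_of_finite_sets splitting.
Proof.
  set (slice := fun n => sep splitting (fun z => exists E, z = opair n E)).
  assert (Ds : definable_term (fun v => slice (v 0))) by (unfold slice; dfn).
  exists (img omega slice). split; [|split].
  - set (index := fun s => the (fun n => n ∈ omega /\ s = slice n /\
      forall m, m ∈ omega -> s = slice m -> n = m \/ n ∈ m)).
    assert (Di : definable_term (fun v => index (v 0))) by (unfold index; dfn).
    assert (Hi : forall s, s ∈ img omega slice -> index s ∈ omega /\ s = slice (index s)).
    { intros s Hs. rewrite in_img in Hs by dfn.
      destruct (omega_least (P := fun n => s = slice n)) as (n & Hn & E & L); [dfn|exact Hs|].
      replace (index s) with n; [auto|]. symmetry. apply the_eq; [auto|].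
      intros m (Hm & Em & Lm). destruct (Lm n Hn E) as [K|K]; [auto|].
      destruct (L m Hm Em) as [K'|K']; [auto|]. elim (mem_asym K K'). }
    exists omega, (img (img omega slice) index). split; [apply is_omegaE; reflexivity|]. split.
    + intros n Hn. rewrite in_img in Hn by dfn. destruct Hn as (s & Hs & ->). apply Hi, Hs.
    + apply equipotentP. exists index. split; [exact Di|]. split; [|split].
      * intros s Hs. rewrite in_img by dfn. eauto.
      * intros s s' Hs Hs' E. rewrite (proj2 (Hi s Hs)), (proj2 (Hi s' Hs')). congruence.
      * intros n Hn. rewrite in_img in Hn by dfn. exact Hn.
  - intros s Hs. rewrite in_img in Hs by dfn. destruct Hs as (n & Hn & ->).
    apply finite_subset with (img (level n) (fun E => opair n E)).
    + apply finite_img; [dfn|apply level_finite, Hn].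
    + intros z Hz. unfold slice in Hz. rewrite in_sep in Hz by dfn. destruct Hz as (Hz & E & ->).
      apply in_splitting in Hz. destruct Hz as (n' & E' & _ & Eq & HE & _).
      apply opair_inj in Eq. destruct Eq; subst n' E'. rewrite in_img by dfn. eauto.
  - apply is_unionE. set_ext z. rewrite in_bigcup. split.
    + intros Hz. assert (K := Hz). apply in_splitting in K. destruct K as (n & E & Hn & -> & _).
      exists (slice n). rewrite in_img by dfn. split; [eauto|]. unfold slice. rewrite in_sep by dfn. eauto.
    + intros (s & Hs & Hz). rewrite in_img in Hs by dfn. destruct Hs as (n & _ & ->).
      unfold slice in Hz. rewrite in_sep in Hz by dfn. apply Hz.
Qed.

(** * Repeated halving along the selected children *)

Section Selection.
Variables I B : M.
Hypothesis I_splitting : I ⊆ splitting.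
Hypothesis I_infinite : infinite I.
Hypothesis B_proper : forall n E, opair n E ∈ I -> nonempty (app B (opair n E)) /\
  app B (opair n E) ⊆ children n E /\ app B (opair n E) <> children n E.

Lemma I_inv z : z ∈ I -> exists n E, z = opair n E /\ n ∈ omega /\ E ∈ level n.
Proof.
  intros H. apply I_splitting, in_splitting in H. destruct H as (n & E & Hn & -> & HE & _). eauto.
Qed.

Lemma I_pair n E : opair n E ∈ I -> n ∈ omega /\ E ∈ level n.
Proof.
  intros H. destruct (I_inv H) as (n' & E' & Eq & H'). apply opair_inj in Eq. destruct Eq; subst; auto.
Qed.

(* Every node (n, E) of [I] has a child inside [cutter n] and a child disjoint from it. *)
Definition cutter n : M :=
  bigcup (sep (level (succ n)) (fun V => exists E, opair n E ∈ I /\ V ∈ app B (opair n E))).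

Lemma DT_cutter : definable_term (fun v => cutter (v 0)).
Proof. dfn. Qed.
#[local] Hint Resolve DT_cutter : dfn.

Lemma in_cutter n x : x ∈ cutter n <->
  exists V E, V ∈ level (succ n) /\ opair n E ∈ I /\ V ∈ app B (opair n E) /\ x ∈ V.
Proof.
  unfold cutter. rewrite in_bigcup. split.
  - intros (V & HV & Hx). rewrite in_sep in HV by dfn. destruct HV as (HV & E & K). exists V, E. tauto.
  - intros (V & E & HV & HE & HB & Hx). exists V. rewrite in_sep by dfn. eauto.
Qed.

Lemma cutter_open n : n ∈ omega -> cutter n ∈ T.
Proof.
  intros Hn. apply (open_bigcup HT). intros V HV. rewrite in_sep in HV by dfn.
  apply (level_open (succ_omega Hn)), HV.
Qed.

(** The cutter is a union of members of level [succ n], and these are pairwise disjoint.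
    Consequently every atom of a later level also lies on one side of it. *)
Lemma cutter_level n V : V ∈ level (succ n) -> V ⊆ cutter n \/ ~ meets V (cutter n).
Proof.
  intros HV. destruct (classic (meets V (cutter n))) as [(x & Hx & K)|N]; [left|auto].
  apply in_cutter in K. destruct K as (V' & E & HV' & HE & HB & Hx').
  assert (Eq : V = V') by (apply (atoms_disjoint HV HV'); exists x; auto). subst V'.
  intros y Hy. apply in_cutter. exists V, E. auto.
Qed.

Definition nodes_below a : M := sep I (fun z => exists n E, z = opair n E /\ E ⊆ a).

Lemma DT_nodes_below : definable_term (fun v => nodes_below (v 0)).
Proof. dfn. Qed.
#[local] Hint Resolve DT_nodes_below : dfn.

Lemma in_nodes_below a n E : opair n E ∈ nodes_below a <-> opair n E ∈ I /\ E ⊆ a.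
Proof.
  unfold nodes_below. rewrite in_sep by dfn. split; intros [H K]; (split; [exact H|]); [|eauto].
  destruct K as (n' & E' & Eq & K). apply opair_inj in Eq. destruct Eq; subst; auto.
Qed.

(** Cutting at the least level that has a selected node below [a] means that only nodes of this one
    finite level can lie astride the cut. *)
Definition rank a : M := the (fun n => (exists E, opair n E ∈ nodes_below a) /\
  forall m, (exists E, opair m E ∈ nodes_below a) -> n = m \/ n ∈ m).

Lemma DT_rank : definable_term (fun v => rank (v 0)).
Proof. dfn. Qed.
#[local] Hint Resolve DT_rank : dfn.

Lemma nodes_below_pair a n E : opair n E ∈ nodes_below a -> n ∈ omega /\ E ∈ level n.
Proof. intros H. apply in_nodes_below in H. apply I_pair, H. Qed.

Lemma nodes_below_inv a z : z ∈ nodes_below a -> exists n E, z = opair n E.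
Proof.
  intros H. unfold nodes_below in H. rewrite in_sep in H by dfn.
  destruct H as (_ & n & E & -> & _). eauto.
Qed.

Lemma rank_spec a : infinite (nodes_below a) ->
  rank a ∈ omega /\ (exists E, opair (rank a) E ∈ nodes_below a) /\
  forall n E, opair n E ∈ nodes_below a -> rank a = n \/ rank a ∈ n.
Proof.
  intros H.
  destruct (omega_least (P := fun n => exists E, opair n E ∈ nodes_below a)) as (n & Hn & Hne & L).
  - dfn.
  - destruct (empty_or_nonempty (nodes_below a)) as [K|[z Hz]].
    + elim H. rewrite K. apply finite_empty.
    + destruct (nodes_below_inv Hz) as (n & E & ->). exists n. split; [|eauto].
      apply (nodes_below_pair Hz).
  - assert (L' : forall m, (exists E, opair m E ∈ nodes_below a) -> n = m \/ n ∈ m).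
    { intros m K. apply L; [|exact K]. destruct K as [E K]. apply (nodes_below_pair K). }
    replace (rank a) with n; [split; [exact Hn|split; [exact Hne|eauto]]|].
    symmetry. apply the_eq; [auto|]. intros m (Hm & Lm).
    destruct (Lm n Hne) as [K|K]; [auto|]. destruct (L' m Hm) as [K'|K']; [auto|].
    elim (mem_asym K K').
Qed.

Definition inside a : M := cap a (cutter (rank a)).
(** The exterior of the cutter replaces its complement so that both halves are open; boundary points
    of the cutter are given up. *)
Definition outside a : M :=
  sep a (fun x => exists V, V ∈ T /\ x ∈ V /\ ~ meets V (cutter (rank a))).

Lemma DT_inside : definable_term (fun v => inside (v 0)).
Proof. dfn. Qed.
Lemma DT_outside : definable_term (fun v => outside (v 0)).
Proof. dfn. Qed.
#[local] Hint Resolve DT_inside DT_outside : dfn.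

Lemma in_inside a x : x ∈ inside a <-> x ∈ a /\ x ∈ cutter (rank a).
Proof. apply in_cap. Qed.

Lemma in_outside a x :
  x ∈ outside a <-> x ∈ a /\ exists V, V ∈ T /\ x ∈ V /\ ~ meets V (cutter (rank a)).
Proof. unfold outside. rewrite in_sep by dfn. tauto. Qed.

Definition fat a : Prop := a ∈ T /\ infinite (nodes_below a).

Lemma inside_open a : fat a -> inside a ∈ T.
Proof. intros [H K]. apply (open_cap HT H), cutter_open, rank_spec, K. Qed.

Lemma outside_open a : fat a -> outside a ∈ T.
Proof.
  intros [H K]. apply (open_local HT). intros x Hx. apply in_outside in Hx.
  destruct Hx as (Hx & V & HV & HxV & N). exists (cap a V).
  split; [apply (open_cap HT); assumption|]. split; [apply in_cap; auto|].
  intros y Hy. apply in_cap in Hy. apply in_outside. split; [apply Hy|]. exists V. tauto.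
Qed.

Lemma inside_nonempty a : fat a -> nonempty (inside a).
Proof.
  intros [H K]. destruct (rank_spec K) as (Hn & (E & HE) & _).
  apply in_nodes_below in HE. destruct HE as [HE HEa].
  destruct (B_proper HE) as ((V & HV) & S & _). assert (HV' := S V HV).
  apply in_children in HV'. destruct HV' as [HV' HVE].
  destruct (atoms_nonempty HV') as (x & Hx). exists x. apply in_inside. split; [auto|].
  apply in_cutter. exists V, E. auto.
Qed.

Lemma outside_nonempty a : fat a -> nonempty (outside a).
Proof.
  intros [H K]. destruct (rank_spec K) as (Hn & (E & HE) & _).
  apply in_nodes_below in HE. destruct HE as [HE HEa].
  destruct (B_proper HE) as (_ & S & N).
  assert (L : exists V, V ∈ children (rank a) E /\ V ∉ app B (opair (rank a) E)).
  { apply NNPP. intros L. apply N. apply subset_antisym; [exact S|]. intros V HV.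
    apply NNPP. intros HB. apply L. eauto. }
  destruct L as (V & HV & HB). apply in_children in HV. destruct HV as [HV HVE].
  destruct (atoms_nonempty HV) as (x & Hx). exists x. apply in_outside. split; [auto|].
  exists V. split; [apply (level_open (succ_omega Hn) HV)|]. split; [exact Hx|].
  intros (y & Hy & Hyc). apply in_cutter in Hyc.
  destruct Hyc as (V' & E' & HV' & HE' & HB' & Hy').
  assert (Eq : V = V') by (apply (atoms_disjoint HV HV'); exists y; auto). subst V'.
  destruct (B_proper HE') as (_ & S' & _). specialize (S' V HB'). apply in_children in S'.
  (* If [V] were part of the cutter because of another node [E'] of the same level, it would lie in
     both [E] and [E'], which are disjoint unless equal. *)
  assert (Eq : E = E').
  { apply (atoms_disjoint (proj2 (I_pair HE)) (proj2 (I_pair HE'))). exists y. split; [auto|].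
    apply S', Hy. }
  subst E'. auto.
Qed.

Lemma inside_outside_disjoint a : disjoint (inside a) (outside a).
Proof.
  intros x Hx Hx'. apply in_inside in Hx. apply in_outside in Hx'.
  destruct Hx' as (_ & V & _ & HxV & N). apply N. exists x. tauto.
Qed.

(* Except for those of least level, all nodes below [a] lie in one of the two halves, and each
   level is finite. *)
Lemma fat_split a : fat a -> fat (inside a) \/ fat (outside a).
Proof.
  intros HA. destruct (classic (finite (nodes_below (inside a)))) as [Fi|Fi];
    [right|left; split; [apply inside_open, HA|exact Fi]].
  split; [apply outside_open, HA|]. intros Fo. destruct HA as [HaT Ha]. apply Ha.
  destruct (rank_spec Ha) as (Hn & _ & L).
  apply finite_subset with
    (cup (img (level (rank a)) (opair (rank a))) (cup (nodes_below (inside a)) (nodes_below (outside a)))).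
  { apply finite_cup; [apply finite_img; [dfn|apply level_finite, Hn]|apply finite_cup; assumption]. }
  intros z Hz. destruct (nodes_below_inv Hz) as (n & E & ->).
  destruct (nodes_below_pair Hz) as [Hno HE].
  assert (Hz' := Hz). apply in_nodes_below in Hz'. destruct Hz' as [HI HEa].
  rewrite !in_cup, !in_nodes_below.
  destruct (L n E Hz) as [Eq|Hlt].
  - left. subst n. rewrite in_img by dfn. eauto.
  - right. assert (Hs : succ (rank a) ⊆ n).
    { intros m Hm. apply in_succ in Hm. destruct Hm as [Hm| ->]; [|exact Hlt].
      apply (omega_subset Hno Hlt Hm). }
    destruct (level_above Hs HE) as (V & HV & HEV).
    destruct (cutter_level HV) as [S|N]; [left|right]; (split; [exact HI|]); intros x Hx.
    + apply in_inside. auto.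
    + apply in_outside. split; [auto|]. exists V.
      split; [apply (level_open (succ_omega Hn) HV)|]. auto.
Qed.

(** When both halves are fat the inside is kept; this fixed preference makes the step a definable
    function. *)
Definition next a : M := ite (fat (inside a)) (inside a) (outside a).
Definition cell a : M := ite (fat (inside a)) (outside a) (inside a).

Lemma D_fat : definable (fun v => fat (v 0)).
Proof. dfn. Qed.
#[local] Hint Resolve D_fat : dfn.
Lemma DT_next : definable_term (fun v => next (v 0)).
Proof. dfn. Qed.
Lemma DT_cell : definable_term (fun v => cell (v 0)).
Proof. dfn. Qed.
#[local] Hint Resolve DT_next DT_cell : dfn.

Lemma next_cell a : fat a -> fat (next a) /\ next a ⊆ a /\ cell a ⊆ a /\
  cell a ∈ T /\ nonempty (cell a) /\ disjoint (cell a) (next a).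
Proof.
  intros HA.
  assert (Si : inside a ⊆ a) by (intros x Hx; apply in_inside in Hx; apply Hx).
  assert (So : outside a ⊆ a) by (intros x Hx; apply in_outside in Hx; apply Hx).
  assert (D := @inside_outside_disjoint a).
  assert (D' : disjoint (outside a) (inside a)) by (intros x Hx Hx'; apply (D x Hx' Hx)).
  destruct (classic (fat (inside a))) as [K|K]; unfold next, cell.
  - rewrite !ite_true by exact K. repeat split; trivial;
      try apply K; first [apply outside_open|apply outside_nonempty]; exact HA.
  - rewrite !ite_false by exact K. destruct (fat_split HA) as [L|L]; [tauto|]. repeat split; trivial;
      try apply L; first [apply inside_open|apply inside_nonempty]; exact HA.
Qed.

Lemma selection_cellular : has_denumerable_cellular_family T.
Proof.
  assert (F0 : fat X).
  { split; [apply (open_full HT)|]. intros K. apply I_infinite. apply (finite_subset K).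
    intros z Hz. destruct (I_inv Hz) as (n & E & -> & Hn & HE). apply in_nodes_below.
    split; [exact Hz|]. apply (open_subset HT), (level_open Hn HE). }
  (* Recursion needs a set of states, and the fat sets are members of [T]. *)
  set (states := sep T (fun a => fat a)).
  assert (Hst : forall a, a ∈ states <-> fat a).
  { intros a. unfold states. rewrite in_sep by dfn. unfold fat. tauto. }
  destruct (recursion DT_next (a := states) (x0 := X)) as (f & Hf & f0 & fS).
  { apply Hst, F0. }
  { intros a Ha. apply Hst in Ha. apply Hst. apply (next_cell Ha). }
  assert (fat_f : forall n, n ∈ omega -> fat (app f n)).
  { intros n Hn. apply Hst, (function_app Hf Hn). }
  set (c := fun n => cell (app f n)).
  assert (Dc : definable_term (fun v => c (v 0))) by (unfold c; dfn).
  assert (Hc : forall n, n ∈ omega -> c n ∈ T /\ nonempty (c n)).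
  { intros n Hn. destruct (next_cell (fat_f n Hn)) as (_ & _ & _ & H & K & _). auto. }
  (* The cell discarded at stage [i] misses the next state, and the states decrease from there
     on. *)
  assert (mono : forall j, j ∈ omega -> forall i, i ∈ j -> disjoint (c i) (app f j)).
  { apply (omega_ind (P := fun j => forall i, i ∈ j -> disjoint (c i) (app f j))); [dfn| |].
    - intros i Hi. elim (in_empty Hi).
    - intros j Hj IH i Hi. rewrite fS by exact Hj.
      destruct (next_cell (fat_f j Hj)) as (_ & S & _ & _ & _ & D).
      apply in_succ in Hi. destruct Hi as [Hi| ->]; [|exact D].
      intros x Hx Hx'. apply (IH i Hi x Hx). auto. }
  assert (dis : forall i j, j ∈ omega -> i ∈ j -> disjoint (c i) (c j)).
  { intros i j Hj Hi x Hx Hx'. apply (mono j Hj i Hi x Hx).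
    destruct (next_cell (fat_f j Hj)) as (_ & _ & S & _). apply S, Hx'. }
  assert (dis' : forall i j, i ∈ omega -> j ∈ omega -> i = j \/ disjoint (c i) (c j)).
  { intros i j Hi Hj. destruct (omega_total Hi Hj) as [K|[K|K]]; [right|auto|right].
    - apply dis; assumption.
    - intros x Hx Hx'. apply (dis j i Hi K x Hx' Hx). }
  exists (img omega c). split; [split; [|split]|].
  - intros U HU. rewrite in_img in HU by dfn. destruct HU as (n & Hn & ->). apply Hc, Hn.
  - intros U HU. rewrite in_img in HU by dfn. destruct HU as (n & Hn & ->). apply Hc, Hn.
  - intros U V HU HV N. rewrite in_img in HU, HV by dfn.
    destruct HU as (i & Hi & ->), HV as (j & Hj & ->).
    destruct (dis' i j Hi Hj) as [->|D]; [tauto|exact D].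
  - apply denumerable_img; [dfn|]. intros i j Hi Hj E.
    destruct (dis' i j Hi Hj) as [K|D]; [exact K|].
    destruct (proj2 (Hc i Hi)) as (x & Hx). elim (D x Hx). rewrite <- E. exact Hx.
Qed.

End Selection.

Lemma QPKW_cellular : QPKW M -> has_denumerable_cellular_family T.
Proof.
  intros Q.
  set (A := fun z => the (fun a => exists n E, z = opair n E /\ a = children n E)).
  assert (DA : definable_term (fun v => A (v 0))) by (unfold A; dfn).
  assert (AE : forall n E, A (opair n E) = children n E).
  { intros n E. apply the_eq; [eauto|]. intros a (n' & E' & Eq & ->).
    apply opair_inj in Eq. destruct Eq; subst; auto. }
  destruct (Q splitting (lam splitting A)) as (I & B & HI & InfI & HB & K).
  - exact splitting_infinite.
  - apply lam_family, DA.
  - intros z a Hz. rewrite maps_lam in Hz by exact DA. destruct Hz as [Hz ->].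
    apply in_splitting in Hz. destruct Hz as (n & E & Hn & -> & HE & H2). rewrite AE.
    split; [|exact H2]. apply (finite_subset (level_finite (succ_omega Hn))).
    intros V HV. apply in_children in HV. apply HV.
  - exact splitting_countable_union.
  - apply (selection_cellular HI InfI (B := B)). intros n E Hz.
    apply (K (opair n E)).
    + rewrite maps_lam by exact DA. split; [auto|]. symmetry. apply AE.
    + apply (family_app HB Hz).
Qed.

End AtomSequence.

Section FromIQDI.
Context {M : set_structure} {ZF : is_ZF_model M}.
Variables X T : M.
Hypotheses (HI : IQDI M) (HT : is_topology X T) (HX : infinite X) (HH : hausdorff X T).

Lemma IQDI_regular_sequence : exists F, definable_term (fun v => F (v 0)) /\
  (forall n, n ∈ omega -> F n ⊆ regular_sets T) /\
  (forall n, n ∈ omega -> finite (F n)) /\ injective_on F omega.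
Proof.
  destruct (HI (regular_sets_infinite HT HH HX)) as (D & HD & K).
  destruct (denumerable_enum HD) as (F & DF & H & J & _).
  exists F. split; [exact DF|]. split; [|split; [|exact J]]; intros n Hn; apply (K (F n) (H n Hn)).
Qed.

Lemma IQDI_regular_matrix : has_regular_matrix X T.
Proof.
  destruct IQDI_regular_sequence as (F & DF & H & K & J). exact (atoms_regular_matrix HT DF H K J).
Qed.

Lemma IQDI_cellular : QPKW M -> has_denumerable_cellular_family T.
Proof.
  destruct IQDI_regular_sequence as (F & DF & H & K & J). exact (QPKW_cellular HT DF H K J).
Qed.
End FromIQDI.

(** * The unit interval and Tychonoff cubes *)

Section UnitInterval.
Context {M : set_structure} {ZF : is_ZF_model M}.
Implicit Types a b c f p q s t u x y z m n k : M.
Implicit Types U V W : M.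

Lemma D_fraction : definable (fun v : nat -> M => fraction (v 0)).
Proof. dfn. Qed.
Lemma D_fraction_le : definable (fun v : nat -> M => fraction_le (v 0) (v 1)).
Proof. dfn. Qed.
#[local] Hint Resolve D_fraction D_fraction_le : dfn.
Lemma D_unit_real : definable (fun v : nat -> M => unit_real (v 0)).
Proof. dfn. Qed.
Lemma D_real_lt : definable (fun v : nat -> M => real_lt (v 0) (v 1)).
Proof. dfn. Qed.
Lemma D_is_topology : definable (fun v : nat -> M => is_topology (v 0) (v 1)).
Proof. dfn. Qed.
#[local] Hint Resolve D_unit_real D_real_lt D_is_topology : dfn.

Lemma fractionE p : fraction p <-> exists m n, n ∈ omega /\ m ∈ n /\ p = opair m n.
Proof.
  unfold fraction. split.
  - intros (w & m & n & Hw & Hn & Hm & Hp). apply is_omegaE in Hw. apply is_opairE in Hp.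
    subst. eauto.
  - intros (m & n & Hn & Hm & ->). exists omega, m, n. rewrite is_omegaE, is_opairE. auto.
Qed.

Lemma fraction_leE m n m' n' :
  fraction_le (opair m n) (opair m' n') <-> injects (prod m n') (prod m' n).
Proof.
  rewrite <- injectsP. unfold fraction_le. split.
  - intros (m1 & n1 & m2 & n2 & a & b & f & H1 & H2 & H3 & H4 & H).
    apply is_opairE, opair_inj in H1. apply is_opairE, opair_inj in H2.
    apply is_productE in H3, H4. destruct H1, H2; subst. eauto.
  - intros (f & H). exists m, n, m', n', (prod m n'), (prod m' n), f.
    rewrite !is_opairE, !is_productE. auto.
Qed.

Lemma fraction_le_total p q : fraction p -> fraction q -> fraction_le p q \/ fraction_le q p.
Proof.
  intros Hp Hq. apply fractionE in Hp, Hq.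
  destruct Hp as (m & n & Hn & Hm & ->), Hq as (m' & n' & Hn' & Hm' & ->).
  rewrite !fraction_leE. apply finite_comparable; apply finite_prod; apply finite_omega; trivial;
    first [exact (omega_mem Hn Hm)|exact (omega_mem Hn' Hm')].
Qed.

(* m/n < n/(n+1), because m × (n+1) embeds into n × n with the pair (m, m) left out. *)
Lemma fraction_no_max p : fraction p -> exists q, fraction q /\ ~ fraction_le q p.
Proof.
  intros Hp. apply fractionE in Hp. destruct Hp as (m & n & Hn & Hm & ->).
  exists (opair n (succ n)). split.
  { apply fractionE. exists n, (succ n). split; [apply succ_omega, Hn|]. split; [|reflexivity].
    apply in_succ. auto. }
  rewrite fraction_leE. intros (F & HF & H & I).
  (* [G] moves the pairs with second coordinate [n] to first coordinate [m], which is free since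
     first coordinates are below [m]. The pair [(m, m)] is missed because [i] is never [m]. Composed
     with [F] this contradicts the pigeonhole principle on [prod n n]. *)
  set (G := fun z => the (fun y => exists i j, z = opair i j /\ y = ite (j = n) (opair m i) (opair i j))).
  assert (DG : definable_term (fun v => G (v 0))) by (unfold G; dfn).
  assert (GE : forall i j, G (opair i j) = ite (j = n) (opair m i) (opair i j)).
  { intros i j. apply the_eq; [eauto|]. intros y (i' & j' & Eq & ->).
    apply opair_inj in Eq. destruct Eq; subst; auto. }
  assert (Gn : forall i, G (opair i n) = opair m i) by (intros i; rewrite GE; apply ite_true; reflexivity).
  assert (Gj : forall i j, j ∈ n -> G (opair i j) = opair i j).
  { intros i j Hj. rewrite GE. apply ite_false. intros ->. apply (mem_irrefl Hj). }
  assert (Hmn := omega_subset Hn Hm).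
  assert (GI : injective_on G (prod m (succ n))).
  { intros z z' Hz Hz' E. apply in_prod in Hz, Hz'.
    destruct Hz as (i & j & Hi & Hj & ->), Hz' as (i' & j' & Hi' & Hj' & ->).
    apply in_succ in Hj, Hj'. destruct Hj as [Hj| ->], Hj' as [Hj'| ->];
      rewrite ?Gn, ?Gj in E by assumption; trivial; apply opair_inj in E; destruct E as [E1 E2].
    - subst i. elim (mem_irrefl Hi).
    - subst i'. elim (mem_irrefl Hi').
    - congruence. }
  destruct (finite_pigeonhole (F := fun z => G (F z)) ltac:(dfn) (a := prod n n)) with (y := opair m m)
    as (z & Hz & E).
  - apply finite_prod; apply finite_omega, Hn.
  - intros z Hz. specialize (H z Hz). apply in_prod in H. destruct H as (i & j & Hi & Hj & ->).
    apply in_succ in Hj. destruct Hj as [Hj| ->]; rewrite ?Gn, ?Gj by assumption;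
      apply opair_in_prod; auto.
  - intros z z' Hz Hz' E. apply I; auto.
  - apply opair_in_prod. auto.
  - specialize (H z Hz). apply in_prod in H. destruct H as (i & j & Hi & Hj & Fz).
    rewrite Fz in E. apply in_succ in Hj.
    destruct Hj as [Hj| ->]; rewrite ?Gn, ?Gj in E by assumption; apply opair_inj in E;
      destruct E; subst; apply (mem_irrefl Hi).
Qed.

Definition one : M := sep (prod omega omega) fraction.

Lemma in_one p : p ∈ one <-> fraction p.
Proof.
  unfold one. rewrite in_sep by dfn. split; [tauto|]. intros H. split; [|exact H].
  apply fractionE in H. destruct H as (m & n & Hn & Hm & ->). apply opair_in_prod.
  split; [apply (omega_mem Hn Hm)|exact Hn].
Qed.

Lemma unit_real_zero : unit_real empty.
Proof. split; [|split]; [intros p Hp|intros p q Hp|intros p Hp]; elim (in_empty Hp). Qed.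

Lemma unit_real_one : unit_real one.
Proof.
  split; [|split].
  - intros p Hp. apply in_one, Hp.
  - intros p q _ Hq _. apply in_one, Hq.
  - intros p Hp. apply in_one in Hp. destruct (fraction_no_max Hp) as (q & Hq & N).
    exists q. rewrite in_one. auto.
Qed.

Lemma zero_neq_one : empty <> one.
Proof.
  intros E. assert (K : opair empty (succ empty) ∈ one).
  { apply in_one, fractionE. exists empty, (succ empty).
    split; [apply succ_omega, empty_omega|]. split; [|reflexivity]. apply in_succ. auto. }
  rewrite <- E in K. apply (in_empty K).
Qed.

Lemma unit_real_total a b : unit_real a -> unit_real b -> a ⊆ b \/ b ⊆ a.
Proof.
  intros (Ha1 & Ha2 & _) (Hb1 & Hb2 & _). destruct (classic (a ⊆ b)) as [H|H]; [auto|right].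
  intros q Hq. apply NNPP. intros Nq. apply H. intros p Hp.
  destruct (fraction_le_total (Ha1 p Hp) (Hb1 q Hq)) as [K|K].
  - apply (Hb2 q p Hq (Ha1 p Hp) K).
  - elim Nq. apply (Ha2 p q Hp (Hb1 q Hq) K).
Qed.

(** The intersection of all topologies on [X] containing [S]. Separation from [power X] yields it,
    which is why [S] has to be definable. *)
Lemma generated_topology_exists (X : M) (S : M -> Prop) : definable (fun v => S (v 0)) ->
  (forall U, S U -> U ⊆ X) -> exists T, generated_topology X T S.
Proof.
  intros DS HS.
  set (T := sep (power X) (fun U => forall T', is_topology X T' -> (forall U, S U -> U ∈ T') -> U ∈ T')).
  assert (HT : forall U, U ∈ T <-> U ⊆ X /\ forall T', is_topology X T' -> (forall U, S U -> U ∈ T') -> U ∈ T').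
  { intros U. unfold T. rewrite in_sep, in_power by dfn. tauto. }
  exists T. split; [|split].
  - split; [|split; [|split; [|split]]].
    + intros U HU. apply HT, HU.
    + intros U HU. apply HT. split.
      * intros x Hx. elim (proj1 (HU x) Hx).
      * intros T' HT' _. destruct HT' as (_ & K & _). apply K, HU.
    + apply HT. split; [apply subset_refl|]. intros T' HT' _. apply HT'.
    + intros U V W HU HV HW. apply HT in HU, HV. destruct HU as [HU KU], HV as [HV KV]. apply HT. split.
      * intros x Hx. apply HW in Hx. apply HU, Hx.
      * intros T' HT' K. destruct (HT') as (_ & _ & _ & L & _). apply (L U V W); auto.
    + intros F U HF HU. apply HT. split.
      * intros x Hx. apply HU in Hx. destruct Hx as (V & HV & Hx). apply HF, HT in HV.
        destruct HV as [HV _]. auto.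
      * intros T' HT' K. destruct (HT') as (_ & _ & _ & _ & L). apply (L F U); [|exact HU].
        intros V HV. apply HF, HT in HV. destruct HV as [_ HV]. auto.
  - intros U HU. apply HT. split; [auto|]. intros T' _ K. auto.
  - intros T' HT' K U HU. apply HT in HU. destruct HU as [_ HU]. auto.
Qed.

Lemma unit_interval_exists : exists I TI : M, is_unit_interval I TI.
Proof.
  set (I := sep (power one) unit_real).
  assert (HI : forall x, x ∈ I <-> unit_real x).
  { intros x. unfold I. rewrite in_sep, in_power by dfn. split; [tauto|]. intros H. split; [|exact H].
    intros p Hp. apply in_one. apply H, Hp. }
  destruct (generated_topology_exists (X := I) (S := fun U => exists a, a ∈ I /\
      (U ≐ (fun x => x ∈ I /\ real_lt x a) \/ U ≐ (fun x => x ∈ I /\ real_lt a x)))) as (TI & H).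
  - dfn.
  - intros U (a & Ha & [HU|HU]) x Hx; apply HU in Hx; apply Hx.
  - exists I, TI. split; [exact HI|exact H].
Qed.

Section Interval.
Variables I TI : M.
Hypothesis HI : is_unit_interval I TI.

Lemma in_interval x : x ∈ I <-> unit_real x.
Proof. apply (proj1 HI x). Qed.

Lemma ray_lt a : a ∈ I -> sep I (fun x => real_lt x a) ∈ TI.
Proof.
  intros Ha. apply (proj1 (proj2 (proj2 HI))). exists a. split; [exact Ha|]. left. intros x.
  rewrite in_sep by dfn. reflexivity.
Qed.

Lemma ray_gt a : a ∈ I -> sep I (fun x => real_lt a x) ∈ TI.
Proof.
  intros Ha. apply (proj1 (proj2 (proj2 HI))). exists a. split; [exact Ha|]. right. intros x.
  rewrite in_sep by dfn. reflexivity.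
Qed.

(* If no point lies strictly between [a] and [b], the rays x < b and x > a are already disjoint,
   so density of the order is not used. *)
Lemma interval_hausdorff : hausdorff I TI.
Proof.
  assert (K : forall a b, a ∈ I -> b ∈ I -> real_lt a b -> exists U V, U ∈ TI /\ V ∈ TI /\
    a ∈ U /\ b ∈ V /\ disjoint U V).
  { intros a b Ha Hb L.
    destruct (classic (exists c, c ∈ I /\ real_lt a c /\ real_lt c b)) as [(c & Hc & L1 & L2)|N].
    - exists (sep I (fun x => real_lt x c)), (sep I (fun x => real_lt c x)).
      split; [apply ray_lt, Hc|]. split; [apply ray_gt, Hc|].
      rewrite !in_sep by dfn. split; [auto|]. split; [auto|].
      intros x Hx Hx'. rewrite in_sep in Hx, Hx' by dfn.
      destruct Hx as (_ & S & Ne), Hx' as (_ & S' & _). apply Ne, subset_antisym; assumption.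
    - exists (sep I (fun x => real_lt x b)), (sep I (fun x => real_lt a x)).
      split; [apply ray_lt, Hb|]. split; [apply ray_gt, Ha|].
      rewrite !in_sep by dfn. split; [auto|]. split; [auto|].
      intros x Hx Hx'. rewrite in_sep in Hx, Hx' by dfn. apply N. exists x. tauto. }
  intros a b Ha Hb N.
  destruct (@unit_real_total a b) as [L|L]; try (apply in_interval; assumption).
  - apply K; trivial. split; assumption.
  - destruct (K b a Hb Ha) as (U & V & HU & HV & HbU & HaV & D).
    + split; [exact L|]. intros E. auto.
    + exists V, U. repeat split; trivial. intros x Hx Hx'. apply (D x Hx' Hx).
Qed.

Lemma zero_interval : empty ∈ I.
Proof. apply in_interval, unit_real_zero. Qed.

Lemma one_interval : one ∈ I.
Proof. apply in_interval, unit_real_one. Qed.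

End Interval.

Definition preimage f (X V : M) : M := sep X (fun x => app f x ∈ V).

Lemma in_preimage f X V x : x ∈ preimage f X V <-> x ∈ X /\ app f x ∈ V.
Proof. unfold preimage. rewrite in_sep by dfn. reflexivity. Qed.

Lemma preimage_open f X T TY V : is_family f X -> continuous f X T TY -> V ∈ TY ->
  preimage f X V ∈ T.
Proof.
  intros Hf H HV. apply (H V); [exact HV|]. intros x. rewrite in_preimage. split.
  - intros [Hx K]. split; [exact Hx|]. exists (app f x). split; [apply (family_app Hf Hx)|exact K].
  - intros (Hx & y & K & Hy). apply (mapsP _ _ Hf) in K. destruct K as [_ ->]. auto.
Qed.

(** Complete regularity is applied to [x] and the singleton of [y], closed by T1; disjoint
    neighbourhoods of 0 and 1 are then pulled back. *)
Lemma tychonoff_hausdorff (X T : M) : is_topology X T -> tychonoff X T -> hausdorff X T.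
Proof.
  intros HT (T1 & CR) x y Hx Hy N.
  destruct (CR x (sing y)) as (I & TI & f & HI & Hf & Cf & F0 & F1); [exact Hx| | |].
  - split; [intros z Hz; apply in_sing in Hz; subst; exact Hy|].
    intros U HU. apply (open_local HT). intros z Hz. apply HU in Hz. destruct Hz as [Hz Nz].
    rewrite in_sing in Nz. destruct (T1 z y Hz Hy Nz) as (V & HV & HzV & HyV).
    exists V. split; [exact HV|]. split; [exact HzV|]. intros u Hu. apply HU.
    split; [apply (open_subset HT HV Hu)|]. rewrite in_sing. intros ->. auto.
  - rewrite in_sing. exact N.
  - assert (Ex : app f x = empty) by (apply is_emptyE, F0, (family_app (proj1 Hf) Hx)).
    assert (Ey : app f y = one).
    { assert (K : real_one (app f y)).
      { apply (F1 y); [apply in_sing; reflexivity|]. apply (family_app (proj1 Hf) Hy). }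
      set_ext p. rewrite in_one. apply K. }
    destruct (interval_hausdorff HI (zero_interval HI) (one_interval HI) zero_neq_one)
      as (U & V & HU & HV & H0 & H1 & D).
    exists (preimage f X U), (preimage f X V).
    split; [apply (preimage_open (proj1 Hf) Cf HU)|]. split; [apply (preimage_open (proj1 Hf) Cf HV)|].
    rewrite !in_preimage, Ex, Ey. split; [auto|]. split; [auto|].
    intros z Hz Hz'. apply in_preimage in Hz, Hz'. apply (D (app f z)); tauto.
Qed.

Lemma cube_hausdorff (X C TC : M) : is_tychonoff_cube X C TC -> hausdorff C TC.
Proof.
  intros (I & TI & HI & HC & _ & HS & _) f g Hf Hg N.
  apply HC in Hf, Hg.
  assert (K : exists x, x ∈ X /\ app f x <> app g x).
  { apply NNPP. intros K. apply N. apply (family_ext (proj1 Hf) (proj1 Hg)). intros x Hx.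
    apply NNPP. intros E. apply K. eauto. }
  destruct K as (x & Hx & Ne).
  destruct (interval_hausdorff HI (function_app Hf Hx) (function_app Hg Hx) Ne)
    as (U & V & HU & HV & H0 & H1 & D).
  assert (P : forall W, W ∈ TI -> sep C (fun f => app f x ∈ W) ∈ TC).
  { intros W HW. apply HS. exists x, W. split; [exact Hx|]. split; [exact HW|].
    intros h. rewrite in_sep by dfn. split.
    - intros [Hh K]. split; [exact Hh|]. exists (app h x). split; [|exact K].
      apply HC in Hh. apply (family_app (proj1 Hh) Hx).
    - intros (Hh & y & K & Hy). split; [exact Hh|]. apply HC in Hh.
      apply (mapsP _ _ (proj1 Hh)) in K. destruct K as [_ ->]. exact Hy. }
  exists (sep C (fun f => app f x ∈ U)), (sep C (fun f => app f x ∈ V)).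
  split; [auto|]. split; [auto|]. rewrite !in_sep by dfn. rewrite !(HC _). split; [auto|]. split; [auto|].
  intros h Hh Hh'. rewrite in_sep in Hh, Hh' by dfn. apply (D (app h x)); tauto.
Qed.

Section Subspace.
Variables Y TY X T : M.
Hypotheses (HT : is_topology X T) (HY : is_subspace Y TY X T).

Lemma in_subspace W : W ∈ TY <-> exists U, U ∈ T /\ W = cap U Y.
Proof. rewrite (proj2 HY W). setoid_rewrite is_interE. tauto. Qed.

Lemma subspace_topology : is_topology Y TY.
Proof.
  split; [|split; [|split; [|split]]].
  - intros W HW. apply in_subspace in HW. destruct HW as (U & _ & ->). intros x Hx.
    apply in_cap in Hx. apply Hx.
  - intros W HW. apply is_emptyE in HW. subst. apply in_subspace. exists empty.
    split; [apply (open_empty HT)|]. set_ext x. rewrite in_cap.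
    split; [intros H|intros [H _]]; elim (in_empty H).
  - apply in_subspace. exists X. split; [apply (open_full HT)|]. set_ext x. rewrite in_cap.
    split; [|tauto]. intros Hx. split; [apply (proj1 HY x Hx)|exact Hx].
  - intros U V W HU HV HW. apply is_interE in HW. subst W. apply in_subspace in HU, HV.
    destruct HU as (U' & HU & ->), HV as (V' & HV & ->). apply in_subspace.
    exists (cap U' V'). split; [apply (open_cap HT); assumption|]. set_ext x. rewrite !in_cap. tauto.
  - intros F U HF HU. apply is_unionE in HU. subst U. apply in_subspace.
    (* All open sets with trace in [F] are united, instead of choosing one for each member of
       [F]. *)
    exists (bigcup (sep T (fun U => cap U Y ∈ F))). split.
    + apply (open_bigcup HT). intros U HU. rewrite in_sep in HU by dfn. apply HU.
    + set_ext x. rewrite in_cap, !in_bigcup. split.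
      * intros (W & HW & Hx). assert (K := HF W HW). apply in_subspace in K.
        destruct K as (U & HU & ->). assert (Hx' := Hx). apply in_cap in Hx'. split; [|apply Hx'].
        exists U. rewrite in_sep by dfn. tauto.
      * intros [(U & HU & Hx) HxY]. rewrite in_sep in HU by dfn. exists (cap U Y).
        rewrite in_cap. tauto.
Qed.

Lemma subspace_hausdorff : hausdorff X T -> hausdorff Y TY.
Proof.
  intros H x y Hx Hy N.
  destruct (H x y (proj1 HY x Hx) (proj1 HY y Hy) N) as (U & V & HU & HV & HxU & HyV & D).
  exists (cap U Y), (cap V Y). rewrite !in_subspace, !in_cap. repeat split; eauto.
  intros z Hz Hz'. rewrite in_cap in Hz, Hz'. apply (D z); tauto.
Qed.
End Subspace.

End UnitInterval.
#[export] Hint Resolve D_fraction D_fraction_le D_unit_real D_real_lt D_is_topology : dfn.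

(** * The Cantor cube *)

Section CantorCube.
Context {M : set_structure} {ZF : is_ZF_model M}.
Implicit Types a b c f g h p q r s t x y z m n k i j e : M.
Implicit Types U V W : M.

(** [injects] quantifies over Rocq functions, so unfolding it gives no formula. Its equivalence with
    the existence of an injection in the model does. *)
Lemma D_injects : definable (fun v : nat -> M => injects (v 0) (v 1)).
Proof.
  apply D_ext with (fun v => exists f, is_injection f (v 0) (v 1)); [|dfn].
  intros v. symmetry. apply injectsP.
Qed.
#[local] Hint Resolve D_injects : dfn.

Variable X : M.

(** The endpoints of [0,1], so that [cantor] is literally a subset of the Tychonoff cube. *)
Definition two : M := upair empty one.
Definition cantor : M := sep (power (prod X two)) (fun f => is_function f X two).
Definition cylinder p : M := sep cantor (fun f => p ⊆ f).

Lemma in_cantor f : f ∈ cantor <-> is_function f X two.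
Proof.
  unfold cantor. rewrite in_sep, in_power by dfn. split; [tauto|]. intros H. split; [|exact H].
  intros z Hz. apply (family_in _ (proj1 H)) in Hz. destruct Hz as (x & Hx & ->).
  apply opair_in_prod. split; [exact Hx|apply (function_app H Hx)].
Qed.

Lemma in_cylinder p f : f ∈ cylinder p <-> f ∈ cantor /\ p ⊆ f.
Proof. unfold cylinder. rewrite in_sep by dfn. reflexivity. Qed.

Lemma DT_cylinder : definable_term (fun v => cylinder (v 0)).
Proof. dfn. Qed.
#[local] Hint Resolve DT_cylinder : dfn.

Lemma cantor_app f x : f ∈ cantor -> x ∈ X -> opair x (app f x) ∈ f /\ app f x ∈ two.
Proof.
  intros Hf Hx. apply in_cantor in Hf. split; [|apply (function_app Hf Hx)].
  apply mapsE, (family_app (proj1 Hf) Hx).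
Qed.

Lemma cantor_pair f x i : f ∈ cantor -> opair x i ∈ f -> x ∈ X /\ i = app f x.
Proof. intros Hf H. apply in_cantor in Hf. apply (mapsP _ _ (proj1 Hf)), mapsE, H. Qed.

Lemma cantor_functional f x i j : f ∈ cantor -> opair x i ∈ f -> opair x j ∈ f -> i = j.
Proof.
  intros Hf H K. apply (cantor_pair Hf) in H, K. destruct H, K; congruence.
Qed.

Lemma cantor_subset_prod f : f ∈ cantor -> f ⊆ prod X two.
Proof. intros H. unfold cantor in H. rewrite in_sep, in_power in H by dfn. apply H. Qed.

Lemma cantor_antisym f g : f ∈ cantor -> g ∈ cantor -> f ⊆ g -> f = g.
Proof.
  intros Hf Hg S. assert (Hf' := Hf). assert (Hg' := Hg). apply in_cantor in Hf', Hg'.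
  apply (family_ext (proj1 Hf') (proj1 Hg')). intros x Hx.
  apply (cantor_functional Hg (x := x)); [apply S|]; apply cantor_app; assumption.
Qed.

Lemma lam_cantor (F : M -> M) : definable_term (fun v => F (v 0)) ->
  (forall x, x ∈ X -> F x ∈ two) -> lam X F ∈ cantor.
Proof. intros DF H. apply in_cantor, lam_function; assumption. Qed.

Lemma in_lam (F : M -> M) (DF : definable_term (fun v => F (v 0))) x i :
  opair x i ∈ lam X F <-> x ∈ X /\ i = F x.
Proof. rewrite <- mapsE. apply maps_lam, DF. Qed.

Lemma zero_two : empty ∈ two.
Proof. apply in_upair. auto. Qed.

Lemma one_two : one ∈ two.
Proof. apply in_upair. auto. Qed.

Lemma finite_two : finite two.
Proof.
  apply (finite_subset (finite_adjoin one (finite_sing empty))). intros i Hi.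
  rewrite in_cup, !in_sing. apply in_upair, Hi.
Qed.

Lemma ite_two (P : Prop) a b : a ∈ two -> b ∈ two -> ite P a b ∈ two.
Proof.
  intros Ha Hb. destruct (classic P) as [H|H]; [rewrite ite_true|rewrite ite_false]; assumption.
Qed.

Lemma cantor_infinite : infinite X -> infinite cantor.
Proof.
  intros HX H. apply HX. refine (finite_injects _ H).
  exists (fun x => lam X (fun y => ite (y = x) one empty)). split; [dfn|]. split.
  - intros x Hx. apply lam_cantor; [dfn|]. intros y _. apply ite_two; [apply one_two|apply zero_two].
  - intros x x' Hx Hx' E.
    assert (K : opair x one ∈ lam X (fun y => ite (y = x') one empty)).
    { rewrite <- E, in_lam by dfn. split; [exact Hx|]. symmetry. apply ite_true. reflexivity. }
    rewrite in_lam in K by dfn. destruct K as [_ K]. apply NNPP. intros N.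
    rewrite ite_false in K by exact N. apply zero_neq_one. auto.
Qed.

(** A single coordinate where [g] disagrees with [p] suffices. This makes the complement of a
    cylinder open. *)
Lemma separating_point p g : p ⊆ prod X two -> g ∈ cantor -> ~ p ⊆ g ->
  exists q, finite q /\ q ⊆ g /\ forall h, h ∈ cylinder q -> ~ p ⊆ h.
Proof.
  intros Hp Hg N.
  assert (L : exists z, z ∈ p /\ z ∉ g).
  { apply NNPP. intros L. apply N. intros z Hz. apply NNPP. intros K. eauto. }
  destruct L as (z & Hz & Nz). assert (K := Hp z Hz). apply in_prod in K.
  destruct K as (x & i & Hx & Hi & ->). destruct (cantor_app Hg Hx) as [K _].
  exists (sing (opair x (app g x))). split; [apply finite_sing|]. split.
  - intros y Hy. apply in_sing in Hy. subst. exact K.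
  - intros h Hh S. apply in_cylinder in Hh. destruct Hh as [Hh Kh]. apply Nz.
    replace i with (app g x); [exact K|]. apply (cantor_functional Hh (x := x)).
    + apply Kh, in_sing. reflexivity.
    + apply S, Hz.
Qed.

Section Cube.
Variables I TI C TC : M.
Hypothesis HI : is_unit_interval I TI.
Hypothesis HC : C ≐ fun f => is_function f X I.
Hypothesis HTC : generated_topology C TC (fun U => exists x V, x ∈ X /\ V ∈ TI /\
      U ≐ fun f => f ∈ C /\ exists y, maps f x y /\ y ∈ V).

Lemma two_interval : two ⊆ I.
Proof.
  intros i Hi. apply in_upair in Hi. destruct Hi as [->| ->]; [apply (zero_interval HI)|apply (one_interval HI)].
Qed.

Lemma cantor_cube : cantor ⊆ C.
Proof.
  intros f Hf. apply HC. apply in_cantor in Hf. split; [apply Hf|].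
  intros x y H. apply two_interval. apply (proj2 Hf x y H).
Qed.

Lemma cube_open_cylinders U f : U ∈ TC -> f ∈ U -> f ∈ cantor ->
  exists p, finite p /\ p ⊆ f /\ cylinder p ⊆ U.
Proof.
  (* The sets with the desired property form a topology containing the subbase, so minimality of
     [TC] gives [TC ⊆ T0] without any analysis of finite intersections of subbasic sets. *)
  set (T0 := sep (power C) (fun U => forall f, f ∈ U -> f ∈ cantor ->
    exists p, finite p /\ p ⊆ f /\ cylinder p ⊆ U)).
  assert (HT0 : forall U, U ∈ T0 <-> U ⊆ C /\ forall f, f ∈ U -> f ∈ cantor ->
    exists p, finite p /\ p ⊆ f /\ cylinder p ⊆ U).
  { intros V. unfold T0. rewrite in_sep, in_power by dfn. reflexivity. }
  intros HU. revert f. apply HT0. revert U HU. apply HTC.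
  - split; [|split; [|split; [|split]]].
    + intros U HU. apply HT0, HU.
    + intros U HU. apply is_emptyE in HU. subst. apply HT0.
      split; intros f Hf; elim (in_empty Hf).
    + apply HT0. split; [apply subset_refl|]. intros f Hf Hf'. exists empty.
      split; [apply finite_empty|]. split; [intros x Hx; elim (in_empty Hx)|].
      intros g Hg. apply in_cylinder in Hg. apply cantor_cube, Hg.
    + intros U V W HU HV HW. apply is_interE in HW. subst W. apply HT0 in HU, HV. apply HT0.
      destruct HU as [HU KU], HV as [HV KV]. split.
      * intros f Hf. apply in_cap in Hf. apply HU, Hf.
      * intros f Hf Hf'. apply in_cap in Hf. destruct Hf as [Hf1 Hf2].
        destruct (KU f Hf1 Hf') as (p & Fp & Hp & Sp), (KV f Hf2 Hf') as (q & Fq & Hq & Sq).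
        exists (cup p q). split; [apply finite_cup; assumption|]. split.
        -- intros z Hz. apply in_cup in Hz. destruct Hz; auto.
        -- intros g Hg. apply in_cylinder in Hg. destruct Hg as [Hg K].
           apply in_cap. split; [apply Sp|apply Sq]; apply in_cylinder; split; trivial;
             intros z Hz; apply K, in_cup; auto.
    + intros F U HF HU. apply is_unionE in HU. subst U. apply HT0. split.
      * intros f Hf. apply in_bigcup in Hf. destruct Hf as (V & HV & Hf).
        apply HF, HT0 in HV. destruct HV as [HV _]. auto.
      * intros f Hf Hf'. apply in_bigcup in Hf. destruct Hf as (V & HV & Hf).
        assert (K := HF V HV). apply HT0 in K. destruct K as [_ K].
        destruct (K f Hf Hf') as (p & Fp & Hp & Sp). exists p. split; [exact Fp|]. split; [exact Hp|].
        intros g Hg. apply in_bigcup. eauto.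
  - intros U (x & V & Hx & HV & HU). apply HT0. split.
    + intros f Hf. apply HU in Hf. apply Hf.
    + intros f Hf Hf'. destruct (cantor_app Hf' Hx) as [K _].
      exists (sing (opair x (app f x))). split; [apply finite_sing|]. split.
      * intros z Hz. apply in_sing in Hz. subst. exact K.
      * intros g Hg. apply in_cylinder in Hg. destruct Hg as [Hg S]. apply HU.
        split; [apply cantor_cube, Hg|]. exists (app f x).
        split; [apply mapsE, S, in_sing; reflexivity|].
        apply HU in Hf. destruct Hf as (_ & y & Hy & HyV). apply mapsE in Hy.
        rewrite <- (cantor_functional Hf' Hy K). exact HyV.
Qed.

Lemma two_separated i : i ∈ two -> exists V, V ∈ TI /\ forall j, j ∈ two -> (j ∈ V <-> j = i).
Proof.
  destruct (interval_hausdorff HI (zero_interval HI) (one_interval HI) zero_neq_one)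
    as (V0 & V1 & H0 & H1 & K0 & K1 & D).
  intros Hi. apply in_upair in Hi. destruct Hi as [->| ->].
  - exists V0. split; [exact H0|]. intros j Hj. apply in_upair in Hj. split; [|intros ->; exact K0].
    intros Hj'. destruct Hj as [->| ->]; [reflexivity|]. elim (D one Hj' K1).
  - exists V1. split; [exact H1|]. intros j Hj. apply in_upair in Hj. split; [|intros ->; exact K1].
    intros Hj'. destruct Hj as [->| ->]; [|reflexivity]. elim (D empty K0 Hj').
Qed.

Lemma cylinder_cube_open p : finite p -> exists U, U ∈ TC /\ cylinder p = cap U cantor.
Proof.
  assert (HT : is_topology C TC) by apply HTC.
  revert p. apply (finite_ind (P := fun p => exists U, U ∈ TC /\ cylinder p = cap U cantor)); [dfn| |].
  - exists C. split; [apply (open_full HT)|]. set_ext f. rewrite in_cylinder, in_cap. split.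
    + intros [Hf _]. split; [apply cantor_cube, Hf|exact Hf].
    + intros [_ Hf]. split; [exact Hf|]. intros z Hz. elim (in_empty Hz).
  - intros p z _ _ (U & HU & EU).
    assert (E : cylinder (cup p (sing z)) = cap (cylinder p) (cylinder (sing z))).
    { set_ext f. rewrite in_cap, !in_cylinder. split.
      - intros [Hf K]. split; (split; [exact Hf|]); intros y Hy; apply K, in_cup; auto.
      - intros [[Hf K1] [_ K2]]. split; [exact Hf|]. intros y Hy. apply in_cup in Hy.
        destruct Hy; auto. }
    destruct (classic (z ∈ prod X two)) as [Hz|Hz].
    + apply in_prod in Hz. destruct Hz as (x & i & Hx & Hi & ->).
      destruct (two_separated Hi) as (V & HV & KV).
      exists (cap U (sep C (fun f => app f x ∈ V))). split.
      * apply (open_cap HT HU). apply (proj1 (proj2 HTC)). exists x, V.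
        split; [exact Hx|]. split; [exact HV|]. intros f. rewrite in_sep by dfn.
        split; intros [Hf K]; (split; [exact Hf|]); apply HC in Hf.
        -- exists (app f x). split; [apply (family_app (proj1 Hf) Hx)|exact K].
        -- destruct K as (y & Hy & HyV). apply (mapsP _ _ (proj1 Hf)) in Hy.
           destruct Hy as [_ ->]. exact HyV.
      * rewrite E, EU. set_ext f. rewrite !in_cap, in_cylinder, in_sep by dfn.
        assert (L : f ∈ cantor -> (sing (opair x i) ⊆ f <-> app f x ∈ V)).
        { intros Hf. destruct (cantor_app Hf Hx) as [K1 K2]. rewrite (KV _ K2). split.
          - intros S. apply (cantor_functional Hf K1). apply S, in_sing. reflexivity.
          - intros <- y Hy. apply in_sing in Hy. subst. exact K1. }
        assert (L' := @cantor_cube f). tauto.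
    (* A pair outside [prod X two] belongs to no member of [cantor], so the cylinder is empty. *)
    + exists empty. split; [apply (open_empty HT)|]. rewrite E. set_ext f.
      rewrite !in_cap, !in_cylinder. split; [|intros [K _]; elim (in_empty K)].
      intros [_ [Hf S]]. elim Hz. apply (cantor_subset_prod Hf), S, in_sing. reflexivity.
Qed.

(** The right-hand side no longer mentions [0,1]; it becomes the hypothesis [openP] under which the
    space is studied below. *)
Lemma cube_subspace_open TY : is_subspace cantor TY C TC -> forall W,
  W ∈ TY <-> W ⊆ cantor /\ forall f, f ∈ W -> exists p, finite p /\ p ⊆ f /\ cylinder p ⊆ W.
Proof.
  intros HY W. assert (HT : is_topology C TC) by apply HTC.
  assert (HTY := subspace_topology HT HY). split.
  - intros HW. split; [apply (open_subset HTY HW)|]. intros f Hf.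
    apply (in_subspace HY) in HW. destruct HW as (U & HU & ->). apply in_cap in Hf.
    destruct Hf as [Hf Hf']. destruct (cube_open_cylinders HU Hf Hf') as (p & Fp & Hp & S).
    exists p. split; [exact Fp|]. split; [exact Hp|]. intros g Hg. apply in_cap. split; [auto|].
    apply in_cylinder in Hg. apply Hg.
  - intros [S H]. apply (open_local HTY). intros f Hf. destruct (H f Hf) as (p & Fp & Hp & K).
    exists (cylinder p). split; [|split; [apply in_cylinder; auto|exact K]].
    apply (in_subspace HY). apply cylinder_cube_open, Fp.
Qed.

End Cube.

(** * Separation properties of the Cantor cube *)

Section Space.
Variable TY : M.
Hypothesis openP : forall W,
  W ∈ TY <-> W ⊆ cantor /\ forall f, f ∈ W -> exists p, finite p /\ p ⊆ f /\ cylinder p ⊆ W.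
Hypothesis HT : is_topology cantor TY.

Lemma cylinder_open p : finite p -> cylinder p ∈ TY.
Proof.
  intros Fp. apply openP. split; [intros f Hf; apply in_cylinder in Hf; apply Hf|].
  intros f Hf. exists p. split; [exact Fp|]. split; [apply in_cylinder in Hf; apply Hf|apply subset_refl].
Qed.

Lemma cylinder_complement_open p : p ⊆ prod X two -> sep cantor (fun f => ~ p ⊆ f) ∈ TY.
Proof.
  intros Hp. apply openP. split; [intros f Hf; rewrite in_sep in Hf by dfn; apply Hf|].
  intros f Hf. rewrite in_sep in Hf by dfn. destruct Hf as [Hf N].
  destruct (separating_point Hp Hf N) as (q & Fq & Hq & K). exists q.
  split; [exact Fq|]. split; [exact Hq|]. intros h Hh. rewrite in_sep by dfn.
  split; [apply in_cylinder in Hh; apply Hh|auto].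
Qed.

Lemma cantor_hausdorff : hausdorff cantor TY.
Proof.
  intros f g Hf Hg N.
  assert (L : exists z, z ∈ f /\ z ∉ g).
  { apply NNPP. intros L. apply N, (cantor_antisym Hf Hg). intros z Hz. apply NNPP. eauto. }
  destruct L as (z & Hz & Nz). exists (cylinder (sing z)), (sep cantor (fun h => ~ sing z ⊆ h)).
  split; [apply cylinder_open, finite_sing|]. split.
  { apply cylinder_complement_open. intros y Hy. apply in_sing in Hy. subst.
    apply (cantor_subset_prod Hf Hz). }
  rewrite in_cylinder, in_sep by dfn. split; [|split].
  - split; [exact Hf|]. intros y Hy. apply in_sing in Hy. subst. exact Hz.
  - split; [exact Hg|]. intros S. apply Nz, S, in_sing. reflexivity.
  - intros h Hh Hh'. rewrite in_cylinder in Hh. rewrite in_sep in Hh' by dfn. tauto.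
Qed.

Lemma cylinder_clopen p : finite p -> p ⊆ prod X two -> clopen cantor TY (cylinder p).
Proof.
  intros Fp Hp. split; [apply cylinder_open, Fp|]. split.
  - intros f Hf. apply in_cylinder in Hf. apply Hf.
  - intros U HU. replace U with (sep cantor (fun f => ~ p ⊆ f)).
    + apply cylinder_complement_open, Hp.
    + set_ext f. rewrite (HU f), in_sep, in_cylinder by dfn. tauto.
Qed.

Lemma cantor_zero_dimensional : zero_dimensional cantor TY.
Proof.
  exists (sep TY (fun U => clopen cantor TY U)). split; [split|].
  - intros U HU. rewrite in_sep in HU by dfn. apply (proj1 HU).
  - intros U HU f. split; [|intros (V & _ & S & Hf); auto].
    intros Hf. assert (K := HU). apply openP in K. destruct K as [S K].
    destruct (K f Hf) as (p & Fp & Hp & Sp). exists (cylinder p).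
    rewrite in_sep by dfn. split; [split; [apply cylinder_open, Fp|]|].
    + apply (cylinder_clopen Fp). apply (subset_trans Hp), cantor_subset_prod. auto.
    + split; [exact Sp|]. apply in_cylinder. auto.
  - intros U HU. rewrite in_sep in HU by dfn. apply (proj2 HU).
Qed.

Lemma cantor_tychonoff (I TI : M) : is_unit_interval I TI -> tychonoff cantor TY.
Proof.
  intros HI. split.
  - intros f g Hf Hg N. destruct (cantor_hausdorff Hf Hg N) as (U & V & HU & HV & HfU & HgV & D).
    exists U. split; [exact HU|]. split; [exact HfU|]. intros K. apply (D g K HgV).
  - intros f F Hf [HF HF'] N.
    assert (K := HF' (diff cantor F) (proj2 (is_diffE _ _ _) eq_refl)). apply openP in K.
    destruct K as [_ K]. destruct (K f) as (p & Fp & Hp & Sp); [apply in_diff; auto|].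
    assert (Pp : p ⊆ prod X two) by (apply (subset_trans Hp), cantor_subset_prod, Hf).
    (* The cylinder of [p] contains [f], misses [F] and is clopen, so the function that is 0 on it
       and 1 off it is locally constant. *)
    set (H := fun g => ite (p ⊆ g) empty one).
    assert (DH : definable_term (fun v => H (v 0))) by (unfold H; dfn).
    assert (H0 : forall g, p ⊆ g -> H g = empty) by (intros g Hg; apply ite_true, Hg).
    assert (H1 : forall g, ~ p ⊆ g -> H g = one) by (intros g Hg; apply ite_false, Hg).
    exists I, TI, (lam cantor H). split; [exact HI|]. split; [|split; [|split]].
    + apply (lam_function DH). intros g _. apply (two_interval HI).
      apply ite_two; [apply zero_two|apply one_two].
    + intros V U HV HU. apply openP. split; [intros g Hg; apply HU in Hg; apply Hg|].
      intros g Hg. apply HU in Hg. destruct Hg as (Hg & y & Hy & HyV).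
      rewrite maps_lam in Hy by exact DH. destruct Hy as [_ ->].
      assert (L : exists q, finite q /\ q ⊆ g /\ forall h, h ∈ cylinder q -> H h = H g).
      { destruct (classic (p ⊆ g)) as [S|S].
        - exists p. split; [exact Fp|]. split; [exact S|]. intros h Hh.
          apply in_cylinder in Hh. rewrite !H0; [reflexivity|exact S|apply Hh].
        - destruct (separating_point Pp Hg S) as (q & Fq & Hq & Sq). exists q.
          split; [exact Fq|]. split; [exact Hq|]. intros h Hh.
          rewrite !H1; [reflexivity|exact S|apply (Sq h Hh)]. }
      destruct L as (q & Fq & Hq & Eq). exists q. split; [exact Fq|]. split; [exact Hq|].
      intros h Hh. apply HU. assert (Hh' := Hh). apply in_cylinder in Hh'.
      split; [apply Hh'|]. exists (H g). split; [|exact HyV]. rewrite maps_lam by exact DH.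
      split; [apply Hh'|]. symmetry. apply Eq, Hh.
    + intros y Hy. rewrite maps_lam in Hy by exact DH. destruct Hy as [_ ->].
      rewrite H0 by exact Hp. apply is_emptyE. reflexivity.
    + intros g y Hg Hy. rewrite maps_lam in Hy by exact DH. destruct Hy as [_ ->].
      rewrite H1; [intros z; apply in_one|]. intros S.
      assert (L : g ∈ diff cantor F) by (apply Sp, in_cylinder; auto).
      apply in_diff in L. tauto.
Qed.

(** * Minimal conditions of regular open sets *)

Definition condition p : Prop := finite p /\ exists f, f ∈ cantor /\ p ⊆ f.

(** Conditions are the finite partial functions from [X] to [two]. Minimality is with respect to
    inclusion, so [U] may have minimal conditions of different sizes. *)
Definition minimal U p : Prop :=
  condition p /\ cylinder p ⊆ U /\ forall r, r ⊆ p -> cylinder r ⊆ U -> r = p.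

(* The minimal [p] extending [r] with at most [n] points outside [r]. *)
Definition minimals U n r : M :=
  sep (power (prod X two)) (fun p => minimal U p /\ r ⊆ p /\ injects (diff p r) n).

Lemma D_minimal : definable (fun v => minimal (v 0) (v 1)).
Proof. dfn. Qed.
#[local] Hint Resolve D_minimal : dfn.

Lemma in_minimals U n r p :
  p ∈ minimals U n r <-> minimal U p /\ r ⊆ p /\ injects (diff p r) n.
Proof.
  unfold minimals. rewrite in_sep, in_power by dfn. split; [tauto|]. intros H. split; [|exact H].
  destruct H as (((_ & f & Hf & S) & _) & _). apply (subset_trans S), cantor_subset_prod, Hf.
Qed.

(** A finite set has a minimal subset whose cylinder stays inside [U]. Hence an open set is the
    union of the cylinders of its minimal conditions and is determined by them. *)
Lemma minimal_below U f : U ∈ TY -> f ∈ U -> exists p, minimal U p /\ p ⊆ f.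
Proof.
  intros HU Hf. apply openP in HU. destruct HU as [S K].
  destruct (K f Hf) as (p & Fp & Hp & Sp).
  destruct (finite_minimal Fp (k := sep (power p) (fun r => cylinder r ⊆ U))) as (t & Ht & Htp & Hm).
  - exists p. rewrite in_sep, in_power by dfn. auto.
  - rewrite in_sep, in_power in Ht by dfn. destruct Ht as [_ Ht].
    exists t. split; [|apply (subset_trans Htp Hp)]. split; [|split].
    + split; [apply (finite_subset Fp Htp)|]. exists f. split; [auto|apply (subset_trans Htp Hp)].
    + exact Ht.
    + intros r Hr Hr'. apply Hm; [|exact Hr]. rewrite in_sep, in_power by dfn.
      split; [apply (subset_trans Hr Htp)|exact Hr'].
Qed.

(** Removing [e] frees the value [F e], to which the element with value [n], if there is one, is
    redirected. *)
Lemma injects_remove a n e : injects a (succ n) -> e ∈ a -> injects (diff a (sing e)) n.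
Proof.
  intros (F & DF & H & I) He. exists (fun z => ite (F z = n) (F e) (F z)). split; [dfn|].
  assert (N : forall z, z ∈ diff a (sing e) -> z ∈ a /\ F z <> F e).
  { intros z Hz. rewrite in_diff, in_sing in Hz. destruct Hz as [Hz Ne].
    split; [exact Hz|]. intros E. apply Ne, I; auto. }
  split.
  - intros z Hz. destruct (N z Hz) as [Hza Ne]. destruct (classic (F z = n)) as [E|E].
    + rewrite ite_true by exact E. assert (K := H e He). apply in_succ in K. destruct K; [auto|congruence].
    + rewrite ite_false by exact E. assert (K := H z Hza). apply in_succ in K. tauto.
  - intros z z' Hz Hz' E. destruct (N z Hz) as [Hza Ne], (N z' Hz') as [Hza' Ne'].
    destruct (classic (F z = n)) as [E1|E1], (classic (F z' = n)) as [E2|E2];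
      rewrite ?(ite_true _ _ E1), ?(ite_true _ _ E2), ?(ite_false _ _ E1), ?(ite_false _ _ E2) in E;
      try (elim Ne; congruence); try (elim Ne'; congruence); apply I; congruence.
Qed.

Definition conflict z e : Prop := exists x i j, z = opair x i /\ e = opair x j /\ i <> j.

(** The common extension follows [f] on the domain of [p] and [g] elsewhere. *)
Lemma conditions_amalgamate p q f g : f ∈ cantor -> p ⊆ f -> g ∈ cantor -> q ⊆ g ->
  (forall e z, e ∈ p -> z ∈ q -> ~ conflict z e) -> exists h, h ∈ cantor /\ p ⊆ h /\ q ⊆ h.
Proof.
  intros Hf Hp Hg Hq N.
  set (F := fun x => ite (exists i, opair x i ∈ p) (app f x) (app g x)).
  assert (DF : definable_term (fun v => F (v 0))) by (unfold F; dfn).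
  exists (lam X F). split; [|split].
  - apply (lam_cantor DF). intros x Hx. apply ite_two; apply cantor_app; assumption.
  - intros z Hz. assert (K := cantor_subset_prod Hf (Hp z Hz)). apply in_prod in K.
    destruct K as (x & i & Hx & _ & ->). rewrite in_lam by exact DF. split; [exact Hx|].
    unfold F. rewrite ite_true by eauto. apply (cantor_pair Hf (Hp _ Hz)).
  - intros z Hz. assert (K := cantor_subset_prod Hg (Hq z Hz)). apply in_prod in K.
    destruct K as (x & i & Hx & _ & ->). rewrite in_lam by exact DF. split; [exact Hx|].
    unfold F. destruct (classic (exists j, opair x j ∈ p)) as [L|L].
    + rewrite ite_true by exact L. destruct L as (j & Hj).
      destruct (cantor_pair Hf (Hp _ Hj)) as [_ <-]. apply NNPP. intros Ne.
      apply (N _ _ Hj Hz). exists x, i, j. auto.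
    + rewrite ite_false by exact L. apply (cantor_pair Hg (Hq _ Hz)).
Qed.

(* If [r] alone does not force membership in [U], some [q] extending [r] forces the contrary, and
   every minimal [p] extending [r] conflicts with [q] at one of the finitely many points of [q];
   adding the conflicting pair to [r] decreases the size of the part of [p] outside [r]. *)
Lemma minimals_finite U : regular TY U -> forall n, n ∈ omega -> forall r, finite (minimals U n r).
Proof.
  intros HU. apply (omega_ind (P := fun n => forall r, finite (minimals U n r))); [dfn| |].
  - intros r. apply (finite_subset (finite_sing r)). intros p Hp. apply in_minimals in Hp.
    destruct Hp as (_ & S & (F & _ & H & _)). apply in_sing, subset_antisym; [|exact S].
    intros z Hz. apply NNPP. intros N. apply (@in_empty M _ (F z)), H, in_diff. auto.
  - intros n Hn IH r.
    destruct (empty_or_nonempty (minimals U (succ n) r)) as [->|[p0 Hp0]]; [apply finite_empty|].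
    apply in_minimals in Hp0. destruct Hp0 as (((Fp0 & f0 & Hf0 & S0) & _) & Sr0 & _).
    assert (Fr : finite r) by apply (finite_subset Fp0 Sr0).
    (* If [r] already suffices, a minimal [p] containing [r] must equal [r]. *)
    destruct (classic (cylinder r ⊆ U)) as [Hr|Hr].
    { apply (finite_subset (finite_sing r)). intros p Hp. apply in_minimals in Hp.
      destruct Hp as ((_ & _ & Hm) & S & _). apply in_sing. symmetry. apply Hm; assumption. }
    (* By regularity [U] is not dense in [cylinder r], so some nonempty open subset of that cylinder
       misses [U]; a condition for a point of this subset, joined with [r], serves as [q]. *)
    assert (L : exists q g, finite q /\ r ⊆ q /\ g ∈ cantor /\ q ⊆ g /\ ~ meets (cylinder q) U).
    { apply NNPP. intros L. apply Hr, HU; [apply cylinder_open, Fr|].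
      intros W HW HWr (g & Hg). apply NNPP. intros N. apply L.
      assert (K := HW). apply openP in K. destruct K as [SW K]. destruct (K g Hg) as (q & Fq & Hq & Sq).
      exists (cup q r), g. split; [apply finite_cup; assumption|].
      split; [intros z Hz; apply in_cup; auto|]. split; [auto|].
      assert (Hgr := HWr g Hg). apply in_cylinder in Hgr. split.
      - intros z Hz. apply in_cup in Hz. destruct Hz as [Hz|Hz]; [auto|apply Hgr, Hz].
      - intros (h & Hh & HhU). apply N. exists h. split; [|exact HhU]. apply Sq.
        apply in_cylinder in Hh. apply in_cylinder. split; [apply Hh|].
        intros z Hz. apply Hh, in_cup. auto. }
    destruct L as (q & g & Fq & Srq & Hg & Sqg & Nq).
    set (R := fun z => sep (minimals U (succ n) r) (fun p => exists e, e ∈ p /\ e ∉ r /\ conflict z e)).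
    assert (DR : definable_term (fun v => R (v 0))) by (unfold R; dfn).
    apply finite_subset with (bigcup (img q R)).
    + apply finite_bigcup; [apply (finite_img DR Fq)|].
      intros s Hs. rewrite in_img in Hs by exact DR. destruct Hs as (z & Hz & ->).
      destruct (empty_or_nonempty (R z)) as [->|[p Hp]]; [apply finite_empty|].
      unfold R in Hp. rewrite in_sep in Hp by dfn. destruct Hp as (Hp & e & He & _ & Hze).
      apply in_minimals in Hp. destruct Hp as (((_ & f1 & Hf1 & Spf1) & _) & _).
      apply (finite_subset (IH (cup r (sing e)))). rename p into p1.
      intros p Hp. unfold R in Hp. rewrite in_sep in Hp by dfn.
      destruct Hp as (Hp & e' & He' & Ner & Hze').
      apply in_minimals in Hp. destruct Hp as (Hm & Srp & Inj).
      (* There are only two values, so [z] determines the pair that conflicts with it. All members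
         of [R z] therefore contain the same [e], and one instance of the induction hypothesis
         covers them. *)
      assert (Ee : e' = e).
      { destruct Hm as ((_ & f & Hf & Spf) & _).
        destruct Hze as (x & i & j & -> & -> & Nij), Hze' as (x' & i' & j' & E & -> & Nij').
        apply opair_inj in E. destruct E as [<- <-]. f_equal.
        assert (Ti := cantor_subset_prod Hg (Sqg _ Hz)). apply opair_in_prod in Ti.
        assert (Tj' := cantor_subset_prod Hf (Spf _ He')). apply opair_in_prod in Tj'.
        assert (Tj := cantor_subset_prod Hf1 (Spf1 _ He)). apply opair_in_prod in Tj.
        destruct Ti as [_ Ti], Tj as [_ Tj], Tj' as [_ Tj'].
        apply in_upair in Ti, Tj, Tj'.
        destruct Ti, Tj, Tj'; congruence. }
      subst e'. apply in_minimals. split; [exact Hm|]. split.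
      * intros y Hy. rewrite in_cup, in_sing in Hy. destruct Hy as [Hy| ->]; auto.
      * apply injects_trans with (diff (diff p r) (sing e)).
        -- apply subset_injects. intros y Hy. rewrite !in_diff, in_cup in *. tauto.
        -- apply injects_remove; [exact Inj|]. apply in_diff. auto.
    + intros p Hp. assert (Hp' := Hp). apply in_minimals in Hp'.
      destruct Hp' as (((_ & f & Hf & Spf) & SpU & _) & Srp & _).
      (* A common extension of [p] and [q] would lie in [U] by the choice of [p] and outside [U] by
         that of [q]. *)
      assert (L : exists e z, e ∈ p /\ z ∈ q /\ conflict z e).
      { apply NNPP. intros L.
        destruct (conditions_amalgamate Hf Spf Hg Sqg) as (h & Hh & Hph & Hqh).
        - intros e z He Hz K. eauto 6.
        - apply Nq. exists h. split; [apply in_cylinder; auto|]. apply SpU, in_cylinder. auto. }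
      destruct L as (e & z & He & Hz & K). apply in_bigcup. exists (R z).
      rewrite in_img by exact DR. split; [eauto|]. unfold R. rewrite in_sep by dfn.
      split; [exact Hp|]. exists e. split; [exact He|]. split; [|exact K].
      intros Her. destruct K as (x & i & j & -> & -> & Nij). apply Nij.
      apply (cantor_functional Hg (x := x)); [apply Sqg, Hz|apply Sqg, Srq, Her].
Qed.

Lemma minimals_mono U m n r : m ⊆ n -> minimals U m r ⊆ minimals U n r.
Proof.
  intros H p Hp. apply in_minimals in Hp. apply in_minimals. destruct Hp as (H1 & H2 & H3).
  split; [exact H1|]. split; [exact H2|]. apply (injects_trans H3), subset_injects, H.
Qed.

(** * Finite supports of a sequence of finite sets of regular open sets *)

Section Sequence.
Variable c : M -> M.
Hypothesis Dc : definable_term (fun v => c (v 0)).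
Hypothesis c_inj : injective_on c omega.
Hypothesis c_finite : forall n, n ∈ omega -> finite (c n).
Hypothesis c_regular : forall n U, n ∈ omega -> U ∈ c n -> regular TY U.

(* The coordinates of the minimal conditions of size at most [n] for members of the first [n]
   terms; bounding both by the same [n] makes each support finite and the sequence exhaustive. *)
Definition support n : M := sep X (fun x => exists k U p i,
  k ∈ succ n /\ U ∈ c k /\ p ∈ minimals U n empty /\ opair x i ∈ p).

Lemma DT_minimals : definable_term (fun v => minimals (v 0) (v 1) empty).
Proof. dfn. Qed.
#[local] Hint Resolve DT_minimals : dfn.

Lemma DT_support : definable_term (fun v => support (v 0)).
Proof. dfn. Qed.
#[local] Hint Resolve DT_support : dfn.

Lemma in_support n k U p x i : k ∈ succ n -> U ∈ c k -> p ∈ minimals U n empty -> opair x i ∈ p ->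
  x ∈ support n.
Proof.
  intros Hk HU Hp Hx. unfold support. rewrite in_sep by dfn. split; [|exists k, U, p, i; auto].
  apply in_minimals in Hp. destruct Hp as (((_ & f & Hf & S) & _) & _).
  apply (cantor_pair Hf (S _ Hx)).
Qed.

Lemma support_finite n : n ∈ omega -> finite (support n).
Proof.
  intros Hn.
  set (fst := fun z => the (fun x => exists i, z = opair x i)).
  assert (Df : definable_term (fun v => fst (v 0))) by (unfold fst; dfn).
  apply finite_subset with
    (img (bigcup (bigcup (img (bigcup (img (succ n) c)) (fun U => minimals U n empty)))) fst).
  - apply (finite_img Df). apply finite_bigcup.
    + apply finite_bigcup.
      * apply finite_img; [dfn|]. apply finite_bigcup.
        -- apply (finite_img Dc), finite_omega, succ_omega, Hn.
        -- intros s Hs. rewrite in_img in Hs by exact Dc. destruct Hs as (k & Hk & ->).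
           apply c_finite, (omega_mem (succ_omega Hn) Hk).
      * intros s Hs. rewrite in_img in Hs by dfn. destruct Hs as (U & HU & ->).
        apply in_bigcup in HU. destruct HU as (a & Ha & HU). rewrite in_img in Ha by exact Dc.
        destruct Ha as (k & Hk & ->). apply (minimals_finite (c_regular (omega_mem (succ_omega Hn) Hk) HU) Hn).
    + intros p Hp. apply in_bigcup in Hp. destruct Hp as (s & Hs & Hp).
      rewrite in_img in Hs by dfn. destruct Hs as (U & _ & ->). apply in_minimals in Hp. apply Hp.
  - intros x Hx. unfold support in Hx. rewrite in_sep in Hx by dfn.
    destruct Hx as (_ & k & U & p & i & Hk & HU & Hp & Hx).
    rewrite in_img by exact Df. exists (opair x i). split.
    + apply in_bigcup. exists p. split; [|exact Hx]. apply in_bigcup. exists (minimals U n empty).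
      split; [|exact Hp]. rewrite in_img by dfn. exists U. split; [|reflexivity].
      apply in_bigcup. exists (c k). split; [|exact HU]. rewrite in_img by exact Dc. eauto.
    + symmetry. apply the_eq; [eauto|]. intros y (j & E). apply opair_inj in E. destruct E; auto.
Qed.

(** With finitely many supports, all minimal conditions of all members of the terms [c n] would be
    subsets of one finite set [P]. Those members would be finitely many, as each is determined by
    its minimal conditions, and an injective sequence of sets of them could not exist. *)
Lemma supports_infinite : infinite (img omega support).
Proof.
  intros H.
  assert (FS : finite (bigcup (img omega support))).
  { apply (finite_bigcup H). intros s Hs. rewrite in_img in Hs by dfn. destruct Hs as (n & Hn & ->).
    apply support_finite, Hn. }
  set (P := prod (bigcup (img omega support)) two).
  assert (FP : finite P) by (apply finite_prod; [exact FS|apply finite_two]).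
  assert (FR : finite (bigcup (img omega c))).
  { apply finite_injective with (F := fun U => sep (power P) (fun p => minimal U p)); [dfn| |].
    - assert (K : forall U V, U ∈ bigcup (img omega c) -> V ∈ bigcup (img omega c) ->
        sep (power P) (fun p => minimal U p) = sep (power P) (fun p => minimal V p) -> U ⊆ V).
      { intros U V HU HV E f Hf. apply in_bigcup in HU. destruct HU as (s & Hs & HU).
        rewrite in_img in Hs by exact Dc. destruct Hs as (k & Hk & ->).
        destruct (minimal_below (proj1 (c_regular Hk HU)) Hf) as (p & Hp & Hpf).
        assert (Fp := Hp). destruct Fp as ((Fp & f' & Hf' & Spf') & _). apply finiteE in Fp.
        destruct Fp as (m & Hm & Em).
        (* The support containing the coordinates of [p] is taken at the larger of the index [k] of
           its term and the size [m] of [p]. *)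
        assert (L : exists n, n ∈ omega /\ k ∈ succ n /\ m ⊆ n).
        { destruct (omega_total Hk Hm) as [L|[->|L]].
          - exists m. rewrite in_succ. auto.
          - exists m. rewrite in_succ. auto.
          - exists k. rewrite in_succ. split; [exact Hk|]. split; [auto|apply (omega_subset Hk L)]. }
        destruct L as (n & Hn & Hkn & Hmn).
        assert (Hpn : p ∈ minimals U n empty).
        { apply (minimals_mono Hmn), in_minimals. split; [exact Hp|].
          split; [intros z Hz; elim (in_empty Hz)|].
          apply injects_trans with p; [|apply equipotent_injects, Em].
          apply subset_injects. intros z Hz. apply in_diff in Hz. apply Hz. }
        assert (HpP : p ∈ sep (power P) (fun p => minimal U p)).
        { rewrite in_sep, in_power by dfn. split; [|exact Hp]. intros z Hz.
          assert (T := cantor_subset_prod Hf' (Spf' z Hz)). apply in_prod in T.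
          destruct T as (x & i & Hx & Hi & ->). apply opair_in_prod. split; [|exact Hi].
          apply in_bigcup. exists (support n). rewrite in_img by dfn. split; [eauto|].
          apply (in_support Hkn HU Hpn Hz). }
        rewrite E, in_sep in HpP by dfn. destruct HpP as (_ & _ & S & _).
        apply S, in_cylinder. split; [|exact Hpf].
        apply (open_subset HT (proj1 (c_regular Hk HU)) Hf). }
      intros U V HU HV E. apply subset_antisym; apply K; auto.
    - apply (finite_subset (finite_power (finite_power FP))). intros s Hs.
      rewrite in_img in Hs by dfn. destruct Hs as (U & _ & ->). apply in_power. intros p Hp.
      rewrite in_sep in Hp by dfn. apply Hp. }
  apply omega_infinite. refine (finite_injects _ (finite_power FR)).
  exists c. split; [exact Dc|]. split; [|exact c_inj]. intros n Hn. apply in_power. intros U HU.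
  apply in_bigcup. exists (c n). rewrite in_img by exact Dc. eauto.
Qed.

Lemma sequence_denumerable : exists D, denumerable D /\ forall s, s ∈ D -> s ⊆ X /\ finite s.
Proof.
  destruct (img_denumerable_subset DT_support supports_infinite) as (D & HD & S).
  exists D. split; [exact HD|]. intros s Hs. apply S in Hs. rewrite in_img in Hs by dfn.
  destruct Hs as (n & Hn & ->). split; [|apply support_finite, Hn].
  intros x Hx. unfold support in Hx. rewrite in_sep in Hx by dfn. apply Hx.
Qed.

End Sequence.

(** The members of a cellular family are replaced by their regularizations, to which
    [minimals_finite] applies. These stay distinct, because a nonempty open set contained in the
    regularization of another open set meets that set. *)
Lemma cellular_denumerable : has_denumerable_cellular_family TY ->
  exists D, denumerable D /\ forall s, s ∈ D -> s ⊆ X /\ finite s.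
Proof.
  intros (F & (HF & NF & DF) & Den).
  destruct (denumerable_enum Den) as (e & De & He & Ie & _).
  apply sequence_denumerable with (c := fun n => sing (regularization cantor TY (e n))).
  - dfn.
  - intros m n Hm Hn E.
    assert (K : regularization cantor TY (e m) = regularization cantor TY (e n)).
    { apply in_sing. rewrite <- E. apply in_sing. reflexivity. }
    apply Ie; trivial. apply NNPP. intros N.
    assert (Om := HF _ (He m Hm)). assert (On := HF _ (He n Hn)).
    destruct (NF _ (He m Hm)) as (x & Hx).
    destruct (meets_regularization HT (U := e n) Om) as (z & Hz & Hz').
    + exists x. split; [exact Hx|]. rewrite <- K. apply (regularization_subset HT Om Hx).
    + apply (DF _ _ (He m Hm) (He n Hn) N z Hz Hz').
  - intros n _. apply finite_sing.
  - intros n U _ HU. apply in_sing in HU. subst U. apply (regularization_regular HT).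
Qed.

Lemma regular_matrix_denumerable : has_regular_matrix cantor TY ->
  exists D, denumerable D /\ forall s, s ∈ D -> s ⊆ X /\ finite s.
Proof.
  intros (c & w & Hw & Hc & Ic & H). apply is_omegaE in Hw. subst w.
  apply sequence_denumerable with (c := fun n => app c n).
  - dfn.
  - intros m n Hm Hn E. apply (Ic m n (app c m)); [|rewrite E]; apply (family_app Hc); assumption.
  - intros n Hn. apply (H n _ (family_app Hc Hn)).
  - intros n U Hn HU. apply (regular_openP HT). destruct (H n _ (family_app Hc Hn)) as (_ & _ & R & _).
    apply R, HU.
Qed.

End Space.

Lemma cantor_cube_exists : exists I TI C TC TY : M,
  is_unit_interval I TI /\ is_tychonoff_cube X C TC /\ is_subspace cantor TY C TC /\
  is_topology cantor TY /\
  forall W, W ∈ TY <->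
    W ⊆ cantor /\ forall f, f ∈ W -> exists p, finite p /\ p ⊆ f /\ cylinder p ⊆ W.
Proof.
  destruct (unit_interval_exists (M := M)) as (I & TI & HI).
  set (C := sep (power (prod X I)) (fun f => is_function f X I)).
  assert (HC : C ≐ fun f => is_function f X I).
  { intros f. unfold C. rewrite in_sep, in_power by dfn. split; [tauto|]. intros H. split; [|exact H].
    intros z Hz. apply (family_in _ (proj1 H)) in Hz. destruct Hz as (x & Hx & ->).
    apply opair_in_prod. split; [exact Hx|apply (function_app H Hx)]. }
  destruct (generated_topology_exists (X := C) (S := fun U => exists x V, x ∈ X /\ V ∈ TI /\
      U ≐ fun f => f ∈ C /\ exists y, maps f x y /\ y ∈ V)) as (TC & HTC).
  - dfn.
  - intros U (x & V & _ & _ & HU) f Hf. apply HU in Hf. apply Hf.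
  - set (TY := sep (power cantor) (fun W => exists U, U ∈ TC /\ is_inter W U cantor)).
    assert (HY : is_subspace cantor TY C TC).
    { split; [apply (cantor_cube HI HC)|]. intros W. unfold TY. rewrite in_sep, in_power by dfn.
      split; [tauto|]. intros H. split; [|exact H]. destruct H as (U & _ & H). intros f Hf.
      apply H in Hf. apply Hf. }
    exists I, TI, C, TC, TY. split; [exact HI|]. split; [exists I, TI; auto|]. split; [exact HY|].
    split; [apply (subspace_topology (proj1 HTC) HY)|]. apply (cube_subspace_open HI HC HTC HY).
Qed.

End CantorCube.

(** * The equivalences *)

Theorem corollary6p9 (M : set_structure) (hZF : is_ZF_model M) (hQPKW : QPKW M) :
  let i := IQDI M in
  let ii := forall X T : M, infinite X -> is_topology X T ->
    zero_dimensional X T -> hausdorff X T -> has_denumerable_cellular_family T in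
  let iii := forall X T : M, infinite X -> is_topology X T ->
    hausdorff X T -> has_denumerable_cellular_family T in
  let iv := forall X T : M, infinite X -> is_topology X T ->
    tychonoff X T -> has_denumerable_cellular_family T in
  let v := forall X C TC Y TY : M, infinite X -> is_tychonoff_cube X C TC ->
    is_subspace Y TY C TC -> infinite Y -> has_denumerable_cellular_family TY in
  let vi := forall X T : M, infinite X -> is_topology X T ->
    hausdorff X T -> has_regular_matrix X T in
  (i <-> ii) /\ (i <-> iii) /\ (i <-> iv) /\ (i <-> v) /\ (i <-> vi).
Proof.
  intros i ii iii iv v vi.
  (* Condition (iii) yields (ii), (iv) and (v), while each of (ii), (iv), (v) and (vi) returns to
     (i) by way of the one space [cantor X]. *)
  assert (i_iii : i -> iii).
  { intros H X T HX HT HH. exact (IQDI_cellular H HT HX HH hQPKW). }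
  assert (i_vi : i -> vi).
  { intros H X T HX HT HH. exact (IQDI_regular_matrix H HT HX HH). }
  assert (iii_iv : iii -> iv).
  { intros H X T HX HT HH. apply (H X T HX HT), (tychonoff_hausdorff HT HH). }
  assert (iii_v : iii -> v).
  { intros H X C TC Y TY HX HC HY Inf.
    assert (HT : is_topology C TC) by (destruct HC as (I & TI & _ & _ & G); apply G).
    apply (H Y TY Inf (subspace_topology HT HY)).
    apply (subspace_hausdorff HY), (cube_hausdorff HC). }
  assert (ii_i : ii -> i).
  { intros H X HX. destruct (cantor_cube_exists X) as (I & TI & C & TC & TY & HI & HC & HY & HT & K).
    apply (cellular_denumerable K HT), (H (cantor X) TY); trivial.
    - apply cantor_infinite, HX.
    - apply (cantor_zero_dimensional K).
    - apply (cantor_hausdorff K). }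
  assert (iv_i : iv -> i).
  { intros H X HX. destruct (cantor_cube_exists X) as (I & TI & C & TC & TY & HI & HC & HY & HT & K).
    apply (cellular_denumerable K HT), (H (cantor X) TY); trivial.
    - apply cantor_infinite, HX.
    - apply (cantor_tychonoff K HI). }
  assert (v_i : v -> i).
  { intros H X HX. destruct (cantor_cube_exists X) as (I & TI & C & TC & TY & HI & HC & HY & HT & K).
    apply (cellular_denumerable K HT), (H X C TC (cantor X) TY); trivial.
    apply cantor_infinite, HX. }
  assert (vi_i : vi -> i).
  { intros H X HX. destruct (cantor_cube_exists X) as (I & TI & C & TC & TY & HI & HC & HY & HT & K).
    apply (regular_matrix_denumerable K HT), (H (cantor X) TY); trivial.
    - apply cantor_infinite, HX.
    - apply (cantor_hausdorff K). }
  assert (iii_ii : iii -> ii) by (intros H X T HX HT _ HH; exact (H X T HX HT HH)).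
  repeat split; auto.
Qed.
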